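(* Let $n\geq 4$ and $1\leq q<\infty$, $1\le p\le\infty$. The maximal operator $A_*$ is bounded from $\ell^{p}(\mathbb{Z})\times\cdots\times\ell^{p}(\mathbb{Z})$ ($n$ factors) to $\ell^{q}(\mathbb{Z})$, i.e. there is a constant $C$ such that \[\|A_*[f_1,\dots,f_n]\|_{\ell^q(\mathbb{Z})}\leq C\prod_{i=1}^n\|f_i\|_{\ell^p(\mathbb{Z})}\quad\text{for all } f_1,\dots,f_n:\mathbb{Z}\to\mathbb{C},\] if and only if $n\geq 5$ and $1\leq p\leq nq$.
   Context: Fix an integer $n\geq 4$. For an integer $\lambda\geq1$ let $r(\lambda)=\#\{x=(x_1,\dots,x_n)\in\mathbb{Z}^n: x_1^2+\cdots+x_n^2=\lambda\}$ (which is positive for all $\lambda\ge1$ when $n\ge4$). For functions $f_1,\dots,f_n:\mathbb{Z}\to\mathbb{C}$ and $y\in\mathbb{Z}$ define the multilinear spherical averages \[A_\lambda[f_1,\dots,f_n](y)=\frac{1}{r(\lambda)}\sum_{x\in\mathbb{Z}^n,\ |x|^2=\lambda} f_1(y-x_1)\cdots f_n(y-x_n),\] where $|x|^2=x_1^2+\cdots+x_n^2$, and the maximal operator \[A_*[f_1,\dots,f_n](y)=\sup_{\lambda\in\mathbb{Z},\,\lambda\geq1}\big|A_\lambda[f_1,\dots,f_n](y)\big|.\] *)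

(* Defs.v *)
From Stdlib Require Import Reals ZArith List.
Import ListNotations.
Open Scope R_scope.

Record Cx := mkCx { Re : R; Im : R }.
Definition C0 : Cx := mkCx 0 0.
Definition C1 : Cx := mkCx 1 0.
Definition Cadd (a b : Cx) : Cx := mkCx (Re a + Re b) (Im a + Im b).
Definition Cmul (a b : Cx) : Cx :=
  mkCx (Re a * Re b - Im a * Im b) (Re a * Im b + Im a * Re b).
Definition Cscale (t : R) (a : Cx) : Cx := mkCx (t * Re a) (t * Im a).
Definition Cmod (a : Cx) : R := sqrt (Re a * Re a + Im a * Im a).

(** x^p for x >= 0 and real p > 0, with 0^p = 0. *)
Definition rpow (x p : R) : R := if Rle_dec x 0 then 0 else Rpower x p.

Inductive exponent := PFin (p : R) | PInf.
Definition exp_ge1 (p : exponent) : Prop :=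
  match p with PFin r => 1 <= r | PInf => True end.
Definition exp_le (p : exponent) (t : R) : Prop :=
  match p with PFin r => r <= t | PInf => False end.

Definition zrange (N : nat) : list Z :=
  map (fun k => (Z.of_nat k - Z.of_nat N)%Z) (seq 0 (2 * N + 1)).

Definition Rsum_list (l : list R) : R := fold_right Rplus 0 l.

Fixpoint lattice (n m : nat) : list (list Z) :=
  match n with
  | O => [[]]
  | S n' => flat_map (fun a => map (fun v => a :: v) (lattice n' m)) (zrange m)
  end.

Definition sumsq (x : list Z) : Z := fold_right (fun a s => (a * a + s)%Z) 0%Z x.

(** points of Z^n on the sphere |x|^2 = lambda (lambda >= 1); every such point
    has |x_i| <= lambda, so the box [-lambda, lambda]^n contains them all. *)
Definition sphere (n lam : nat) : list (list Z) :=
  filter (fun x => Z.eqb (sumsq x) (Z.of_nat lam)) (lattice n lam).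

Definition r (n lam : nat) : nat := length (sphere n lam).

Fixpoint prodf (f : nat -> Z -> Cx) (i : nat) (y : Z) (x : list Z) : Cx :=
  match x with
  | [] => C1
  | a :: xs => Cmul (f i (y - a)%Z) (prodf f (S i) y xs)
  end.

Definition Aavg (n : nat) (f : nat -> Z -> Cx) (lam : nat) (y : Z) : Cx :=
  Cscale (/ INR (r n lam))
    (fold_right Cadd C0 (map (fun x => prodf f 0 y x) (sphere n lam))).

Definition Amax_trunc (n : nat) (f : nat -> Z -> Cx) (L : nat) (y : Z) : R :=
  fold_right Rmax 0 (map (fun lam => Cmod (Aavg n f lam y)) (seq 1 L)).

Definition lp_norm_le (p : exponent) (g : Z -> Cx) (M : R) : Prop :=
  match p with
  | PFin pr => forall N : nat,
      Rsum_list (map (fun y => rpow (Cmod (g y)) pr) (zrange N)) <= rpow M pr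
  | PInf => forall y : Z, Cmod (g y) <= M
  end.

Fixpoint prod_upto (M : nat -> R) (n : nat) : R :=
  match n with O => 1 | S k => prod_upto M k * M k end.

(** A_* : l^p x ... x l^p -> l^q bounded (q finite).  ||A_* f||_q <= K is
    expressed as: for all truncations N (|y| <= N) and L (1 <= lambda <= L),
    sum_{|y|<=N} (max_{lambda<=L} |A_lambda f(y)|)^q <= K^q (monotone
    convergence). ||f_i||_p is expressed through arbitrary upper bounds M_i. *)
Definition Astar_bounded (n : nat) (p : exponent) (q : R) : Prop :=
  exists C : R, forall (f : nat -> Z -> Cx) (M : nat -> R),
    (forall i, (i < n)%nat -> 0 <= M i /\ lp_norm_le p (f i) (M i)) ->
    forall N L : nat,
      Rsum_list (map (fun y => rpow (Amax_trunc n f L y) q) (zrange N))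
        <= rpow (C * prod_upto M n) q.

(* Main.v *)
(** For [n >= 5] the average over the sphere of squared radius [lam] is bounded pointwise by
    [C (1/N * sum_{|a| <= N} F(y-a)^s)^(n/s)], where [N = sqrt lam], [F] is the maximum of the
    [|f_i|] (each of norm 1) and [s = 8n/9]. As [s < n], the Hardy-Littlewood maximal theorem on [l^(nq/s)] gives
    [l^(nq) x ... x l^(nq) -> l^q], including [q = 1].

    Upper bound for the sum over the sphere: keep only the two largest factors
    ([G = F^(n/2)] at two coordinates) and write the result as
    [1/P sum_j |S_G(j/P)|^2 |K(j/P)|^(n-2)], with [S_G(t) = sum G(a) e(a^2 t)] and
    [K(t) = sum_{|a| <= N} e(a^2 t)]. Weyl differencing gives
    [|K(b/q + beta)|^2 <= C (N^2/q) (1 + N^2 |beta|)^(-3/4) + C N^(5/4)]. For fixed [q] and [beta],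
    [sum_b |S_G(b/q + beta)|^2] is [q] times a correlation of [G] over the pairs with
    [a^2 = a'^2 (mod q)], where Schur's test saves about [q^(7/8)]. What is left is essentially
    the convergent series [sum_q q^(-3/2) q q^(-7/8)].

    Lower bound [r_n(lam) >= c N^(n-2)]: for [n = 5] it follows from [r_4(u) >= 8 u], [u] odd,
    a consequence of Jacobi's theorem on four odd squares.

    Necessity: indicators of long intervals force [p <= n q]; for [n = 4] the spheres of squared
    radius [4^k] have boundedly many points, and delta functions give a counterexample. *)
Require Import Defs.
From Stdlib Require Import Reals ZArith List.
From Stdlib Require Import Lra Lia Permutation Classical Znumtheory Factorial.
Import ListNotations.
Open Scope R_scope.
Local Arguments Z.mul : simpl never.
Local Arguments Z.add : simpl never.
Local Arguments Z.sub : simpl never.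

(** * Finite sums and real powers *)

(** The exponent 9/8 explains the numerology. At q = 1 and p = n, the choice s = n would require a
    strong maximal theorem on l^1, which is false. So [G] has to be measured in a norm below l^2,
    here l^(16/9), and s = (n/2)(16/9) = 8n/9. The price is paid in Schur's test: interpolating
    between the l^2 bound and the trivial l^1 bound saves q^(7/8) instead of q, which the series
    over q can afford. Two factors are kept, so n - 2 copies of [K] remain, and n >= 5 supplies the
    cube |K|^3 and with it q^(-3/2). With the |K|^2 of n = 4 the series would be sum_q q^(-1) q
    q^(-7/8), which diverges. The decay exponent 3/4 in Weyl's bound, instead of 1, avoids
    logarithms; its 3/2 power 9/8 still exceeds 1, so the offsets beta can be summed. The error
    N^(5/4) becomes N^(15/8) = N^3 N^(-9/8), the same power of N as the main term. Only upper bounds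
    for nonnegative sums occur, so the equation |x|^2 = lam may be relaxed to a congruence mod P and
    the circle replaced by the grid j/P. *)

Definition lsum {A : Type} (l : list A) (f : A -> R) : R := Rsum_list (map f l).

Definition indic (b : bool) : R := if b then 1 else 0.

Section ListSums.
Context {A : Type}.
Implicit Types (l : list A) (f g : A -> R).

Lemma lsum_cons a l f : lsum (a :: l) f = f a + lsum l f.
Proof. reflexivity. Qed.

Lemma lsum_single a f : lsum [a] f = f a.
Proof. unfold lsum; simpl; lra. Qed.

Lemma lsum_app l l' f : lsum (l ++ l') f = lsum l f + lsum l' f.
Proof.
  induction l as [|a l IH]; simpl; [unfold lsum; simpl; lra|].
  rewrite !lsum_cons, IH; lra.
Qed.

Lemma lsum_ext l f g : (forall a, In a l -> f a = g a) -> lsum l f = lsum l g.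
Proof. intros H. unfold lsum. f_equal. now apply map_ext_in. Qed.

Lemma lsum_le l f g : (forall a, In a l -> f a <= g a) -> lsum l f <= lsum l g.
Proof.
  induction l as [|a l IH]; intros H; [unfold lsum; simpl; lra|].
  rewrite !lsum_cons. apply Rplus_le_compat; [apply H; now left|].
  apply IH; intros; apply H; now right.
Qed.

Lemma lsum_zero l : lsum l (fun _ => 0) = 0.
Proof. induction l as [|a l IH]; [reflexivity|rewrite lsum_cons, IH; lra]. Qed.

Lemma lsum_nonneg l f : (forall a, In a l -> 0 <= f a) -> 0 <= lsum l f.
Proof. intros H. rewrite <- (lsum_zero l). now apply lsum_le. Qed.

Lemma lsum_plus l f g : lsum l (fun a => f a + g a) = lsum l f + lsum l g.
Proof.
  induction l as [|a l IH]; [unfold lsum; simpl; lra|].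
  rewrite !lsum_cons, IH; lra.
Qed.

Lemma lsum_scal l f c : lsum l (fun a => c * f a) = c * lsum l f.
Proof.
  induction l as [|a l IH]; [unfold lsum; simpl; lra|].
  rewrite !lsum_cons, IH; lra.
Qed.

Lemma lsum_const l c : lsum l (fun _ => c) = c * INR (length l).
Proof.
  induction l as [|a l IH]; [unfold lsum; simpl; lra|].
  rewrite lsum_cons, IH. simpl length. rewrite S_INR. lra.
Qed.

Lemma lsum_Rabs l f : Rabs (lsum l f) <= lsum l (fun a => Rabs (f a)).
Proof.
  induction l as [|a l IH]; [unfold lsum; simpl; rewrite Rabs_R0; lra|].
  rewrite !lsum_cons. eapply Rle_trans; [apply Rabs_triang|lra].
Qed.

Lemma lsum_filter l f p : lsum (filter p l) f = lsum l (fun a => indic (p a) * f a).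
Proof.
  induction l as [|a l IH]; [reflexivity|].
  simpl. unfold indic at 1. rewrite lsum_cons. destruct (p a) eqn:E;
    rewrite ?lsum_cons, IH; unfold indic at 1; try rewrite E; lra.
Qed.

Lemma lsum_perm l l' f : Permutation l l' -> lsum l f = lsum l' f.
Proof. induction 1; rewrite ?lsum_cons in *; lra. Qed.

Lemma lsum_eq_set l l' f :
  NoDup l -> NoDup l' -> (forall a, In a l <-> In a l') -> lsum l f = lsum l' f.
Proof. intros. apply lsum_perm. now apply NoDup_Permutation. Qed.

Lemma lsum_incl l l' f :
  NoDup l -> incl l l' -> (forall a, In a l' -> 0 <= f a) -> lsum l f <= lsum l' f.
Proof.
  revert l'. induction l as [|a l IH]; intros l' Hn Hi H.
  - now apply lsum_nonneg.
  - destruct (in_split a l') as (l1 & l2 & ->); [apply Hi; now left|].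
    rewrite (lsum_perm (l1 ++ a :: l2) (a :: l1 ++ l2)) by (symmetry; apply Permutation_middle).
    rewrite !lsum_cons. apply Rplus_le_compat_l. inversion Hn; subst.
    apply IH; [assumption| |].
    + intros b Hb. assert (Hb' := Hi b (or_intror Hb)).
      apply in_app_or in Hb'. apply in_or_app. destruct Hb' as [|[->|]]; tauto.
    + intros b Hb. apply H. apply in_app_or in Hb. apply in_or_app. simpl. tauto.
Qed.

Lemma lsum_term l f a : In a l -> (forall b, In b l -> 0 <= f b) -> f a <= lsum l f.
Proof.
  intros Ha H. replace (f a) with (lsum [a] f) by (unfold lsum; simpl; lra).
  apply lsum_incl; auto; [repeat constructor; auto|]. intros b [<-|[]]; auto.
Qed.

Lemma lsum_mult_l l f c : lsum l f * c = lsum l (fun a => f a * c).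
Proof. rewrite Rmult_comm, <- lsum_scal. apply lsum_ext; intros; ring. Qed.

End ListSums.

Lemma lsum_map {A B : Type} (h : A -> B) (l : list A) (f : B -> R) :
  lsum (map h l) f = lsum l (fun a => f (h a)).
Proof. unfold lsum. now rewrite map_map. Qed.

Lemma lsum_flat_map {A B : Type} (h : A -> list B) (l : list A) (f : B -> R) :
  lsum (flat_map h l) f = lsum l (fun a => lsum (h a) f).
Proof.
  induction l as [|a l IH]; [reflexivity|].
  simpl. now rewrite lsum_app, lsum_cons, IH.
Qed.

Lemma lsum_exchange {A B : Type} (l : list A) (l' : list B) (f : A -> B -> R) :
  lsum l (fun a => lsum l' (f a)) = lsum l' (fun b => lsum l (fun a => f a b)).
Proof.
  induction l as [|a l IH].
  - unfold lsum at 1; simpl. symmetry. apply lsum_zero.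
  - rewrite lsum_cons, IH, <- lsum_plus. apply lsum_ext; intros. now rewrite lsum_cons.
Qed.

Lemma length_lsum {A : Type} (l : list A) : INR (length l) = lsum l (fun _ => 1).
Proof. rewrite lsum_const; lra. Qed.

Lemma lsum_inj_le {A B : Type} (h : A -> B) (l : list A) (l' : list B) (f : B -> R) :
  NoDup l -> (forall a a', In a l -> In a' l -> h a = h a' -> a = a') ->
  (forall a, In a l -> In (h a) l') -> (forall b, In b l' -> 0 <= f b) ->
  lsum l (fun a => f (h a)) <= lsum l' f.
Proof.
  intros Hn Hi Hm Hf. rewrite <- (lsum_map h). apply lsum_incl; auto.
  - clear Hm Hf. induction l as [|a l IH]; simpl; constructor; inversion Hn; subst.
    + rewrite in_map_iff. intros (b & E & Hb). apply Hi in E; simpl; auto. congruence.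
    + apply IH; auto. intros; apply Hi; simpl; auto.
  - intros b Hb. apply in_map_iff in Hb as (a & <- & Ha); auto.
Qed.

Lemma length_inj_le {A B : Type} (h : A -> B) (l : list A) (l' : list B) :
  NoDup l -> (forall a a', In a l -> In a' l -> h a = h a' -> a = a') ->
  (forall a, In a l -> In (h a) l') -> (length l <= length l')%nat.
Proof.
  intros. apply INR_le. rewrite !length_lsum.
  apply (lsum_inj_le h l l' (fun _ => 1)); auto. intros; lra.
Qed.

Lemma lsum_invol {A : Type} (h : A -> A) (l : list A) (f : A -> R) :
  NoDup l -> (forall a, In a l -> In (h a) l) -> (forall a, In a l -> h (h a) = a) ->
  lsum l (fun a => f (h a)) = lsum l f.
Proof.
  intros Hn Hm Hh. rewrite <- (lsum_map h). apply lsum_eq_set; auto.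
  - assert (Hi : forall a a', In a l -> In a' l -> h a = h a' -> a = a').
    { intros a a' Ha Ha' E. rewrite <- (Hh a), <- (Hh a'), E; auto. }
    clear Hm Hh. induction l as [|a l IH]; simpl; constructor; inversion Hn; subst.
    + rewrite in_map_iff. intros (b & E & Hb). apply Hi in E; simpl; auto. congruence.
    + apply IH; auto. intros; apply Hi; simpl; auto.
  - intros b; split; intros Hb.
    + apply in_map_iff in Hb as (a & <- & Ha); auto.
    + apply in_map_iff. exists (h b); auto.
Qed.

(** * Integer intervals *)

Definition zseq (a : Z) (n : nat) : list Z :=
  map (fun k => (a + Z.of_nat k)%Z) (seq 0 n).

Lemma in_zseq a n x : In x (zseq a n) <-> (a <= x < a + Z.of_nat n)%Z.
Proof.
  unfold zseq. rewrite in_map_iff. split.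
  - intros (k & <- & Hk). apply in_seq in Hk. lia.
  - intros H. exists (Z.to_nat (x - a)). split; [lia|]. apply in_seq. lia.
Qed.

Lemma NoDup_map_inj {A B : Type} (h : A -> B) (l : list A) :
  (forall a a', h a = h a' -> a = a') -> NoDup l -> NoDup (map h l).
Proof.
  intros Hi Hn. induction Hn as [|a l Ha Hn IH]; simpl; constructor; auto.
  rewrite in_map_iff. intros (b & E & Hb). apply Hi in E. congruence.
Qed.

Lemma NoDup_zseq a n : NoDup (zseq a n).
Proof. apply NoDup_map_inj; [intros; lia|apply seq_NoDup]. Qed.

Lemma length_zseq a n : length (zseq a n) = n.
Proof. unfold zseq. now rewrite length_map, length_seq. Qed.

Lemma zseq_app a m n : zseq a (m + n) = zseq a m ++ zseq (a + Z.of_nat m) n.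
Proof.
  unfold zseq. rewrite seq_app, map_app. f_equal. simpl.
  rewrite <- (Nat.add_0_r m) at 1.
  revert m. generalize 0%nat as s. induction n as [|n IH]; intros s m; simpl; [reflexivity|].
  f_equal; [lia|]. specialize (IH (S s) m). rewrite <- IH. f_equal. f_equal. lia.
Qed.

Lemma zseq_S a n : zseq a (S n) = zseq a n ++ [(a + Z.of_nat n)%Z].
Proof.
  replace (S n) with (n + 1)%nat by lia. rewrite zseq_app. f_equal.
  unfold zseq; simpl. now rewrite Z.add_0_r.
Qed.

Lemma zrange_zseq N : zrange N = zseq (- Z.of_nat N) (2 * N + 1).
Proof. unfold zrange, zseq. apply map_ext. intros; lia. Qed.

Lemma in_zrange N x : In x (zrange N) <-> (Z.abs x <= Z.of_nat N)%Z.
Proof. rewrite zrange_zseq, in_zseq. lia. Qed.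

Lemma NoDup_zrange N : NoDup (zrange N).
Proof. rewrite zrange_zseq. apply NoDup_zseq. Qed.

Lemma length_zrange N : length (zrange N) = (2 * N + 1)%nat.
Proof. rewrite zrange_zseq. apply length_zseq. Qed.

Lemma lsum_shift (f : Z -> R) a n c :
  lsum (zseq a n) (fun x => f (x + c)%Z) = lsum (zseq (a + c) n) f.
Proof.
  unfold zseq. rewrite !lsum_map. apply lsum_ext; intros. f_equal. lia.
Qed.

(** * Real powers, extended by 0 to x <= 0 *)

Section Rpow.
Implicit Types x y a b : R.

Lemma rpow_pos_eq x a : 0 < x -> rpow x a = Rpower x a.
Proof. intros H. unfold rpow. destruct (Rle_dec x 0); [lra|reflexivity]. Qed.

Lemma rpow_0 a : rpow 0 a = 0.
Proof. unfold rpow. destruct (Rle_dec 0 0); [reflexivity|lra]. Qed.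

Lemma rpow_nonneg x a : 0 <= rpow x a.
Proof.
  unfold rpow. destruct (Rle_dec x 0); [lra|]. left. apply exp_pos.
Qed.

Lemma rpow_pos x a : 0 < x -> 0 < rpow x a.
Proof. intros H. rewrite rpow_pos_eq by easy. apply exp_pos. Qed.

Lemma rpow_1 x : 0 <= x -> rpow x 1 = x.
Proof.
  intros [H|<-]; [|apply rpow_0]. rewrite rpow_pos_eq by easy. now apply Rpower_1.
Qed.

Lemma rpow_one a : rpow 1 a = 1.
Proof. rewrite rpow_pos_eq by lra. unfold Rpower. rewrite ln_1, Rmult_0_r. apply exp_0. Qed.

Lemma rpow_rpow x a b : rpow (rpow x a) b = rpow x (a * b).
Proof.
  destruct (Rle_dec x 0) as [H|H].
  - unfold rpow at 2 3. destruct (Rle_dec x 0); [|lra]. apply rpow_0.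
  - assert (0 < x) by lra. rewrite (rpow_pos_eq x), rpow_pos_eq by (auto; apply exp_pos).
    rewrite Rpower_mult. now rewrite rpow_pos_eq.
Qed.

Lemma rpow_mult x y a : 0 <= x -> 0 <= y -> rpow (x * y) a = rpow x a * rpow y a.
Proof.
  intros [Hx|<-] [Hy|<-]; rewrite ?Rmult_0_l, ?Rmult_0_r, ?rpow_0; try lra.
  rewrite !rpow_pos_eq by (auto; nra). symmetry. now apply Rpower_mult_distr.
Qed.

Lemma rpow_plus x a b : rpow x (a + b) = rpow x a * rpow x b.
Proof.
  unfold rpow. destruct (Rle_dec x 0); [lra|]. apply Rpower_plus.
Qed.

Lemma rpow_le x y a : 0 <= a -> x <= y -> rpow x a <= rpow y a.
Proof.
  intros Ha H. destruct (Rle_dec x 0) as [H0|H0].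
  - unfold rpow at 1. destruct (Rle_dec x 0); [|lra]. apply rpow_nonneg.
  - rewrite !rpow_pos_eq by lra. destruct Ha as [Ha|<-].
    + destruct H as [H|<-]; [|lra]. left. apply Rlt_Rpower_l; lra.
    + rewrite !Rpower_O by lra. lra.
Qed.

Lemma rpow_le_exp x a b : 1 <= x -> a <= b -> rpow x a <= rpow x b.
Proof. intros. rewrite !rpow_pos_eq by lra. now apply Rle_Rpower. Qed.

Lemma rpow_opp x a : 0 < x -> rpow x (- a) = / rpow x a.
Proof. intros. rewrite !rpow_pos_eq by lra. apply Rpower_Ropp. Qed.

Lemma rpow_inv x a : 0 < x -> rpow (/ x) a = / rpow x a.
Proof.
  intros H. assert (rpow x a > 0) by now apply rpow_pos.
  apply Rmult_eq_reg_l with (rpow x a); [|lra].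
  rewrite <- rpow_mult by (try lra; left; now apply Rinv_0_lt_compat).
  rewrite !Rinv_r by lra. apply rpow_one.
Qed.

Lemma rpow_le_small x a b : 0 <= x <= 1 -> a <= b -> rpow x b <= rpow x a.
Proof.
  intros [[Hx|<-] H1] Hab; [|rewrite !rpow_0; lra].
  rewrite <- (Rinv_inv x), !(rpow_inv (/ x)) by now apply Rinv_0_lt_compat.
  apply Rinv_le_contravar; [apply rpow_pos; now apply Rinv_0_lt_compat|].
  apply rpow_le_exp; auto. rewrite <- Rinv_1. now apply Rinv_le_contravar.
Qed.

Lemma rpow_le_neg x y a : 0 <= a -> 0 < x -> x <= y -> rpow y (- a) <= rpow x (- a).
Proof.
  intros. rewrite !rpow_opp by lra. apply Rinv_le_contravar; [now apply rpow_pos|].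
  now apply rpow_le.
Qed.

Lemma rpow_INR x n : 0 < x -> rpow x (INR n) = x ^ n.
Proof. intros. rewrite rpow_pos_eq by easy. now apply Rpower_pow. Qed.

Lemma rpow_zero_exp x : 0 < x -> rpow x 0 = 1.
Proof. intros. rewrite rpow_pos_eq by easy. now apply Rpower_O. Qed.

Lemma rpow_sum_le x y a : 0 <= a -> 0 <= x -> 0 <= y ->
  rpow (x + y) a <= rpow 2 a * (rpow x a + rpow y a).
Proof.
  intros Ha Hx Hy. assert (H2 := rpow_nonneg 2 a).
  assert (H3 := rpow_nonneg x a). assert (H4 := rpow_nonneg y a).
  destruct (Rle_dec x y).
  - apply Rle_trans with (rpow (2 * y) a); [apply rpow_le; lra|].
    rewrite rpow_mult by lra. nra.
  - apply Rle_trans with (rpow (2 * x) a); [apply rpow_le; lra|].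
    rewrite rpow_mult by lra. nra.
Qed.

End Rpow.

(** * Jacobi's formula for four odd squares *)

Section OddSquares.
Context (B : nat).

Definition odds : list Z := filter Z.odd (zrange B).

(** On generating series this is multiplication by theta(x), the sum of x^(j^2) over odd j with |j|
    <= B, and [conv_sq'] is multiplication by x theta'(x). The cutoff does not affect the
    coefficients of index at most [B] in powers of theta. *)
Definition conv_sq (g : Z -> R) (M : Z) : R := lsum odds (fun j => g (M - j * j)%Z).

Definition conv_sq' (g : Z -> R) (M : Z) : R :=
  lsum odds (fun j => IZR (j * j) * g (M - j * j)%Z).

Fixpoint odd_rep (k : nat) : Z -> R :=
  match k with
  | O => fun M => indic (Z.eqb M 0)
  | S k' => conv_sq (odd_rep k')
  end.

Lemma in_odds j : In j odds <-> (Z.abs j <= Z.of_nat B)%Z /\ Z.odd j = true.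
Proof. unfold odds. rewrite filter_In, in_zrange. tauto. Qed.

Lemma NoDup_odds : NoDup odds.
Proof. apply NoDup_filter, NoDup_zrange. Qed.

Lemma conv_sq_ext g h M : (forall m, g m = h m) -> conv_sq g M = conv_sq h M.
Proof. intros H. apply lsum_ext; auto. Qed.

(** Leibniz rule for x d/dx, which multiplies the coefficient of x^M by M: write M = (M - j^2) +
    j^2. *)
Lemma conv_sq_derivation g M :
  IZR M * conv_sq g M = conv_sq (fun m => IZR m * g m) M + conv_sq' g M.
Proof.
  unfold conv_sq, conv_sq'. rewrite <- lsum_plus, <- lsum_scal.
  apply lsum_ext; intros j _. rewrite minus_IZR. ring.
Qed.

Lemma conv_sq_comm g M : conv_sq (conv_sq' g) M = conv_sq' (conv_sq g) M.
Proof.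
  unfold conv_sq, conv_sq'. rewrite lsum_exchange. apply lsum_ext; intros j _.
  rewrite <- lsum_scal. apply lsum_ext; intros i _. f_equal. f_equal. ring.
Qed.

(** By symmetry the sum of [x_1^2] over a sphere is a fixed fraction of the sum of [|x|^2]. *)
Lemma odd_rep_symmetry k M : IZR M * odd_rep (S k) M = INR (S k) * conv_sq' (odd_rep k) M.
Proof.
  revert M. induction k as [|k IH]; intros M.
  - change (odd_rep 1) with (conv_sq (odd_rep 0)). rewrite conv_sq_derivation.
    rewrite (conv_sq_ext _ (fun _ => 0)).
    + unfold conv_sq at 1. rewrite lsum_zero. simpl INR. ring.
    + intros m. simpl. destruct (Z.eqb_spec m 0); subst; simpl; ring.
  - change (odd_rep (S (S k))) with (conv_sq (odd_rep (S k))).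
    rewrite conv_sq_derivation, (conv_sq_ext _ _ _ IH).
    replace (conv_sq (fun m => INR (S k) * conv_sq' (odd_rep k) m) M)
      with (INR (S k) * conv_sq (conv_sq' (odd_rep k)) M)
      by (unfold conv_sq; now rewrite lsum_scal).
    rewrite conv_sq_comm. change (conv_sq (odd_rep k)) with (odd_rep (S k)).
    rewrite (S_INR (S k)). ring.
Qed.

(** The two sides of [odd_rep_symmetry] written out over j. The terms j = 1 and j = -1 carry the
    largest argument M - 1, with coefficient M - (k + 1), so the relation determines the
    coefficients of theta^k recursively. *)
Lemma odd_rep_recurrence k M :
  lsum odds (fun j => (IZR M - INR (S k) * IZR (j * j)) * odd_rep k (M - j * j)%Z) = 0.
Proof.
  assert (H := odd_rep_symmetry k M).
  change (odd_rep (S k)) with (conv_sq (odd_rep k)) in H. unfold conv_sq, conv_sq' in H.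
  rewrite <- !lsum_scal in H.
  rewrite (lsum_ext _ _ (fun j => IZR M * odd_rep k (M - j * j)%Z
     + (-1) * (INR (S k) * (IZR (j * j) * odd_rep k (M - j * j)%Z))))
    by (intros; ring).
  rewrite lsum_plus, (lsum_scal _ _ (-1)). lra.
Qed.

Lemma odd_rep_small k M : (M < Z.of_nat k)%Z -> odd_rep k M = 0.
Proof.
  revert M. induction k as [|k IH]; intros M H.
  - simpl. destruct (Z.eqb_spec M 0); [lia|reflexivity].
  - simpl. unfold conv_sq. rewrite <- (lsum_zero odds). apply lsum_ext; intros j Hj.
    apply IH. apply in_odds in Hj as [_ Hj]. destruct (Z.eq_dec j 0); [subst; discriminate|nia].
Qed.

Lemma lsum_odds_pm1 f : (1 <= B)%nat ->
  (forall j, In j odds -> (3 <= Z.abs j)%Z -> f j = 0) -> lsum odds f = f 1%Z + f (-1)%Z.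
Proof.
  intros HB H. transitivity (lsum [1%Z; (-1)%Z] f); [|unfold lsum; simpl; ring].
  transitivity (lsum (filter (fun j => Z.abs j =? 1)%Z odds) f).
  - rewrite lsum_filter. apply lsum_ext; intros j Hj.
    destruct (Z.eqb_spec (Z.abs j) 1); simpl; [ring|].
    rewrite H; auto; [ring|]. apply in_odds in Hj as [_ Hj].
    destruct (Z.eq_dec j 0), (Z.eq_dec j 2), (Z.eq_dec j (-2)); subst; try discriminate. lia.
  - apply lsum_eq_set; [apply NoDup_filter, NoDup_odds| |].
    + repeat constructor; simpl; lia.
    + intros j. rewrite filter_In, in_odds, Z.eqb_eq. simpl. split; [lia|].
      intros [<-|[<-|[]]]; simpl; repeat split; auto; lia.
Qed.

Lemma odd_rep_diag k : (1 <= B)%nat -> odd_rep k (Z.of_nat k) = 2 ^ k.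
Proof.
  intros HB. induction k as [|k IH]; [reflexivity|].
  change (odd_rep (S k)) with (conv_sq (odd_rep k)). unfold conv_sq.
  rewrite lsum_odds_pm1; auto.
  - replace (Z.of_nat (S k) - 1 * 1)%Z with (Z.of_nat k) by lia.
    replace (Z.of_nat (S k) - -1 * -1)%Z with (Z.of_nat k) by lia.
    rewrite IH. simpl. ring.
  - intros j Hj H3. apply odd_rep_small. nia.
Qed.

(** * The same recurrence for sums of divisors *)

Definition pairs : list (Z * Z) := list_prod (zseq 1 B) (zseq 1 B).

Lemma in_pairs d e : In (d, e) pairs <-> (1 <= d <= Z.of_nat B /\ 1 <= e <= Z.of_nat B)%Z.
Proof. unfold pairs. rewrite in_prod_iff, !in_zseq. lia. Qed.

Lemma NoDup_list_prod {S T : Type} (l : list S) (l' : list T) :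
  NoDup l -> NoDup l' -> NoDup (list_prod l l').
Proof.
  intros Hl Hl'. induction Hl as [|a l Ha Hl IH]; simpl; [constructor|].
  apply NoDup_app; auto.
  - apply NoDup_map_inj; auto. congruence.
  - intros [s t] H1 H2. apply in_map_iff in H1 as (t' & E & _). inversion E; subst.
    apply in_prod_iff in H2. tauto.
Qed.

Lemma lsum_list_prod {S T : Type} (l : list S) (l' : list T) (f : S * T -> R) :
  lsum (list_prod l l') f = lsum l (fun a => lsum l' (fun b => f (a, b))).
Proof.
  induction l as [|a l IH]; [reflexivity|]. simpl.
  now rewrite lsum_app, lsum_map, lsum_cons, IH.
Qed.

(** The sum of the divisors of u, for 1 <= u <= B. Writing it over factorizations u = d e lets it
    merge with a sum over j into one sum over [triples]. *)
Definition sigma1 (u : Z) : R := lsum pairs (fun p => indic (fst p * snd p =? u)%Z * IZR (fst p)).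

Definition triples (M : Z) : list (Z * (Z * Z)) :=
  filter (fun t => let '(j, (d, e)) := t in (j * j + 4 * (d * e) =? M)%Z)
    (list_prod (zrange B) pairs).

Lemma in_triples M j d e : (M <= Z.of_nat B)%Z ->
  In (j, (d, e)) (triples M) <-> (0 < d /\ 0 < e /\ j * j + 4 * (d * e) = M)%Z.
Proof.
  intros HM. unfold triples. rewrite filter_In, in_prod_iff, in_zrange, in_pairs, Z.eqb_eq.
  split; [lia|]. intros (Hd & He & H). repeat split; try lia; nia.
Qed.

Lemma NoDup_triples M : NoDup (triples M).
Proof.
  apply NoDup_filter, NoDup_list_prod; [apply NoDup_zrange|].
  apply NoDup_list_prod; apply NoDup_zseq.
Qed.

Lemma not_square_5_mod_8 x M : (M mod 8 = 5 -> x * x <> M)%Z.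
Proof.
  intros H E. subst. rewrite <- Zmult_mod_idemp_l, <- Zmult_mod_idemp_r in H.
  assert (Hx : (0 <= x mod 8 < 8)%Z) by (apply Z.mod_pos_bound; lia).
  revert H Hx. generalize (x mod 8)%Z. intros y H Hy.
  assert (y = 0 \/ y = 1 \/ y = 2 \/ y = 3 \/ y = 4 \/ y = 5 \/ y = 6 \/ y = 7)%Z as D by lia.
  decompose [or] D; subst; discriminate.
Qed.

(** [j^2 + 4 d e] is the discriminant of the form [d X^2 + j X Y - e Y^2]. The maps [tau] and
    [psi] below come from changes of variables; together they generate a dihedral group of
    order 12, and the cubic [(d + e) (d + j) (e - j)] is invariant under [tau] and
    anti-invariant under [psi]. *)
Lemma triples_cubic M : (M <= Z.of_nat B)%Z -> (M mod 8 = 5)%Z ->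
  lsum (triples M) (fun t => let '(j, (d, e)) := t in IZR ((d + e) * (d + j) * (e - j))) = 0.
Proof.
  intros HB H5.
  set (f := fun t : Z * (Z * Z) => let '(j, (d, e)) := t in IZR ((d + e) * (d + j) * (e - j))).
  set (inA := fun t : Z * (Z * Z) => let '(j, (d, e)) := t in (j + d <? e)%Z).
  set (tau := fun t : Z * (Z * Z) => let '(j, (d, e)) := t in ((- j)%Z, (e, d))).
  set (psi := fun t : Z * (Z * Z) => let '(j, (d, e)) := t in ((- j - 2 * d)%Z, (d, (e - j - d)%Z))).
  (* The involution [psi] preserves the region j + d < e and changes the sign of the cubic. *)
  assert (HA : lsum (filter inA (triples M)) f = 0).
  { assert (H : lsum (filter inA (triples M)) (fun t => f (psi t))
                = lsum (filter inA (triples M)) f).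
    { apply (lsum_invol psi).
      - apply NoDup_filter, NoDup_triples.
      - intros (j & d & e). rewrite !filter_In. simpl. rewrite !in_triples, !Z.ltb_lt by auto.
        intros [(Hd & He & Hj) HA]. repeat split; try lia.
      - intros (j & d & e) _. simpl. f_equal; [lia|f_equal; lia]. }
    rewrite (lsum_ext _ (fun t => f (psi t)) (fun t => -1 * f t)) in H.
    - rewrite lsum_scal in H. lra.
    - intros (j & d & e) _. unfold f, psi.
      change (-1) with (IZR (-1)). rewrite <- mult_IZR. f_equal. ring. }
  assert (HT : lsum (triples M) (fun t => indic (inA (tau t)) * f (tau t))
               = lsum (triples M) (fun t => indic (inA t) * f t)).
  { apply (lsum_invol tau (triples M) (fun t => indic (inA t) * f t)).
    - apply NoDup_triples.
    - intros (j & d & e). simpl. rewrite !in_triples by auto. intros (Hd & He & Hj). repeat split; lia.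
    - intros (j & d & e) _. simpl. f_equal. lia. }
  rewrite lsum_filter in HA. rewrite HA in HT.
  rewrite (lsum_ext _ _ (fun t => indic (inA t) * f t + indic (inA (tau t)) * f (tau t))).
  - rewrite lsum_plus. lra.
  - intros (j & d & e) Ht. apply in_triples in Ht as (Hd & He & Hj); auto.
    replace (f (tau (j, (d, e)))) with (f (j, (d, e))) by (unfold f, tau; f_equal; ring).
    (* [tau] exchanges the two sides of e = j + d. On the boundary M would be the square (j + 2d)^2,
       which is excluded mod 8. *)
    simpl. assert (e <> j + d)%Z.
    { intros ->. apply (not_square_5_mod_8 (j + 2 * d) M); auto. rewrite <- Hj. ring. }
    destruct (Z.ltb_spec (j + d) e), (Z.ltb_spec (- j + e) d); simpl; try lia; ring.
Qed.

(** The cubic is (d + e)(d e - j^2) + (d + e) j (e - d). The second part is odd in j and sums to 0.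
    The first is the sum of d (d e - j^2) and its image under exchange of d and e, so it sums to
    twice the left side. *)
Lemma triples_identity M : (M <= Z.of_nat B)%Z -> (M mod 8 = 5)%Z ->
  lsum (triples M) (fun t => let '(j, (d, e)) := t in IZR (d * (d * e - j * j))) = 0.
Proof.
  intros HB H5. assert (H0 := triples_cubic M HB H5).
  set (f1 := fun t : Z * (Z * Z) => let '(j, (d, e)) := t in IZR (d * (d * e - j * j))).
  set (f2 := fun t : Z * (Z * Z) => let '(j, (d, e)) := t in IZR ((d + e) * j * (e - d))).
  set (neg := fun t : Z * (Z * Z) => let '(j, (d, e)) := t in ((- j)%Z, (d, e))).
  set (swap := fun t : Z * (Z * Z) => let '(j, (d, e)) := t in (j, (e, d))).
  assert (Hneg : lsum (triples M) (fun t => f2 (neg t)) = lsum (triples M) f2).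
  { apply (lsum_invol neg).
    - apply NoDup_triples.
    - intros (j & d & e). simpl. rewrite !in_triples by auto. intros (Hd & He & Hj). repeat split; lia.
    - intros (j & d & e) _. simpl. f_equal. lia. }
  assert (Hsw : lsum (triples M) (fun t => f1 (swap t)) = lsum (triples M) f1).
  { apply (lsum_invol swap).
    - apply NoDup_triples.
    - intros (j & d & e). simpl. rewrite !in_triples by auto. intros (Hd & He & Hj). repeat split; lia.
    - intros (j & d & e) _. reflexivity. }
  rewrite (lsum_ext _ (fun t => f2 (neg t)) (fun t => -1 * f2 t)), lsum_scal in Hneg.
  2:{ intros (j & d & e) _. unfold f2, neg.
      change (-1) with (IZR (-1)). rewrite <- mult_IZR. f_equal. ring. }
  rewrite (lsum_ext _ _ (fun t => (f1 t + f1 (swap t)) + f2 t)) in H0.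
  2:{ intros (j & d & e) _. unfold f1, f2, swap. rewrite <- !plus_IZR. f_equal. ring. }
  rewrite !lsum_plus in H0. fold f1. lra.
Qed.

(** If M = j^2 + 4 d e, then M - 5 j^2 = 4 (d e - j^2), so this is 4 times [triples_identity], the
    weight d adding up to [sigma1]. Even j contribute nothing to that identity because M is odd. *)
Lemma sigma1_recurrence M : (M <= Z.of_nat B)%Z -> (M mod 8 = 5)%Z ->
  lsum odds (fun j => (IZR M - 5 * IZR (j * j)) * sigma1 ((M - j * j) / 4)) = 0.
Proof.
  intros HB H5. assert (H := triples_identity M HB H5).
  unfold triples in H. rewrite lsum_filter, lsum_list_prod in H.
  unfold odds. rewrite lsum_filter.
  transitivity (4 * 0); [|ring]. rewrite <- H, <- lsum_scal.
  apply lsum_ext; intros j _. unfold sigma1. rewrite <- !lsum_scal.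
  apply lsum_ext; intros (d & e) _. simpl fst; simpl snd.
  destruct (Z.odd j) eqn:Ej; simpl.
  - apply Z.odd_spec in Ej as (i & ->).
    assert (HM : exists m, (M = 8 * m + 5)%Z) by (exists (M / 8)%Z; pose proof (Z.div_mod M 8); lia).
    destruct HM as (m & ->).
    replace ((8 * m + 5 - (2 * i + 1) * (2 * i + 1)) / 4)%Z with (2 * m + 1 - i * i - i)%Z.
    2:{ apply Z.div_unique_exact; [lia|ring]. }
    destruct (Z.eqb_spec ((2 * i + 1) * (2 * i + 1) + 4 * (d * e)) (8 * m + 5)) as [E|E],
      (Z.eqb_spec (d * e) (2 * m + 1 - i * i - i)) as [E'|E']; simpl; try lia; try ring.
    rewrite <- E. rewrite !plus_IZR, !mult_IZR, !minus_IZR, !mult_IZR, !plus_IZR, !mult_IZR. ring.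
  - destruct (Z.eqb_spec (j * j + 4 * (d * e)) M) as [E|E]; simpl; [|ring].
    exfalso. rewrite <- Z.negb_even in Ej. apply Bool.negb_false_iff, Z.even_spec in Ej as (i & ->).
    pose proof (Z.div_mod M 8). nia.
Qed.

Lemma sigma1_neg u : (u <= 0)%Z -> sigma1 u = 0.
Proof.
  intros Hu. unfold sigma1. rewrite <- (lsum_zero pairs). apply lsum_ext; intros (d & e) H.
  apply in_pairs in H. simpl. destruct (Z.eqb_spec (d * e) u); simpl; [nia|ring].
Qed.

Lemma sigma1_ge u : (0 < u <= Z.of_nat B)%Z -> IZR u <= sigma1 u.
Proof.
  intros Hu. unfold sigma1.
  replace (IZR u) with ((fun p => indic (fst p * snd p =? u)%Z * IZR (fst p)) (u, 1%Z)).
  2:{ simpl. rewrite Z.mul_1_r, Z.eqb_refl. simpl. ring. }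
  apply (lsum_term pairs (fun p => indic (fst p * snd p =? u)%Z * IZR (fst p))).
  - apply in_pairs. lia.
  - intros (d & e) H. apply in_pairs in H. simpl. apply Rmult_le_pos.
    + unfold indic. destruct (_ =? _)%Z; lra.
    + apply IZR_le. lia.
Qed.

Lemma sigma1_1 : (1 <= B)%nat -> sigma1 1 = 1.
Proof.
  intros HB. unfold sigma1.
  rewrite (lsum_ext _ _ (fun p => indic (fst p * snd p =? 1)%Z * 1)).
  - rewrite <- lsum_filter. transitivity (lsum [(1%Z, 1%Z)] (fun _ => 1)).
    + apply lsum_eq_set.
      * apply NoDup_filter, NoDup_list_prod; apply NoDup_zseq.
      * repeat constructor. simpl. tauto.
      * intros (d & e). rewrite filter_In, in_pairs, Z.eqb_eq. simpl. split.
        -- intros [Hde E]. left. f_equal; nia.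
        -- intros [E|[]]. inversion E; subst. lia.
    + unfold lsum; simpl; ring.
  - intros (d & e) H. apply in_pairs in H. simpl.
    destruct (Z.eqb_spec (d * e) 1); simpl; [|ring]. replace d with 1%Z by nia. ring.
Qed.

(** Both sides satisfy the same recurrence. *)
Lemma four_odd_squares (n : nat) u : (0 < u <= Z.of_nat n)%Z -> Z.odd u = true ->
  (4 * u + 1 <= Z.of_nat B)%Z -> odd_rep 4 (4 * u) = 16 * sigma1 u.
Proof.
  revert u. induction n as [|n IH]; intros u Hu Ho HB; [lia|].
  (* At u = 1 the leading coefficient M - 5 = 4 (u - 1) vanishes and the recurrence gives no
     information; this value is computed directly. *)
  destruct (Z.eq_dec u 1) as [->|Hu1].
  { rewrite sigma1_1 by lia. change (4 * 1)%Z with (Z.of_nat 4).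
    rewrite odd_rep_diag by lia. simpl. ring. }
  apply Z.odd_spec in Ho as (w & Ew).
  set (M := (4 * u + 1)%Z).
  assert (HM8 : (M mod 8 = 5)%Z).
  { unfold M. rewrite Ew. replace (4 * (2 * w + 1) + 1)%Z with (5 + w * 8)%Z by ring.
    now rewrite Z_mod_plus_full. }
  assert (H1 := odd_rep_recurrence 4 M). assert (H2 := sigma1_recurrence M HB HM8).
  assert (H3 : lsum odds (fun j => (IZR M - 5 * IZR (j * j)) *
     (odd_rep 4 (M - j * j)%Z - 16 * sigma1 ((M - j * j) / 4))) = 0).
  { rewrite (lsum_ext _ _ (fun j => (IZR M - INR 5 * IZR (j * j)) * odd_rep 4 (M - j * j)%Z
      + -16 * ((IZR M - 5 * IZR (j * j)) * sigma1 ((M - j * j) / 4)))).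
    - rewrite lsum_plus, lsum_scal, H1, H2. ring.
    - intros j _. replace (INR 5) with 5 by (simpl; ring). ring. }
  rewrite lsum_odds_pm1 in H3; [|lia|].
  - change (-1 * -1)%Z with (1 * 1)%Z in H3.
    replace (M - 1 * 1)%Z with (4 * u)%Z in H3 by (unfold M; ring).
    replace (4 * u / 4)%Z with u in H3 by (apply Z.div_unique_exact; lia).
    assert (5 < IZR M) by (apply IZR_lt; unfold M; lia).
    change (IZR (1 * 1)) with 1 in H3.
    assert (H4 : (IZR M - 5) * (odd_rep 4 (4 * u) - 16 * sigma1 u) = 0) by lra.
    apply Rmult_integral in H4. destruct H4; lra.
  (* For the other j one has M - j^2 = 4 u' with u' odd, since i (i + 1) is even, and u' < u. Either
     the induction hypothesis applies or both terms vanish. *)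
  - intros j Hj Hj3. apply in_odds in Hj as [_ Hj]. apply Z.odd_spec in Hj as (i & Ej).
    set (u' := (2 * w + 1 - i * i - i)%Z).
    assert (E : (M - j * j = 4 * u')%Z) by (unfold M, u'; rewrite Ew, Ej; ring).
    rewrite E. replace (4 * u' / 4)%Z with u' by (apply Z.div_unique_exact; lia).
    destruct (Z_le_gt_dec u' 0) as [Hu'|Hu'].
    + rewrite sigma1_neg by auto. rewrite odd_rep_small; [ring|simpl; lia].
    + rewrite IH; [ring| | |].
      * assert (u' < u)%Z by (unfold M in E; nia). lia.
      * rewrite Z.odd_spec.
        destruct (Z.Even_or_Odd i) as [[k ->]|[k ->]]; unfold u'.
        -- exists (w - 2 * k * k - k)%Z. ring.
        -- exists (w - 2 * k * k - 3 * k - 1)%Z. ring.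
      * unfold M in E. nia.
Qed.

End OddSquares.

(** * Lower bounds for the number of representations *)

Fixpoint words (J : list Z) (n : nat) : list (list Z) :=
  match n with
  | O => [[]]
  | S n' => flat_map (fun a => map (fun v => a :: v) (words J n')) J
  end.

Lemma lattice_words n m : lattice n m = words (zrange m) n.
Proof. induction n as [|n IH]; simpl; [|rewrite IH]; reflexivity. Qed.

Lemma lsum_words_S J n f :
  lsum (words J (S n)) f = lsum J (fun a => lsum (words J n) (fun v => f (a :: v))).
Proof. simpl. rewrite lsum_flat_map. apply lsum_ext; intros. now rewrite lsum_map. Qed.

Lemma NoDup_flat_map_cons {A : Type} (h : A -> Z) (l : list A) (F : A -> list (list Z)) :
  (forall a b, h a = h b -> a = b) -> NoDup l -> (forall a, In a l -> NoDup (F a)) ->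
  NoDup (flat_map (fun a => map (fun v => h a :: v) (F a)) l).
Proof.
  intros Hh Hl HF. induction Hl as [|a l Ha Hl IH]; simpl; [constructor|].
  apply NoDup_app.
  - apply NoDup_map_inj; [congruence|]. apply HF. now left.
  - apply IH. intros; apply HF; now right.
  - intros x H1 H2. apply in_map_iff in H1 as (v & <- & _).
    apply in_flat_map in H2 as (b & Hb & H2). apply in_map_iff in H2 as (w & E & _).
    inversion E. apply Hh in H0. congruence.
Qed.

Lemma NoDup_words J n : NoDup J -> NoDup (words J n).
Proof.
  intros HJ. induction n as [|n IH]; simpl; [repeat constructor; simpl; tauto|].
  apply (NoDup_flat_map_cons (fun a => a)); auto.
Qed.

Lemma in_words J n x : In x (words J n) <-> length x = n /\ Forall (fun a => In a J) x.
Proof.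
  revert x. induction n as [|n IH]; intros x; simpl.
  - split; [intros [<-|[]]; auto|]. intros [H _]. destruct x; [auto|discriminate].
  - rewrite in_flat_map. split.
    + intros (a & Ha & H). apply in_map_iff in H as (v & <- & Hv). apply IH in Hv as [Hv HF].
      simpl. split; [congruence|]. now constructor.
    + intros [Hl HF]. destruct x as [|a v]; [discriminate|]. inversion HF; subst.
      exists a; split; auto. apply in_map_iff. exists v; split; auto. apply IH.
      simpl in Hl. split; [congruence|auto].
Qed.

Lemma sumsq_nonneg x : (0 <= sumsq x)%Z.
Proof. induction x as [|a x IH]; simpl; nia. Qed.

Lemma sumsq_coord x a : In a x -> (a * a <= sumsq x)%Z.
Proof.
  induction x as [|b x IH]; simpl; [tauto|].
  intros [->|H]; [pose proof (sumsq_nonneg x); lia|]. specialize (IH H). nia.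
Qed.

Lemma in_sphere n lam x :
  In x (sphere n lam) <-> length x = n /\ sumsq x = Z.of_nat lam.
Proof.
  unfold sphere. rewrite filter_In, lattice_words, in_words, Z.eqb_eq. split; [tauto|].
  intros [Hl Hs]. repeat split; auto. apply Forall_forall. intros a Ha.
  apply in_zrange. apply sumsq_coord in Ha. nia.
Qed.

Lemma NoDup_sphere n lam : NoDup (sphere n lam).
Proof. apply NoDup_filter. rewrite lattice_words. apply NoDup_words, NoDup_zrange. Qed.

Lemma odd_rep_count B k M :
  odd_rep B k M = INR (length (filter (fun x => sumsq x =? M)%Z (words (odds B) k))).
Proof.
  rewrite length_lsum, lsum_filter.
  rewrite (lsum_ext _ _ (fun x => indic (sumsq x =? M)%Z)) by (intros; ring).
  revert M. induction k as [|k IH]; intros M.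
  - change (indic (M =? 0)%Z = indic (0 =? M)%Z + 0). rewrite Z.eqb_sym. ring.
  - rewrite lsum_words_S. simpl. unfold conv_sq. apply lsum_ext; intros a _.
    rewrite IH. apply lsum_ext; intros v _. f_equal.
    destruct (Z.eqb_spec (sumsq v) (M - a * a)), (Z.eqb_spec (a * a + sumsq v) M); auto; lia.
Qed.

(** Half of the odd points on the sphere of squared radius [4 u] have coordinate sum divisible
    by [4], and [H / 4], with [H] a Hadamard matrix, maps them to integer points of squared
    radius [u]. *)
Lemma r4_odd u : Nat.odd u = true -> 8 * INR u <= INR (r 4 u).
Proof.
  intros Hu.
  assert (Hu0 : (0 < u)%nat) by (destruct u; [discriminate|lia]).
  set (B := (4 * u + 1)%nat).
  set (X := filter (fun x => sumsq x =? 4 * Z.of_nat u)%Z (words (odds B) 4)).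
  set (good := fun x : list Z => (fold_right Z.add 0 x mod 4 =? 0)%Z).
  assert (HX : INR (length X) = 16 * sigma1 B (Z.of_nat u)).
  { unfold X. rewrite <- odd_rep_count. apply (four_odd_squares B u); unfold B; try lia.
    apply Nat.odd_spec in Hu as (w & ->). rewrite Z.odd_spec. exists (Z.of_nat w). lia. }
  assert (HXn : NoDup X) by (apply NoDup_filter, NoDup_words, NoDup_odds).
  assert (Hin : forall x, In x X <-> exists a b c d : Z, x = [2*a+1; 2*b+1; 2*c+1; 2*d+1]%Z /\
     (sumsq [2*a+1; 2*b+1; 2*c+1; 2*d+1] = 4 * Z.of_nat u)%Z).
  { intros x. unfold X. rewrite filter_In, in_words, Z.eqb_eq. split.
    - intros [[Hl HF] Hs].
      destruct x as [|a [|b [|c [|d [|]]]]]; try discriminate. clear Hl.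
      rewrite Forall_forall in HF.
      assert (Ho : forall y, In y [a; b; c; d] -> exists w, y = (2 * w + 1)%Z).
      { intros y Hy. apply HF, in_odds in Hy as [_ Hy]. now apply Z.odd_spec in Hy. }
      destruct (Ho a) as (a' & ->), (Ho b) as (b' & ->), (Ho c) as (c' & ->), (Ho d) as (d' & ->);
        simpl; auto 10.
      exists a', b', c', d'. auto.
    - intros (a & b & c & d & -> & Hs). repeat split; auto. apply Forall_forall. intros y Hy.
      apply in_odds. split.
      + apply sumsq_coord in Hy. unfold B. nia.
      + simpl in Hy. rewrite Z.odd_spec. decompose [or] Hy; try tauto; eexists; eauto. }
  (* Changing the sign of one odd coordinate shifts the coordinate sum by 2 mod 4, so it sends bad
     points to good ones. *)
  assert (H2 : (length X <= 2 * length (filter good X))%nat).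
  { rewrite <- (filter_length good X).
    enough (length (filter (fun x => negb (good x)) X) <= length (filter good X))%nat by lia.
    apply (length_inj_le (fun x => match x with [] => [] | a :: v => (- a)%Z :: v end)).
    - now apply NoDup_filter.
    - intros x y Hx Hy. apply filter_In in Hx as [Hx _], Hy as [Hy _].
      apply Hin in Hx as (a & b & c & d & -> & _), Hy as (a' & b' & c' & d' & -> & _).
      intros E. inversion E. repeat f_equal; lia.
    - intros x Hx. apply filter_In in Hx as [Hx Hg].
      apply Hin in Hx as (a & b & c & d & -> & Hs). apply filter_In. split.
      + apply Hin. exists (- a - 1)%Z, b, c, d. split; [f_equal; lia|]. rewrite <- Hs. simpl. ring.
      + unfold good in *. simpl in *. apply Z.eqb_eq.
        apply Bool.negb_true_iff, Z.eqb_neq in Hg.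
        Z.to_euclidean_division_equations; lia. }
  assert (H3 : (length (filter good X) <= r 4 u)%nat).
  { apply (length_inj_le (fun x => match x with
      | [a; b; c; d] => [(a+b+c+d)/4; (a+b-c-d)/4; (a-b+c-d)/4; (a-b-c+d)/4]%Z
      | _ => [] end)).
    - now apply NoDup_filter.
    - intros x y Hx Hy. apply filter_In in Hx as [Hx Gx], Hy as [Hy Gy].
      apply Hin in Hx as (a & b & c & d & -> & _), Hy as (a' & b' & c' & d' & -> & _).
      unfold good in *. simpl in *. apply Z.eqb_eq in Gx, Gy.
      intros E. injection E as E1 E2 E3 E4.
      Z.to_euclidean_division_equations. repeat f_equal; lia.
    - intros x Hx. apply filter_In in Hx as [Hx Gx].
      apply Hin in Hx as (a & b & c & d & -> & Hs). apply in_sphere. split; [reflexivity|].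
      unfold good in *. simpl in *. apply Z.eqb_eq in Gx.
      remember ((2*a+1+(2*b+1)+(2*c+1)+(2*d+1))/4)%Z as p1 eqn:E1.
      remember ((2*a+1+(2*b+1)-(2*c+1)-(2*d+1))/4)%Z as p2 eqn:E2.
      remember ((2*a+1-(2*b+1)+(2*c+1)-(2*d+1))/4)%Z as p3 eqn:E3.
      remember ((2*a+1-(2*b+1)-(2*c+1)+(2*d+1))/4)%Z as p4 eqn:E4.
      assert (F1 : (4 * p1 = 2*a+1+(2*b+1)+(2*c+1)+(2*d+1))%Z)
        by (subst p1; Z.to_euclidean_division_equations; lia).
      assert (F2 : (4 * p2 = 2*a+1+(2*b+1)-(2*c+1)-(2*d+1))%Z)
        by (subst p2; Z.to_euclidean_division_equations; lia).
      assert (F3 : (4 * p3 = 2*a+1-(2*b+1)+(2*c+1)-(2*d+1))%Z)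
        by (subst p3; Z.to_euclidean_division_equations; lia).
      assert (F4 : (4 * p4 = 2*a+1-(2*b+1)-(2*c+1)+(2*d+1))%Z)
        by (subst p4; Z.to_euclidean_division_equations; lia).
      clear E1 E2 E3 E4.
      (* The Hadamard matrix is symmetric with square 4 I, so it also expresses the old point
         through the new one, and the squared norm drops by a factor 4. *)
      replace (2*a+1)%Z with (p1+p2+p3+p4)%Z in Hs by lia.
      replace (2*b+1)%Z with (p1+p2-p3-p4)%Z in Hs by lia.
      replace (2*c+1)%Z with (p1-p2+p3-p4)%Z in Hs by lia.
      replace (2*d+1)%Z with (p1-p2-p3+p4)%Z in Hs by lia.
      clear -Hs. nia. }
  assert (H4 := sigma1_ge B (Z.of_nat u)). rewrite <- INR_IZR_INZ in H4.
  assert (H5 : INR u <= sigma1 B (Z.of_nat u)) by (apply H4; unfold B; lia).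
  apply le_INR in H2, H3. rewrite mult_INR in H2. simpl (INR 2) in H2. lra.
Qed.

Lemma r_slice n lam (A : list nat) : NoDup A -> (forall a, In a A -> (a * a <= lam)%nat) ->
  lsum A (fun a => INR (r n (lam - a * a))) <= INR (r (S n) lam).
Proof.
  intros HA Ha.
  set (L := flat_map (fun a => map (fun v => Z.of_nat a :: v) (sphere n (lam - a * a))) A).
  apply Rle_trans with (INR (length L)).
  - right. rewrite length_lsum. unfold L. rewrite lsum_flat_map. apply lsum_ext; intros.
    rewrite lsum_map. now rewrite <- length_lsum.
  - apply le_INR. apply NoDup_incl_length.
    + apply (NoDup_flat_map_cons Z.of_nat); auto; [intros; lia|]. intros; apply NoDup_sphere.
    + intros x Hx. apply in_flat_map in Hx as (a & Hx & Hv).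
      apply in_map_iff in Hv as (v & <- & Hv). apply in_sphere in Hv as [Hl Hs].
      apply in_sphere. simpl. rewrite Hs. specialize (Ha a Hx). split; [congruence|lia].
Qed.

(** Coordinates a <= m leave at least lam / 2 for the remaining ones, and there are m + 1 >= sqrt
    lam / 2 such values. *)
Lemma sqrt_half_bounds lam : let m := Nat.sqrt (lam / 2) in
  (2 * (m * m) <= lam)%nat /\ sqrt (INR lam) <= 2 * (INR m + 1).
Proof.
  intros m. pose proof (Nat.sqrt_spec (lam / 2) ltac:(lia)) as H. fold m in H.
  pose proof (Nat.div_mod lam 2 ltac:(lia)) as H'.
  pose proof (Nat.mod_upper_bound lam 2 ltac:(lia)) as H''.
  split; [lia|].
  rewrite <- (sqrt_square (2 * (INR m + 1))) by (pose proof (pos_INR m); lra).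
  apply sqrt_le_1_alt. rewrite <- S_INR.
  replace (2 * INR (S m) * (2 * INR (S m))) with (INR (4 * (S m * S m)))
    by (rewrite !mult_INR; simpl (INR 4); ring).
  apply le_INR. lia.
Qed.

(** Give one coordinate the parity opposite to that of lam: what is left for the other four is odd
    and at least lam / 2, so [r4_odd] gives at least 4 lam completions. There are at least sqrt lam
    / 8 such choices, whence the constant 1/2. *)
Lemma r5_lower lam : (1 <= lam)%nat -> sqrt (INR lam) ^ 3 / 2 <= INR (r 5 lam).
Proof.
  intros Hl. destruct (sqrt_half_bounds lam) as [Hm Hs].
  set (m := Nat.sqrt (lam / 2)) in *.
  assert (Hk : exists e k : nat, (m + 1 <= 4 * k)%nat /\
     forall i, (i < k)%nat -> (2 * i + e <= m)%nat /\ Nat.odd (lam - (2*i+e)*(2*i+e)) = true).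
  { destruct (Nat.Even_or_Odd lam) as [[w Hw]|[w Hw]].
    - assert (1 <= m)%nat.
      { unfold m. apply Nat.sqrt_le_square. rewrite Hw, (Nat.mul_comm 2 w), Nat.div_mul; lia. }
      exists 1%nat, ((m - 1) / 2 + 1)%nat.
      pose proof (Nat.div_mod (m - 1) 2 ltac:(lia)).
      pose proof (Nat.mod_upper_bound (m - 1) 2 ltac:(lia)).
      split; [lia|]. intros i Hi. split; [lia|].
      assert ((2 * i + 1) * (2 * i + 1) <= m * m)%nat by (apply Nat.mul_le_mono; lia).
      apply Nat.odd_spec. exists (w - 2 * (i * i) - 2 * i - 1)%nat. nia.
    - exists 0%nat, (m / 2 + 1)%nat.
      pose proof (Nat.div_mod m 2 ltac:(lia)).
      pose proof (Nat.mod_upper_bound m 2 ltac:(lia)).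
      split; [lia|]. intros i Hi. split; [lia|].
      assert ((2 * i + 0) * (2 * i + 0) <= m * m)%nat by (apply Nat.mul_le_mono; lia).
      apply Nat.odd_spec. exists (w - 2 * (i * i))%nat. nia. }
  destruct Hk as (e & k & Hk & Hi).
  set (s := sqrt (INR lam)) in *.
  assert (Hs2 : s * s = INR lam) by (apply sqrt_sqrt, pos_INR).
  assert (Hs0 : 0 <= s) by apply sqrt_pos.
  apply Rle_trans with (lsum (map (fun i => 2 * i + e)%nat (seq 0 k))
    (fun a => INR (r 4 (lam - a * a)))).
  2:{ apply r_slice.
      - apply NoDup_map_inj; [intros; lia|apply seq_NoDup].
      - intros a Ha. apply in_map_iff in Ha as (i & <- & H). apply in_seq in H.
        destruct (Hi i) as [H' _]; [lia|].
        pose proof (Nat.mul_le_mono _ _ _ _ H' H'). lia. }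
  rewrite lsum_map.
  apply Rle_trans with (lsum (seq 0 k) (fun _ => 4 * INR lam)).
  - rewrite lsum_const, length_seq, <- Hs2.
    apply le_INR in Hk. rewrite plus_INR, mult_INR in Hk. simpl in Hk.
    replace (s ^ 3 / 2) with (s * s * (s / 2)) by field. nra.
  - apply lsum_le. intros i H. apply in_seq in H. destruct (Hi i) as [H1 H2]; [lia|].
    eapply Rle_trans; [|apply r4_odd, H2].
    pose proof (Nat.mul_le_mono _ _ _ _ H1 H1).
    assert (H4 : (lam <= 2 * (lam - (2*i+e)*(2*i+e)))%nat) by lia.
    apply le_INR in H4. rewrite mult_INR in H4. simpl (INR 2) in H4. lra.
Qed.

Lemma r_lower n : (5 <= n)%nat ->
  exists c, 0 < c /\ forall lam, (1 <= lam)%nat -> c * sqrt (INR lam) ^ (n - 2) <= INR (r n lam).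
Proof.
  intros Hn. induction Hn as [|n Hn (c & Hc & IH)].
  - exists (/ 2). split; [lra|]. intros lam Hl. pose proof (r5_lower lam Hl). simpl (5 - 2)%nat. lra.
  (* 2^(n-2) because each slice keeps at least half of the radius, and one more 2 because at least
     sqrt lam / 2 slices are counted. *)
  - exists (c * / 2 ^ (n - 1)). split; [apply Rmult_lt_0_compat; auto; apply Rinv_0_lt_compat, pow_lt; lra|].
    intros lam Hl. destruct (sqrt_half_bounds lam) as [Hm Hs].
    set (m := Nat.sqrt (lam / 2)) in *. set (s := sqrt (INR lam)) in *.
    assert (Hs0 : 0 <= s) by apply sqrt_pos.
    assert (Ha : forall a, In a (seq 0 (S m)) -> (2 * (a * a) <= lam)%nat).
    { intros a H. apply in_seq in H. assert (a <= m)%nat as Ha by lia.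
      pose proof (Nat.mul_le_mono _ _ _ _ Ha Ha). lia. }
    eapply Rle_trans; [|apply (r_slice n lam (seq 0 (S m)))].
    + apply Rle_trans with (lsum (seq 0 (S m)) (fun _ => c * (s / 2) ^ (n - 2))).
      * rewrite lsum_const, length_seq, S_INR.
        replace (S n - 2)%nat with (S (n - 2)) by lia. replace (n - 1)%nat with (S (n - 2)) by lia.
        replace (c * / 2 ^ S (n - 2) * s ^ S (n - 2)) with (c * (s / 2) ^ S (n - 2))
          by (unfold Rdiv; rewrite Rpow_mult_distr, pow_inv; ring).
        rewrite <- tech_pow_Rmult.
        assert (0 <= (s / 2) ^ (n - 2)) by (apply pow_le; lra).
        assert (0 <= c * (s / 2) ^ (n - 2)) by (apply Rmult_le_pos; lra). nra.
      * apply lsum_le. intros a H. specialize (Ha a H). eapply Rle_trans; [|apply IH; lia].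
        apply Rmult_le_compat_l; [lra|]. apply pow_incr. split; [lra|].
        rewrite <- (sqrt_square (s / 2)) by lra. apply sqrt_le_1_alt.
        replace (s / 2 * (s / 2)) with (s * s / 4) by field.
        unfold s. rewrite sqrt_sqrt by apply pos_INR.
        assert (H4 : (lam <= 2 * (lam - a * a))%nat) by lia.
        apply le_INR in H4. rewrite mult_INR in H4. simpl (INR 2) in H4. pose proof (pos_INR lam). lra.
    + apply seq_NoDup.
    + intros a H. specialize (Ha a H). lia.
Qed.

(** Squares are 0, 1 or 4 mod 8. With one odd entry, divisibility by 4 makes all four entries odd,
    and then the sum is 4 mod 8. *)
Lemma four_squares_mod8 a b c d : ((a * a + b * b + c * c + d * d) mod 8 = 0)%Z ->
  Z.Even a.
Proof.
  intros H. destruct (Z.Even_or_Odd a) as [|[a' Ea]]; auto. exfalso.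
  assert (Hsq : forall x, exists k, (x * x = 8 * k \/ x * x = 8 * k + 1 \/ x * x = 8 * k + 4)%Z).
  { intros x. destruct (Z.Even_or_Odd x) as [[y ->]|[y ->]].
    - destruct (Z.Even_or_Odd y) as [[z ->]|[z ->]].
      + exists (2 * z * z)%Z. left; ring.
      + exists (2 * z * z + 2 * z)%Z. right; right; ring.
    - destruct (Z.Even_or_Odd y) as [[z ->]|[z ->]].
      + exists (2 * z * z + z)%Z. right; left; ring.
      + exists (2 * z * z + 3 * z + 1)%Z. right; left; ring. }
  assert (Ha : exists k, (a * a = 8 * k + 1)%Z).
  { destruct (Hsq a) as (k & [E|[E|E]]); [exfalso|eauto|exfalso];
      subst a; replace ((2*a'+1)*(2*a'+1))%Z with (4*(a'*a'+a')+1)%Z in E by ring; lia. }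
  destruct Ha as (k1 & E1), (Hsq b) as (k2 & E2), (Hsq c) as (k3 & E3), (Hsq d) as (k4 & E4).
  rewrite E1 in H. apply Z.mod_divide in H as (w & H); [|lia].
  destruct E2 as [E2|[E2|E2]], E3 as [E3|[E3|E3]], E4 as [E4|[E4|E4]];
    rewrite E2, E3, E4 in H; lia.
Qed.

(** Descent: 4^(k+2) is divisible by 8, so all coordinates are even, and halving maps the sphere
    injectively into the one for 4^(k+1). The descent stops at 4, where (1, 1, 1, 1) is odd. *)
Lemma r4_pow4 k : (r 4 (4 ^ (k + 1)) <= r 4 4)%nat.
Proof.
  induction k as [|k IH]; [reflexivity|].
  eapply Nat.le_trans; [|exact IH].
  assert (Hin : forall x, In x (sphere 4 (4 ^ (S k + 1))) -> exists y, x = map (Z.mul 2) y /\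
     In y (sphere 4 (4 ^ (k + 1)))).
  { intros x Hx. apply in_sphere in Hx as [Hl Hs].
    destruct x as [|a [|b [|c [|d [|]]]]]; try discriminate. simpl in Hs.
    assert (E4 : exists w, (Z.of_nat (4 ^ (k + 1)) = 4 * w)%Z).
    { exists (Z.of_nat (4 ^ k)). rewrite Nat.add_1_r, Nat.pow_succ_r'. lia. }
    change (4 ^ (k + 1) + (4 ^ (k + 1) + (4 ^ (k + 1) + (4 ^ (k + 1) + 0))))%nat
      with (4 * 4 ^ (k + 1))%nat in Hs.
    destruct E4 as (w & E4).
    assert (E8 : (a * a + (b * b + (c * c + (d * d + 0))) = 2 * w * 8)%Z) by lia.
    destruct (four_squares_mod8 a b c d) as (a' & ->).
    { rewrite <- (Z_mod_mult (2 * w) 8), <- E8. f_equal; ring. }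
    destruct (four_squares_mod8 b (2 * a') c d) as (b' & ->).
    { rewrite <- (Z_mod_mult (2 * w) 8), <- E8. f_equal; ring. }
    destruct (four_squares_mod8 c (2 * a') (2 * b') d) as (c' & ->).
    { rewrite <- (Z_mod_mult (2 * w) 8), <- E8. f_equal; ring. }
    destruct (four_squares_mod8 d (2 * a') (2 * b') (2 * c')) as (d' & ->).
    { rewrite <- (Z_mod_mult (2 * w) 8), <- E8. f_equal; ring. }
    exists [a'; b'; c'; d']. split; [reflexivity|]. apply in_sphere. split; [reflexivity|].
    simpl. lia. }
  apply (length_inj_le (map (fun a => a / 2)%Z)).
  - apply NoDup_sphere.
  - assert (Hm : forall y, map (fun a => a / 2)%Z (map (Z.mul 2) y) = y).
    { intros y. rewrite map_map. rewrite <- (map_id y) at 2. apply map_ext.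
      intros a. rewrite Z.mul_comm. apply Z.div_mul. lia. }
    intros x x' Hx Hx'. apply Hin in Hx as (y & -> & _), Hx' as (y' & -> & _).
    rewrite !Hm. congruence.
  - intros x Hx. apply Hin in Hx as (y & -> & Hy).
    rewrite map_map. rewrite (map_ext _ (fun a => a)); [now rewrite map_id|].
    intros a. rewrite Z.mul_comm. apply Z.div_mul. lia.
Qed.

(** * Weyl's inequality *)

Lemma rpow_pow x a n : 0 < x -> rpow x a ^ n = rpow x (a * INR n).
Proof. intros. rewrite <- rpow_rpow. symmetry. apply rpow_INR. now apply rpow_pos. Qed.

(** Telescoping: if x^4 = k and y^4 = k - 1, then 1 = x^4 - y^4 <= 4 x^3 (x - y), that is, k^(-3/4)
    <= 4 (x - y). *)
Lemma lsum_rpow_34 L : lsum (seq 1 L) (fun k => rpow (INR k) (-(3/4))) <= 4 * rpow (INR L) (1/4).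
Proof.
  induction L as [|L IH].
  - unfold lsum; simpl. rewrite rpow_0. lra.
  - rewrite seq_S, lsum_app, (Nat.add_comm 1 L), Nat.add_1_r, lsum_single.
    enough (rpow (INR (S L)) (-(3/4)) <= 4 * rpow (INR (S L)) (1/4) - 4 * rpow (INR L) (1/4)) by lra.
    assert (Hp : 0 < INR (S L)) by (apply lt_0_INR; lia).
    set (x := rpow (INR (S L)) (1/4)). set (y := rpow (INR L) (1/4)).
    assert (Hx : 0 < x) by now apply rpow_pos.
    assert (Hy : 0 <= y) by apply rpow_nonneg.
    assert (Hyx : y <= x) by (apply rpow_le; [lra|apply le_INR; lia]).
    assert (H4 : forall z : R, 0 <= z -> rpow z (1/4) ^ 4 = z).
    { intros z [Hz|<-]; [|rewrite rpow_0; ring].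
      rewrite rpow_pow by auto. replace (1/4 * INR 4) with 1 by (simpl; lra). apply rpow_1; lra. }
    assert (E : x ^ 4 - y ^ 4 = 1).
    { unfold x, y. rewrite !H4 by apply pos_INR. rewrite S_INR; ring. }
    replace (rpow (INR (S L)) (- (3 / 4))) with (/ x ^ 3).
    2:{ unfold x. rewrite rpow_pow, rpow_opp by auto. do 2 f_equal. simpl. lra. }
    assert (Hx3 : 0 < x ^ 3) by now apply pow_lt.
    apply Rmult_le_reg_l with (x ^ 3); auto. rewrite Rinv_r by lra.
    assert (x ^ 4 - y ^ 4 = (x - y) * (x^3 + x^2*y + x*y^2 + y^3)) by ring.
    assert (x^2*y <= x^3) by nra.
    assert (x*y^2 <= x^3) by (assert (y^2 <= x^2) by (apply pow_incr; lra); nra).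
    assert (y^3 <= x^3) by (apply pow_incr; lra).
    nra.
Qed.

(** Telescoping with eighth roots x of u and y of u + c: c = y^8 - x^8 <= 8 y^7 (y - x), hence
    y^(-9) <= (8/c)(1/x - 1/y). The constant 8/c is the integral of (1 + c t)^(-9/8) over t >= 0. *)
Lemma lsum_rpow_98 c L : 0 < c ->
  lsum (seq 1 L) (fun l => rpow (1 + c * INR l) (-(9/8))) <= 8 / c.
Proof.
  intros Hc.
  enough (H : lsum (seq 1 L) (fun l => rpow (1 + c * INR l) (-(9/8)))
     <= 8 / c * (1 - rpow (1 + c * INR L) (-(1/8)))).
  { eapply Rle_trans; [exact H|]. assert (0 < 8 / c) by (apply Rdiv_lt_0_compat; lra).
    pose proof (rpow_nonneg (1 + c * INR L) (-(1/8))). nra. }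
  induction L as [|L IH].
  - unfold lsum; simpl. rewrite Rmult_0_r, Rplus_0_r, rpow_one. lra.
  - rewrite seq_S, lsum_app, (Nat.add_comm 1 L), Nat.add_1_r, lsum_single.
    set (u := 1 + c * INR L) in *. replace (1 + c * INR (S L)) with (u + c) by (unfold u; rewrite S_INR; ring).
    assert (Hu : 1 <= u) by (unfold u; pose proof (pos_INR L); nra).
    enough (rpow (u + c) (-(9/8)) <= 8 / c * (rpow u (-(1/8)) - rpow (u + c) (-(1/8)))) by lra.
    rewrite !rpow_opp by lra.
    set (x := rpow u (1/8)). set (y := rpow (u + c) (1/8)).
    assert (Hx : 0 < x) by (apply rpow_pos; lra).
    assert (Hxy : x <= y) by (apply rpow_le; lra).
    assert (Ex : x ^ 8 = u).
    { unfold x. rewrite rpow_pow by lra. replace (1/8 * INR 8) with 1 by (simpl; lra). apply rpow_1; lra. }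
    assert (Ey : y ^ 8 = u + c).
    { unfold y. rewrite rpow_pow by lra. replace (1/8 * INR 8) with 1 by (simpl; lra). apply rpow_1; lra. }
    replace (rpow (u + c) (9/8)) with (y ^ 9).
    2:{ unfold y. rewrite rpow_pow by lra. f_equal. simpl. lra. }
    assert (Hd : c <= 8 * (y - x) * y ^ 7).
    { replace c with (y ^ 8 - x ^ 8) by lra.
      replace (y ^ 8 - x ^ 8) with ((y - x) * (y^7 + y^6*x + y^5*x^2 + y^4*x^3 + y^3*x^4 + y^2*x^5 + y*x^6 + x^7)) by ring.
      assert (Hk : forall i j : nat, y ^ i * x ^ j <= y ^ i * y ^ j).
      { intros i j. apply Rmult_le_compat_l; [apply pow_le; lra|apply pow_incr; lra]. }
      pose proof (Hk 6 1)%nat. pose proof (Hk 5 2)%nat. pose proof (Hk 4 3)%nat. pose proof (Hk 3 4)%nat.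
      pose proof (Hk 2 5)%nat. pose proof (Hk 1 6)%nat. pose proof (Hk 0 7)%nat.
      rewrite <- !pow_add in *. simpl plus in *. rewrite pow_1, pow_O in *.
      rewrite (Rmult_comm 8), Rmult_assoc. apply Rmult_le_compat_l; lra. }
    assert (Hy9 : 0 < y ^ 9) by (apply pow_lt; lra).
    apply Rmult_le_reg_l with (y ^ 9); auto. rewrite Rinv_r by lra.
    replace (y ^ 9 * (8 / c * (/ x - / y))) with (8 * (y - x) * y ^ 7 * (y / x) / c) by (field; lra).
    apply Rmult_le_reg_r with c; auto. unfold Rdiv at 1. rewrite Rmult_assoc, Rinv_l by lra.
    rewrite Rmult_1_l, Rmult_1_r.
    assert (1 <= y / x) by (apply Rmult_le_reg_r with x; auto; unfold Rdiv; rewrite Rmult_assoc, Rinv_l; lra).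
    apply Rle_trans with (1 := Hd).
    assert (0 <= 8 * (y - x) * y ^ 7) by lra. nra.
Qed.

(** On [0, 2] one has sin x >= x - x^3/6 >= x/3; take x = PI t and use PI >= 3. *)
Lemma sin_PI_lower t : 0 <= t <= 1/2 -> t <= sin (PI * t).
Proof.
  intros Ht. pose proof PI2_3_2 as H3. pose proof PI_4 as H4.
  assert (Hx : 0 <= PI * t <= 2) by (split; nra).
  destruct (pre_sin_bound (PI * t) 0) as [H _]; [lra|lra|].
  unfold sin_approx, sin_term in H. simpl in H.
  set (x := PI * t) in *.
  assert (x / 3 <= sin x) by nra.
  unfold x in *. nra.
Qed.

Lemma sin_PI_Z k : sin (IZR k * PI) = 0.
Proof. apply sin_eq_0_1. now exists k. Qed.

Lemma abs_sin_lower x k : Rabs (x - IZR k) <= 1/2 -> Rabs (x - IZR k) <= Rabs (sin (PI * x)).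
Proof.
  intros H. replace (PI * x) with (PI * (x - IZR k) + IZR k * PI) by ring.
  rewrite sin_plus, sin_PI_Z, Rmult_0_r, Rplus_0_r, Rabs_mult.
  assert (Hc : Rabs (cos (IZR k * PI)) = 1).
  { pose proof (sin2_cos2 (IZR k * PI)) as E. rewrite sin_PI_Z in E. unfold Rsqr in E.
    rewrite <- sqrt_Rsqr_abs, <- sqrt_1. f_equal. unfold Rsqr. lra. }
  rewrite Hc, Rmult_1_r. revert H. generalize (x - IZR k). intros t Ht.
  destruct (Rle_dec 0 t) as [H0|H0].
  - rewrite Rabs_pos_eq in * by lra. eapply Rle_trans; [apply sin_PI_lower; lra|apply Rle_abs].
  - rewrite (Rabs_left t) in * by lra.
    replace (PI * t) with (- (PI * - t)) by ring. rewrite sin_neg, Rabs_Ropp.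
    eapply Rle_trans; [apply sin_PI_lower; lra|apply Rle_abs].
Qed.

Lemma cos_sum_telescope alpha phi A n :
  2 * (sin (PI * alpha) * lsum (zseq A n) (fun a => cos (phi + 2 * PI * (alpha * IZR a))))
  = sin (phi + 2 * PI * (alpha * (IZR A + INR n)) - PI * alpha)
    - sin (phi + 2 * PI * (alpha * IZR A) - PI * alpha).
Proof.
  induction n as [|n IH].
  - unfold lsum; simpl. rewrite Rplus_0_r. ring.
  - rewrite zseq_S, lsum_app, lsum_single, S_INR.
    rewrite Rmult_plus_distr_l, Rmult_plus_distr_l, IH.
    rewrite plus_IZR, <- INR_IZR_INZ. set (x := IZR A + INR n).
    replace (IZR A + (INR n + 1)) with (x + 1) by (unfold x; ring).
    replace (phi + 2 * PI * (alpha * (x + 1)) - PI * alpha)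
      with ((phi + 2 * PI * (alpha * x)) + PI * alpha) by ring.
    rewrite sin_plus, sin_minus. ring.
Qed.

Lemma cos_sum_bound alpha phi A n :
  Rabs (sin (PI * alpha)) * Rabs (lsum (zseq A n) (fun a => cos (phi + 2 * PI * (alpha * IZR a)))) <= 1.
Proof.
  rewrite <- Rabs_mult. assert (H := cos_sum_telescope alpha phi A n).
  pose proof (SIN_bound (phi + 2 * PI * (alpha * (IZR A + INR n)) - PI * alpha)).
  pose proof (SIN_bound (phi + 2 * PI * (alpha * IZR A) - PI * alpha)).
  apply Rabs_le. lra.
Qed.

(** [|sum_a G(a) exp(2 pi i a^2 theta)|^2] *)
Definition nsq (l : list Z) (G : Z -> R) (theta : R) : R :=
  (lsum l (fun a => G a * cos (2 * PI * (IZR (a * a) * theta)))) ^ 2 +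
  (lsum l (fun a => G a * sin (2 * PI * (IZR (a * a) * theta)))) ^ 2.

Lemma lsum_mult {A B : Type} (l : list A) (l' : list B) (f : A -> R) (g : B -> R) :
  lsum l f * lsum l' g = lsum l (fun a => lsum l' (fun b => f a * g b)).
Proof.
  rewrite lsum_mult_l. apply lsum_ext; intros. now rewrite lsum_scal.
Qed.

Lemma nsq_expand l G theta :
  nsq l G theta = lsum l (fun a => lsum l (fun a' => G a * G a' * cos (2 * PI * (IZR (a * a - a' * a') * theta)))).
Proof.
  unfold nsq. rewrite <- !Rsqr_pow2. unfold Rsqr. rewrite !lsum_mult, <- lsum_plus.
  apply lsum_ext; intros a _. rewrite <- lsum_plus. apply lsum_ext; intros a' _.
  rewrite minus_IZR.
  replace (2 * PI * ((IZR (a * a) - IZR (a' * a')) * theta)) with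
    (2 * PI * (IZR (a * a) * theta) - 2 * PI * (IZR (a' * a') * theta)) by ring.
  rewrite cos_minus. ring.
Qed.

Lemma nsq_nonneg l G theta : 0 <= nsq l G theta.
Proof. unfold nsq. apply Rplus_le_le_0_compat; apply pow2_ge_0. Qed.

(** With a = a' + h the phase a^2 - a'^2 = h^2 + 2 h a' is linear in a', so for fixed h one sums
    cosines along an arithmetic progression of frequency 2 h theta. [Bd] stands for any bound on
    such sums. *)
Lemma weyl_differencing N theta (Bd : Z -> R) :
  (forall u, In u (zrange (4 * N)) -> 0 <= Bd u) ->
  (forall u A n phi, In u (zrange (4 * N)) -> (n <= 2 * N + 1)%nat ->
     Rabs (lsum (zseq A n) (fun a => cos (phi + 2 * PI * (IZR u * theta * IZR a)))) <= Bd u) ->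
  nsq (zrange N) (fun _ => 1) theta <= lsum (zrange (4 * N)) Bd.
Proof.
  intros H0 HB. rewrite nsq_expand, lsum_exchange.
  (* Only even frequencies u = 2 h occur; since [Bd] is nonnegative, all u up to 4 N may be
     added. *)
  apply Rle_trans with (lsum (zrange (2 * N)) (fun h => Bd (2 * h)%Z)).
  2:{ apply (lsum_inj_le (fun h => 2 * h)%Z); auto; try apply NoDup_zrange; [intros; lia|].
      intros h. rewrite !in_zrange. lia. }
  rewrite (lsum_ext _ _ (fun a' => lsum (zrange (2 * N)) (fun h =>
    indic (Z.abs (a' + h) <=? Z.of_nat N)%Z *
      cos (2 * PI * (IZR (h * h) * theta) + 2 * PI * (IZR (2 * h) * theta * IZR a'))))).
  2:{ intros a' Ha'. apply in_zrange in Ha'.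
      set (F := fun x => indic (Z.abs x <=? Z.of_nat N)%Z * cos (2 * PI * (IZR (x * x - a' * a') * theta))).
      transitivity (lsum (zrange (2 * N)) (fun h => F (h + a')%Z)).
      - rewrite zrange_zseq, zrange_zseq, lsum_shift. unfold F. rewrite <- lsum_filter.
        rewrite (lsum_ext _ _ (fun a => cos (2 * PI * (IZR (a * a - a' * a') * theta)))) by (intros; ring).
        apply lsum_eq_set; [apply NoDup_zseq|apply NoDup_filter, NoDup_zseq|].
        intros a. rewrite filter_In, !in_zseq, Z.leb_le. lia.
      - apply lsum_ext; intros h _. unfold F. rewrite (Z.add_comm h a'). f_equal. f_equal.
        rewrite minus_IZR, !mult_IZR, !plus_IZR. ring. }
  rewrite lsum_exchange. apply lsum_le; intros h Hh. apply in_zrange in Hh.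
  rewrite <- lsum_filter.
  (* For fixed h, the a' with |a'| <= N and |a' + h| <= N form an interval. *)
  set (lo := Z.max (- Z.of_nat N) (- Z.of_nat N - h)).
  set (n := Z.to_nat (Z.min (Z.of_nat N) (Z.of_nat N - h) - lo + 1)).
  rewrite (lsum_eq_set _ (zseq lo n)).
  - eapply Rle_trans; [apply Rle_abs|]. apply HB; [apply in_zrange; lia|unfold n, lo; lia].
  - apply NoDup_filter, NoDup_zrange.
  - apply NoDup_zseq.
  - intros a. rewrite filter_In, in_zrange, in_zseq, Z.leb_le. unfold n, lo. lia.
Qed.

Lemma lsum_multiples (q M : nat) : (1 <= q)%nat -> (1 <= M)%nat ->
  lsum (filter (fun u => negb (u =? 0) && (u mod Z.of_nat q =? 0))%bool%Z (zrange M))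
    (fun u => rpow (Rabs (IZR u)) (-(3/4))) <= 8 * rpow (INR M) (1/4) / INR q.
Proof.
  intros Hq HM. set (L := (M / q)%nat).
  set (l' := map (fun k => Z.of_nat (q * k)) (seq 1 L) ++ map (fun k => (- Z.of_nat (q * k))%Z) (seq 1 L)).
  assert (Hq0 : 0 < INR q) by (apply lt_0_INR; lia).
  apply Rle_trans with (lsum l' (fun u => rpow (Rabs (IZR u)) (-(3/4)))).
  - apply lsum_incl; [apply NoDup_filter, NoDup_zrange| |intros; apply rpow_nonneg].
    intros u Hu. apply filter_In in Hu as [Hu H]. apply in_zrange in Hu.
    apply andb_prop in H as [H1 H2]. apply Bool.negb_true_iff, Z.eqb_neq in H1. apply Z.eqb_eq in H2.
    apply Z.mod_divide in H2 as (k & ->); [|lia]. unfold l'. apply in_or_app.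
    assert (Hk : In (Z.to_nat (Z.abs k)) (seq 1 L)).
    { apply in_seq. split; [lia|]. enough (Z.to_nat (Z.abs k) <= L)%nat by lia.
      unfold L. apply Nat.div_le_lower_bound; [lia|]. nia. }
    destruct (Z.le_ge_cases 0 k).
    + left. apply in_map_iff. exists (Z.to_nat (Z.abs k)). split; auto. nia.
    + right. apply in_map_iff. exists (Z.to_nat (Z.abs k)). split; auto. nia.
  - unfold l'. rewrite lsum_app, !lsum_map.
    assert (E : forall k, In k (seq 1 L) -> rpow (Rabs (IZR (Z.of_nat (q * k)))) (-(3/4)) =
       rpow (INR q) (-(3/4)) * rpow (INR k) (-(3/4))).
    { intros k Hk. rewrite <- INR_IZR_INZ, Rabs_pos_eq by apply pos_INR.
      rewrite mult_INR. apply rpow_mult; apply pos_INR. }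
    rewrite (lsum_ext _ _ _ E).
    rewrite (lsum_ext _ (fun k => rpow (Rabs (IZR (- Z.of_nat (q * k)))) (-(3/4)))
       (fun k => rpow (INR q) (-(3/4)) * rpow (INR k) (-(3/4)))).
    2:{ intros k Hk. rewrite opp_IZR, Rabs_Ropp. auto. }
    rewrite lsum_scal.
    assert (H1 := lsum_rpow_34 L).
    assert (H2 : rpow (INR L) (1/4) <= rpow (INR M / INR q) (1/4)).
    { apply rpow_le; [lra|]. apply Rmult_le_reg_r with (INR q); auto.
      unfold Rdiv. rewrite Rmult_assoc, Rinv_l, Rmult_1_r, <- mult_INR by lra.
      apply le_INR. unfold L. rewrite Nat.mul_comm. apply Nat.Div0.mul_div_le. }
    assert (E3 : rpow (INR q) (-(3/4)) * rpow (INR M / INR q) (1/4) = rpow (INR M) (1/4) / INR q).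
    { change (INR M / INR q) with (INR M * / INR q).
      rewrite rpow_mult, rpow_inv, <- rpow_opp
        by (auto; try apply pos_INR; left; now apply Rinv_0_lt_compat).
      rewrite (Rmult_comm (rpow (INR M) _)), <- Rmult_assoc, <- rpow_plus.
      replace (-(3/4) + -(1/4)) with (-(1)) by lra. rewrite rpow_opp, rpow_1 by lra. unfold Rdiv; ring. }
    assert (H3 := rpow_nonneg (INR q) (-(3/4))).
    replace (8 * rpow (INR M) (1 / 4) / INR q) with (8 * (rpow (INR M) (1 / 4) / INR q)) by (unfold Rdiv; ring).
    rewrite <- E3.
    assert (rpow (INR q) (-(3/4)) * lsum (seq 1 L) (fun k => rpow (INR k) (-(3/4)))
       <= rpow (INR q) (-(3/4)) * (4 * rpow (INR M / INR q) (1/4))) by (apply Rmult_le_compat_l; lra).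
    lra.
Qed.

(** Multiplication by b permutes the residues mod q, so a block of q consecutive integers
    contributes at most one full sum over residues, and floor(n/q) + 1 blocks cover the interval. *)
Lemma lsum_residues (q b A : Z) n (phi : Z -> R) : (0 < q)%Z -> rel_prime b q ->
  (forall r, (0 <= r < q)%Z -> 0 <= phi r) ->
  lsum (zseq A n) (fun u => phi ((u * b) mod q)%Z)
    <= (INR n / IZR q + 1) * lsum (zseq 0 (Z.to_nat q)) phi.
Proof.
  intros Hq Hb Hphi.
  assert (HS : 0 <= lsum (zseq 0 (Z.to_nat q)) phi).
  { apply lsum_nonneg. intros r Hr. apply in_zseq in Hr. apply Hphi. lia. }
  assert (Hblock : forall A, lsum (zseq A (Z.to_nat q)) (fun u => phi ((u * b) mod q)%Z)
     <= lsum (zseq 0 (Z.to_nat q)) phi).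
  { intros A'. apply (lsum_inj_le (fun u => ((u * b) mod q)%Z)).
    - apply NoDup_zseq.
    - intros u u' Hu Hu' E. apply in_zseq in Hu, Hu'.
      assert (D : (q | b * (u - u'))%Z).
      { apply Z.mod_divide; [lia|]. replace (b * (u - u'))%Z with (u * b - u' * b)%Z by ring.
        rewrite Zminus_mod, E, Z.sub_diag. reflexivity. }
      apply Gauss in D; [|now apply rel_prime_sym]. destruct D as (k & D).
      assert (k = 0)%Z by nia. nia.
    - intros u _. apply in_zseq. pose proof (Z.mod_pos_bound (u * b) q Hq). lia.
    - intros r Hr. apply in_zseq in Hr. apply Hphi. lia. }
  set (m := (n / Z.to_nat q + 1)%nat).
  apply Rle_trans with (lsum (zseq A (m * Z.to_nat q)) (fun u => phi ((u * b) mod q)%Z)).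
  { apply lsum_incl; [apply NoDup_zseq| |].
    - intros u. rewrite !in_zseq. pose proof (Nat.div_mod n (Z.to_nat q) ltac:(lia)).
      pose proof (Nat.mod_upper_bound n (Z.to_nat q) ltac:(lia)). unfold m. nia.
    - intros u _. apply Hphi. now apply Z.mod_pos_bound. }
  apply Rle_trans with (INR m * lsum (zseq 0 (Z.to_nat q)) phi).
  - clearbody m. revert A. induction m as [|m IH]; intros A.
    + unfold lsum at 1; simpl. lra.
    + simpl (S m * Z.to_nat q)%nat. rewrite zseq_app, lsum_app, S_INR.
      pose proof (Hblock A). specialize (IH (A + Z.of_nat (Z.to_nat q))%Z). lra.
  - apply Rmult_le_compat_r; auto. unfold m. rewrite plus_INR. simpl (INR 1).
    apply Rplus_le_compat_r. apply Rmult_le_reg_r with (IZR q); [now apply IZR_lt|].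
    unfold Rdiv. rewrite Rmult_assoc, Rinv_l, Rmult_1_r by (apply not_0_IZR; lia).
    replace (IZR q) with (INR (Z.to_nat q)) by (rewrite INR_IZR_INZ, Z2Nat.id; auto; lia).
    rewrite <- mult_INR. apply le_INR. rewrite Nat.mul_comm. apply Nat.Div0.mul_div_le.
Qed.

(** Bounding 1/k by k^(-3/4) trades the logarithm of the harmonic sum for q^(1/4), which the error
    N^(5/4) in Weyl's bound absorbs. *)
Lemma lsum_inverse_residues (q : nat) :
  lsum (zseq 0 q) (fun r => if (r =? 0)%Z then 0 else
     INR q / IZR r + INR q / (INR q - IZR r)) <= 8 * INR q * rpow (INR q) (1/4).
Proof.
  assert (H34 := lsum_rpow_34 q). pose proof (pos_INR q) as Hq.
  assert (Hk : forall k : nat, (1 <= k)%nat -> / INR k <= rpow (INR k) (-(3/4))).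
  { intros k Hk. apply le_INR in Hk. simpl in Hk.
    rewrite rpow_opp by lra. apply Rinv_le_contravar; [apply rpow_pos; lra|].
    rewrite <- (rpow_1 (INR k)) at 2 by lra. apply rpow_le_exp; lra. }
  rewrite (lsum_ext _ _ (fun r => indic (negb (r =? 0)%Z) * (INR q / IZR r)
     + indic (negb (r =? 0)%Z) * (INR q / (INR q - IZR r)))).
  2:{ intros r _. destruct (Z.eqb_spec r 0); simpl; ring. }
  rewrite lsum_plus, <- !lsum_filter.
  set (l := filter (fun r => negb (r =? 0)%Z) (zseq 0 q)).
  assert (Hl : forall r, In r l -> (1 <= r < Z.of_nat q)%Z).
  { intros r Hr. apply filter_In in Hr as [Hr H]. apply in_zseq in Hr.
    apply Bool.negb_true_iff, Z.eqb_neq in H. lia. }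
  assert (Hn : NoDup l) by apply NoDup_filter, NoDup_zseq.
  assert (Hh : forall h : Z -> nat, (forall r, In r l -> (1 <= h r <= q)%nat) ->
    (forall r r', In r l -> In r' l -> h r = h r' -> r = r') ->
    lsum l (fun r => INR q / INR (h r)) <= INR q * (4 * rpow (INR q) (1/4))).
  { intros h Hr Hi.
    apply Rle_trans with (lsum l (fun r => INR q * rpow (INR (h r)) (-(3/4)))).
    - apply lsum_le. intros r Hrl. apply Rmult_le_compat_l; auto. apply Hk. now apply Hr.
    - rewrite lsum_scal. apply Rmult_le_compat_l; auto. eapply Rle_trans; [|exact H34].
      apply (lsum_inj_le h l (seq 1 q) (fun k => rpow (INR k) (-(3/4)))); auto.
      + intros r Hrl. apply Hr in Hrl. apply in_seq. lia.
      + intros; apply rpow_nonneg. }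
  assert (H1 := Hh Z.to_nat ltac:(intros r Hr; apply Hl in Hr; lia)
    ltac:(intros r r' Hr Hr'; apply Hl in Hr, Hr'; lia)).
  assert (H2 := Hh (fun r => q - Z.to_nat r)%nat ltac:(intros r Hr; cbv beta; apply Hl in Hr; lia)
    ltac:(intros r r' Hr Hr'; cbv beta; apply Hl in Hr, Hr'; lia)).
  assert (HE : forall r, In r l -> INR (Z.to_nat r) = IZR r).
  { intros r Hr. apply Hl in Hr. rewrite INR_IZR_INZ, Z2Nat.id; auto; lia. }
  rewrite (lsum_ext l _ (fun r => INR q / IZR r)) in H1 by (intros; now rewrite HE).
  rewrite (lsum_ext l _ (fun r => INR q / (INR q - IZR r))) in H2
    by (intros r Hr; rewrite minus_INR, HE; auto; apply Hl in Hr; lia).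
  lra.
Qed.

(** Integer form of |j/P - b/q| <= 1/(q Q). Among the multiples k j mod P with 0 <= k <= Q, two fall
    into the same one of Q boxes. *)
Lemma dirichlet (P Q j : Z) : (0 < P)%Z -> (0 < Q)%Z ->
  exists q b m : Z, (0 < q <= Q)%Z /\ rel_prime b q /\
    (q * j = b * P + m)%Z /\ (Z.abs m * Q <= P)%Z.
Proof.
  intros HP HQ.
  set (box := fun k : Z => ((k * j) mod P * Q / P)%Z).
  assert (Hbox : forall k, (0 <= box k < Q)%Z).
  { intros k. pose proof (Z.mod_pos_bound (k * j) P HP). unfold box. split.
    - apply Z.div_pos; nia.
    - apply Z.div_lt_upper_bound; nia. }
  assert (Hex : exists k k', (0 <= k < k')%Z /\ (k' <= Q)%Z /\ box k = box k').
  { apply NNPP. intros H.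
    assert (L : (length (zseq 0 (Z.to_nat Q + 1)) <= length (zseq 0 (Z.to_nat Q)))%nat).
    { apply (length_inj_le box); [apply NoDup_zseq| |].
      - intros k k' Hk Hk' E. apply in_zseq in Hk, Hk'.
        destruct (Z.lt_trichotomy k k') as [D|[D|D]]; auto; exfalso; apply H.
        + exists k, k'. repeat split; auto; lia.
        + exists k', k. repeat split; auto; lia.
      - intros k _. apply in_zseq. specialize (Hbox k). lia. }
    rewrite !length_zseq in L. lia. }
  destruct Hex as (k & k' & Hk & Hk' & E).
  set (q0 := (k' - k)%Z). set (m0 := ((k' * j) mod P - (k * j) mod P)%Z).
  set (b0 := ((k' * j) / P - (k * j) / P)%Z).
  assert (E0 : (q0 * j = b0 * P + m0)%Z).
  { unfold q0, b0, m0. pose proof (Z.div_mod (k' * j) P). pose proof (Z.div_mod (k * j) P). lia. }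
  assert (Hm0 : (Z.abs m0 * Q <= P)%Z).
  { unfold box in E. set (x := ((k * j) mod P * Q)%Z) in *. set (y := ((k' * j) mod P * Q)%Z) in *.
    pose proof (Z.div_mod x P ltac:(lia)). pose proof (Z.div_mod y P ltac:(lia)).
    pose proof (Z.mod_pos_bound x P HP). pose proof (Z.mod_pos_bound y P HP).
    assert (m0 * Q = y - x)%Z by (unfold m0, x, y; ring).
    assert (Z.abs m0 * Q = Z.abs (m0 * Q))%Z as -> by (rewrite Z.abs_mul; lia).
    rewrite E in *. lia. }
  (* Reducing the fraction b0/q0 divides the remainder m0 by the same gcd, so its bound persists. *)
  set (g := Z.gcd b0 q0).
  assert (Hg : (0 < g)%Z).
  { pose proof (Z.gcd_nonneg b0 q0). assert (g <> 0)%Z; [|unfold g in *; lia].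
    intros Eg. apply Z.gcd_eq_0_r in Eg. unfold q0 in Eg. lia. }
  destruct (Z.gcd_divide_l b0 q0) as (b & Eb). destruct (Z.gcd_divide_r b0 q0) as (q & Eq).
  fold g in Eb, Eq.
  exists q, b, (q * j - b * P)%Z.
  assert (Em : (m0 = g * (q * j - b * P))%Z) by (rewrite Eb, Eq in E0; lia).
  assert (0 < q)%Z by (unfold q0 in Eq; nia).
  split; [unfold q0 in Eq; nia|]. split; [|split; [lia|]].
  - assert (Hb : Z.gcd b q = 1%Z).
    { assert (Hgg : (g = g * Z.gcd b q)%Z).
      { unfold g at 1. rewrite Eb, Eq, (Z.mul_comm b), (Z.mul_comm q), Z.gcd_mul_mono_l. lia. }
      nia. }
    apply Zgcd_1_rel_prime. exact Hb.
  - rewrite Em in Hm0. rewrite Z.abs_mul in Hm0. nia.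
Qed.

(** As q divides u, u theta differs from an integer by u beta, of size at most 1/4. So the sum is at
    most min(3 N, 1/|u beta|), hence at most 4 N / (1 + N |u beta|). Weakening this to a power -3/4
    gives a form that splits into a power of |u| and a power of 1 + N^2 |beta|. *)
Lemma weyl_multiple (N u q b : Z) (theta beta : R) A (n : nat) phi :
  (1 <= N)%Z -> (1 <= q)%Z -> u <> 0%Z -> (Z.abs u <= 4 * N)%Z -> (q | u)%Z ->
  theta = IZR b / IZR q + beta -> Rabs beta * (16 * IZR N * IZR q) <= 1 -> (INR n <= 3 * IZR N) ->
  Rabs (lsum (zseq A n) (fun a => cos (phi + 2 * PI * (IZR u * theta * IZR a)))) <=
  6 * IZR N * rpow (Rabs (IZR u) / (4 * IZR N) * (1 + IZR N * IZR N * Rabs beta)) (-(3/4)).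
Proof.
  intros HN Hq Hu0 Hu (k & Hk) Eth Hbeta Hn.
  apply IZR_le in HN as HN', Hq as Hq'.
  assert (Hu' : Rabs (IZR u) <= 4 * IZR N) by (rewrite <- abs_IZR, <- mult_IZR; now apply IZR_le).
  assert (Hu1 : 1 <= Rabs (IZR u)) by (rewrite <- abs_IZR; apply IZR_le; lia).
  assert (Hb0 := Rabs_pos beta).
  set (s := Rabs (lsum (zseq A n) (fun a => cos (phi + 2 * PI * (IZR u * theta * IZR a))))).
  assert (Hs0 : 0 <= s) by apply Rabs_pos.
  assert (Hs1 : s <= 3 * IZR N).
  { eapply Rle_trans; [apply lsum_Rabs|].
    eapply Rle_trans; [apply (lsum_le _ _ (fun _ => 1))|].
    - intros a _. apply Rabs_le, COS_bound.
    - rewrite lsum_const, length_zseq. lra. }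
  assert (Hs2 : Rabs (IZR u) * Rabs beta * s <= 1).
  { eapply Rle_trans; [|apply (cos_sum_bound (IZR u * theta) phi A n)].
    apply Rmult_le_compat_r; auto.
    assert (Eq : IZR u * theta - IZR (k * b) = IZR u * beta).
    { rewrite Eth, Hk, !mult_IZR. field. lra. }
    assert (Hub : Rabs (IZR u * beta) <= 1/2).
    { rewrite Rabs_mult. assert (Rabs (IZR u) * Rabs beta <= 4 * IZR N * Rabs beta) by (apply Rmult_le_compat_r; auto).
      assert (Rabs beta * (16 * IZR N * 1) <= 1).
      { eapply Rle_trans; [|exact Hbeta]. apply Rmult_le_compat_l; auto. apply Rmult_le_compat_l; lra. }
      lra. }
    rewrite <- Rabs_mult, <- Eq. apply abs_sin_lower. now rewrite Eq. }
  set (y := IZR N * (Rabs (IZR u) * Rabs beta)).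
  assert (Hy : 0 <= y) by (unfold y; repeat apply Rmult_le_pos; lra).
  set (z := Rabs (IZR u) / (4 * IZR N) * (1 + IZR N * IZR N * Rabs beta)).
  assert (Hz : z = Rabs (IZR u) / (4 * IZR N) + y / 4) by (unfold z, y; field; lra).
  assert (Hz0 : 0 < Rabs (IZR u) / (4 * IZR N)) by (apply Rdiv_lt_0_compat; lra).
  assert (Hz1 : Rabs (IZR u) / (4 * IZR N) <= 1).
  { apply Rmult_le_reg_r with (4 * IZR N); [lra|]. unfold Rdiv. rewrite Rmult_assoc, Rinv_l; lra. }
  assert (Hsy : s * (1 + y) <= 4 * IZR N).
  { unfold y. replace (s * (1 + IZR N * (Rabs (IZR u) * Rabs beta))) with
      (s + IZR N * (Rabs (IZR u) * Rabs beta * s)) by ring. nra. }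
  assert (H1 : rpow (1 + y) (-(1)) <= rpow z (-(3/4))).
  { apply Rle_trans with (rpow (1 + y) (-(3/4))); [apply rpow_le_exp; lra|].
    apply rpow_le_neg; lra. }
  rewrite rpow_opp, rpow_1 in H1 by lra.
  apply Rle_trans with (6 * IZR N * / (1 + y)).
  - apply Rmult_le_reg_r with (1 + y); [lra|]. rewrite Rmult_assoc, Rinv_l; lra.
  - apply Rmult_le_compat_l; lra.
Qed.

(** With r the residue of u b, the distance from u b / q to the integers is min(r, q - r) / q >=
    1/q. The perturbation |u beta| <= 1/(4 q) removes at most a quarter of it, whence 4/3. The
    reciprocal of the minimum is bounded by the sum of both reciprocals. *)
Lemma weyl_nonmultiple (N u q b : Z) (theta beta : R) A (n : nat) phi :
  (1 <= N)%Z -> (1 <= q)%Z -> (Z.abs u <= 4 * N)%Z -> ((u * b) mod q <> 0)%Z ->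
  theta = IZR b / IZR q + beta -> Rabs beta * (16 * IZR N * IZR q) <= 1 ->
  Rabs (lsum (zseq A n) (fun a => cos (phi + 2 * PI * (IZR u * theta * IZR a)))) <=
  4 / 3 * (IZR q / IZR ((u * b) mod q) + IZR q / (IZR q - IZR ((u * b) mod q))).
Proof.
  intros HN Hq Hu Hr Eth Hbeta.
  apply IZR_le in HN as HN', Hq as Hq'.
  assert (Hu' : Rabs (IZR u) <= 4 * IZR N) by (rewrite <- abs_IZR, <- mult_IZR; now apply IZR_le).
  pose proof (Z.mod_pos_bound (u * b) q ltac:(lia)) as Hrb.
  pose proof (Z.div_mod (u * b) q ltac:(lia)) as Hdm.
  set (r := ((u * b) mod q)%Z) in *. set (d := (u * b / q)%Z) in *.
  assert (Hb0 := Rabs_pos beta).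
  set (s := Rabs (lsum (zseq A n) (fun a => cos (phi + 2 * PI * (IZR u * theta * IZR a))))).
  assert (Hs0 : 0 <= s) by apply Rabs_pos.
  set (x := IZR u * theta).
  set (k := (up (x - 1/2))%Z).
  assert (Hk : Rabs (x - IZR k) <= 1/2).
  { pose proof (archimed (x - 1/2)). fold k in H. apply Rabs_le. lra. }
  assert (Hsin := abs_sin_lower x k Hk).
  assert (Hcs := cos_sum_bound x phi A n). fold s in Hcs.
  assert (Hlow : 3/4 * IZR (Z.min r (q - r)) <= IZR q * Rabs (x - IZR k)).
  { assert (E : IZR (r + q * (d - k)) = IZR q * (x - IZR k) - IZR q * (IZR u * beta)).
    { unfold x. rewrite Eth. replace (r + q * (d - k))%Z with (u * b - q * k)%Z by lia.
      rewrite minus_IZR, !mult_IZR. field. lra. }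
    assert (Habs : IZR (Z.min r (q - r)) <= Rabs (IZR (r + q * (d - k)))).
    { rewrite <- abs_IZR. apply IZR_le.
      destruct (Z.le_gt_cases 0 (d - k)); [|assert (d - k <= -1)%Z by lia]; nia. }
    rewrite E in Habs.
    assert (H1 : Rabs (IZR q * (x - IZR k) - IZR q * (IZR u * beta)) <=
      IZR q * Rabs (x - IZR k) + IZR q * (Rabs (IZR u) * Rabs beta)).
    { unfold Rminus at 1. eapply Rle_trans; [apply Rabs_triang|].
      rewrite Rabs_Ropp, !Rabs_mult, (Rabs_pos_eq (IZR q)) by lra. lra. }
    assert (H2 : IZR q * (Rabs (IZR u) * Rabs beta) <= 1/4).
    { assert (Rabs (IZR u) * Rabs beta <= 4 * IZR N * Rabs beta) by (apply Rmult_le_compat_r; auto).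
      assert (IZR q * (Rabs (IZR u) * Rabs beta) <= IZR q * (4 * IZR N * Rabs beta)) by (apply Rmult_le_compat_l; lra).
      lra. }
    assert (1 <= IZR (Z.min r (q - r))) by (apply IZR_le; lia). lra. }
  assert (Hm : 1 <= IZR (Z.min r (q - r))) by (apply IZR_le; lia).
  set (mn := IZR (Z.min r (q - r))) in *.
  assert (Hsm : s * mn <= 4/3 * IZR q).
  { assert (Rabs (x - IZR k) * s <= 1)
      by (eapply Rle_trans; [apply Rmult_le_compat_r; [exact Hs0|exact Hsin]|exact Hcs]).
    assert (3/4 * mn * s <= IZR q * Rabs (x - IZR k) * s) by (apply Rmult_le_compat_r; auto).
    nra. }
  assert (Hs : s <= 4/3 * (IZR q / mn)).
  { apply Rmult_le_reg_r with mn; [lra|].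
    replace (4/3 * (IZR q / mn) * mn) with (4/3 * IZR q) by (field; lra). exact Hsm. }
  eapply Rle_trans; [exact Hs|]. apply Rmult_le_compat_l; [lra|].
  assert (0 < IZR r) by (apply IZR_lt; lia).
  assert (0 < IZR q - IZR r) by (rewrite <- minus_IZR; apply IZR_lt; lia).
  assert (0 <= IZR q / IZR r) by (apply Rle_mult_inv_pos; lra).
  assert (0 <= IZR q / (IZR q - IZR r)) by (apply Rle_mult_inv_pos; lra).
  unfold mn. destruct (Z.le_ge_cases r (q - r)).
  - rewrite Z.min_l by auto. lra.
  - rewrite Z.min_r by auto. rewrite minus_IZR. lra.
Qed.

(** The frequencies u split into u = 0 ([t1]), nonzero multiples of q ([t2], the main term) and the
    rest ([t3]); [t1] and [t3] make up the error. *)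
Lemma weyl_bound (N q : nat) (b : Z) (theta beta : R) :
  (1 <= N)%nat -> (1 <= q <= 16 * N)%nat -> rel_prime b (Z.of_nat q) ->
  theta = IZR b / INR q + beta -> Rabs beta * (16 * INR N * INR q) <= 1 ->
  nsq (zrange N) (fun _ => 1) theta <=
    192 * (INR N ^ 2 / INR q * rpow (1 + INR N * INR N * Rabs beta) (-(3/4)))
    + 600 * rpow (INR N) (5/4).
Proof.
  intros HN Hq Hb Eth Hbeta. rewrite !INR_IZR_INZ in Hbeta. rewrite INR_IZR_INZ in Eth.
  assert (HN' : 1 <= INR N) by (apply (le_INR 1); auto).
  assert (Hq' : 1 <= INR q) by (apply (le_INR 1); lia).
  assert (Hq16 : INR q <= 16 * INR N).
  { destruct Hq as [_ Hq]. apply le_INR in Hq. rewrite mult_INR in Hq.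
    replace (INR 16) with 16 in Hq by (simpl; ring). exact Hq. }
  set (X := 1 + INR N * INR N * Rabs beta).
  assert (HX : 1 <= X).
  { unfold X. assert (0 <= INR N * INR N * Rabs beta) by (repeat apply Rmult_le_pos; try lra; apply Rabs_pos). lra. }
  set (t1 := fun u : Z => indic (u =? 0)%Z * (3 * INR N)).
  set (t2 := fun u : Z => indic (negb (u =? 0) && (u mod Z.of_nat q =? 0))%Z%bool *
     (6 * INR N * rpow (Rabs (IZR u) / (4 * INR N) * X) (-(3/4)))).
  set (phi := fun r : Z => if (r =? 0)%Z then 0 else INR q / IZR r + INR q / (INR q - IZR r)).
  set (t3 := fun u : Z => 4/3 * phi ((u * b) mod (Z.of_nat q))%Z).
  assert (Hphi : forall r, (0 <= r < Z.of_nat q)%Z -> 0 <= phi r).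
  { intros r Hr. unfold phi. destruct (Z.eqb_spec r 0); [lra|].
    assert (0 < IZR r) by (apply IZR_lt; lia).
    assert (0 < INR q - IZR r) by (rewrite INR_IZR_INZ, <- minus_IZR; apply IZR_lt; lia).
    apply Rplus_le_le_0_compat; apply Rle_mult_inv_pos; lra. }
  assert (P1 : forall u, 0 <= t1 u).
  { intros u. unfold t1, indic. destruct (_ =? _)%Z; lra. }
  assert (P2 : forall u, 0 <= t2 u).
  { intros u. unfold t2, indic. pose proof (rpow_nonneg (Rabs (IZR u) / (4 * INR N) * X) (-(3/4))).
    destruct (_ && _)%bool; [|lra]. assert (0 <= 6 * INR N) by lra. nra. }
  assert (P3 : forall u, 0 <= t3 u).
  { intros u. unfold t3. apply Rmult_le_pos; [lra|]. apply Hphi. apply Z.mod_pos_bound. lia. }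
  apply Rle_trans with (lsum (zrange (4 * N)) (fun u => t1 u + t2 u + t3 u)).
  { apply weyl_differencing.
    - intros u _. pose proof (P1 u). pose proof (P2 u). pose proof (P3 u). lra.
    - intros u A n phi' Hu Hn. apply in_zrange in Hu.
      assert (Hn3 : INR n <= 3 * INR N).
      { apply le_INR in Hn. rewrite plus_INR, mult_INR in Hn. simpl in Hn. lra. }
      pose proof (P1 u) as Q1. pose proof (P2 u) as Q2. pose proof (P3 u) as Q3.
      destruct (Z.eq_dec u 0) as [->|Hu0].
      + enough (Rabs (lsum (zseq A n) (fun a => cos (phi' + 2 * PI * (0 * theta * IZR a)))) <= t1 0%Z) by lra.
        eapply Rle_trans; [apply lsum_Rabs|].
        eapply Rle_trans; [apply (lsum_le _ _ (fun _ => 1))|].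
        * intros a _. apply Rabs_le, COS_bound.
        * rewrite lsum_const, length_zseq. unfold t1. simpl indic. lra.
      + destruct (Z.eq_dec (u mod Z.of_nat q) 0) as [Hm|Hm].
        * enough (Rabs (lsum (zseq A n) (fun a => cos (phi' + 2 * PI * (IZR u * theta * IZR a)))) <= t2 u) by lra.
          unfold t2. rewrite Hm, (proj2 (Z.eqb_neq u 0) Hu0). simpl indic. rewrite Rmult_1_l.
          unfold X. rewrite !(INR_IZR_INZ N). eapply weyl_multiple; eauto; try lia.
          -- apply Z.mod_divide; auto; lia.
          -- now rewrite <- INR_IZR_INZ.
        * enough (Rabs (lsum (zseq A n) (fun a => cos (phi' + 2 * PI * (IZR u * theta * IZR a)))) <= t3 u) by lra.
          assert (Hub : ((u * b) mod Z.of_nat q <> 0)%Z).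
          { intros E. apply Hm. apply Z.mod_divide in E; [|lia]. apply Z.mod_divide; [lia|].
            rewrite Z.mul_comm in E. apply Gauss in E; auto. now apply rel_prime_sym. }
          unfold t3, phi. rewrite (proj2 (Z.eqb_neq _ 0) Hub), (INR_IZR_INZ q).
          eapply (weyl_nonmultiple (Z.of_nat N)); eauto; lia. }
  rewrite !lsum_plus.
  assert (H54 : INR N <= rpow (INR N) (5/4)).
  { rewrite <- (rpow_1 (INR N)) at 1 by lra. apply rpow_le_exp; lra. }
  assert (S1 : lsum (zrange (4 * N)) t1 <= 3 * INR N).
  { unfold t1. rewrite <- lsum_filter.
    rewrite (lsum_eq_set _ [0%Z]).
    - rewrite lsum_single. lra.
    - apply NoDup_filter, NoDup_zrange.
    - repeat constructor. simpl. tauto.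
    - intros u. rewrite filter_In, in_zrange, Z.eqb_eq. simpl. split; [intros; left; lia|].
      intros [<-|[]]. simpl. lia. }
  (* 192 = 6 * 8 * 4: the factor 6 N of [weyl_multiple], the 8 of [lsum_multiples], and (4 N)^(3/4)
     (4 N)^(1/4) = 4 N. *)
  assert (S2 : lsum (zrange (4 * N)) t2 <= 192 * (INR N ^ 2 / INR q * rpow X (-(3/4)))).
  { unfold t2. rewrite <- lsum_filter.
    rewrite (lsum_ext _ _ (fun u => 6 * INR N * (rpow (4 * INR N) (3/4) * rpow X (-(3/4))) * rpow (Rabs (IZR u)) (-(3/4)))).
    - rewrite lsum_scal. assert (HM := lsum_multiples q (4 * N) ltac:(lia) ltac:(lia)).
      rewrite mult_INR in HM. replace (INR 4) with 4 in HM by (simpl; ring).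
      eapply Rle_trans; [apply Rmult_le_compat_l; [|exact HM]|].
      + pose proof (rpow_nonneg (4 * INR N) (3/4)). pose proof (rpow_nonneg X (-(3/4))).
        apply Rmult_le_pos; [lra|]. now apply Rmult_le_pos.
      + right. replace (192 * (INR N ^ 2 / INR q * rpow X (- (3 / 4)))) with
          (48 * INR N * rpow X (-(3/4)) * (4 * INR N) / INR q) by (field; lra).
        assert (E : 4 * INR N = rpow (4 * INR N) (3/4) * rpow (4 * INR N) (1/4)).
        { rewrite <- rpow_plus. replace (3/4 + 1/4) with 1 by lra. rewrite rpow_1; lra. }
        rewrite E at 3. field. lra.
    - intros u _.
      assert (0 <= Rabs (IZR u) / (4 * INR N)) by (apply Rle_mult_inv_pos; [apply Rabs_pos|lra]).
      assert (EZ : rpow (Rabs (IZR u) / (4 * INR N) * X) (-(3/4)) =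
        rpow (Rabs (IZR u)) (-(3/4)) * rpow (4 * INR N) (3/4) * rpow X (-(3/4))).
      { rewrite (rpow_mult _ X) by lra. f_equal.
        change (Rabs (IZR u) / (4 * INR N)) with (Rabs (IZR u) * / (4 * INR N)).
        rewrite (rpow_mult (Rabs (IZR u))) by (try apply Rabs_pos; left; apply Rinv_0_lt_compat; lra).
        rewrite rpow_inv, <- rpow_opp by lra. now rewrite Ropp_involutive. }
      rewrite EZ. ring. }
  (* With q <= 16 N, (9 N + q) q^(1/4) <= 25 N * 2 N^(1/4), and 4/3 * 8 * 50 < 540. *)
  assert (S3 : lsum (zrange (4 * N)) t3 <= 540 * rpow (INR N) (5/4)).
  { unfold t3. rewrite lsum_scal, zrange_zseq.
    pose proof (lsum_residues (Z.of_nat q) b (- Z.of_nat (4 * N)) (2 * (4 * N) + 1) phi ltac:(lia) Hb Hphi) as HR.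
    rewrite Nat2Z.id in HR.
    pose proof (lsum_inverse_residues q) as HI. fold phi in HI.
    rewrite <- INR_IZR_INZ in HR.
    assert (Hn : INR (2 * (4 * N) + 1) <= 9 * INR N).
    { replace (9 * INR N) with (INR (9 * N)) by (rewrite mult_INR; simpl (INR 9); ring). apply le_INR; lia. }
    assert (Hq14 : rpow (INR q) (1/4) <= 2 * rpow (INR N) (1/4)).
    { replace 2 with (rpow 16 (1/4)).
      - rewrite <- rpow_mult by lra. apply rpow_le; lra.
      - replace 16 with (rpow 2 4).
        + rewrite rpow_rpow. replace (4 * (1/4)) with 1 by lra. apply rpow_1; lra.
        + replace 4 with (INR 4) by (simpl; ring). rewrite rpow_INR by lra. ring. }
    assert (E54 : rpow (INR N) (5/4) = INR N * rpow (INR N) (1/4)).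
    { replace (5/4) with (1 + 1/4) by lra. rewrite rpow_plus, rpow_1 by lra. reflexivity. }
    pose proof (rpow_nonneg (INR q) (1/4)). pose proof (rpow_nonneg (INR N) (1/4)).
    assert (HR2 : (INR (2 * (4 * N) + 1) / INR q + 1) * lsum (zseq 0 q) phi
       <= (INR (2 * (4 * N) + 1) / INR q + 1) * (8 * INR q * rpow (INR q) (1/4))).
    { apply Rmult_le_compat_l; auto.
      assert (0 <= INR (2 * (4 * N) + 1) / INR q) by (apply Rle_mult_inv_pos; [apply pos_INR|lra]). lra. }
    replace ((INR (2 * (4 * N) + 1) / INR q + 1) * (8 * INR q * rpow (INR q) (1/4))) with
      (8 * ((INR (2 * (4 * N) + 1) + INR q) * rpow (INR q) (1/4))) in HR2 by (field; lra).
    assert (H25 : (INR (2 * (4 * N) + 1) + INR q) * rpow (INR q) (1/4) <= 25 * INR N * (2 * rpow (INR N) (1/4))).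
    { apply Rmult_le_compat; auto; [|lra]. pose proof (pos_INR (2 * (4 * N) + 1)). lra. }
    assert (0 <= INR N * rpow (INR N) (1/4)) by (apply Rmult_le_pos; lra).
    rewrite E54. lra. }
  assert (0 <= rpow (INR N) (5/4)) by apply rpow_nonneg.
  lra.
Qed.

Lemma weyl_cube : exists C, 0 < C /\ forall (N q : nat) (b : Z) (theta beta : R),
  (1 <= N)%nat -> (1 <= q <= 16 * N)%nat -> rel_prime b (Z.of_nat q) ->
  theta = IZR b / INR q + beta -> Rabs beta * (16 * INR N * INR q) <= 1 ->
  rpow (nsq (zrange N) (fun _ => 1) theta) (3/2) <=
    C * (INR N ^ 3 * rpow (INR q) (-(3/2)) * rpow (1 + INR N * INR N * Rabs beta) (-(9/8))
         + rpow (INR N) (15/8)).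
Proof.
  exists (rpow 2 (3/2) * rpow 600 (3/2)). split.
  { apply Rmult_lt_0_compat; apply rpow_pos; lra. }
  intros N q b theta beta HN Hq Hb Eth Hbeta.
  assert (HW := weyl_bound N q b theta beta HN Hq Hb Eth Hbeta).
  assert (HN' : 1 <= INR N) by (apply (le_INR 1); auto).
  assert (Hq' : 1 <= INR q) by (apply (le_INR 1); lia).
  set (X := 1 + INR N * INR N * Rabs beta) in *.
  assert (HX0 := rpow_nonneg X (-(3/4))). assert (HN0 := rpow_nonneg (INR N) (5/4)).
  assert (HD : 0 <= INR N ^ 2 / INR q) by (apply Rle_mult_inv_pos; [apply pow2_ge_0|lra]).
  assert (HDX : 0 <= INR N ^ 2 / INR q * rpow X (-(3/4))) by now apply Rmult_le_pos.
  eapply Rle_trans; [apply rpow_le; [lra|exact HW]|].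
  eapply Rle_trans; [apply rpow_sum_le; lra|].
  rewrite Rmult_assoc. apply Rmult_le_compat_l; [apply rpow_nonneg|].
  rewrite (rpow_mult 192), (rpow_mult 600) by lra.
  rewrite rpow_rpow. replace (5/4 * (3/2)) with (15/8) by lra.
  rewrite rpow_mult, rpow_rpow by lra. replace (-(3/4) * (3/2)) with (-(9/8)) by lra.
  assert (E : rpow (INR N ^ 2 / INR q) (3/2) = INR N ^ 3 * rpow (INR q) (-(3/2))).
  { change (INR N ^ 2 / INR q) with (INR N ^ 2 * / INR q).
    rewrite rpow_mult by (try apply pow2_ge_0; left; apply Rinv_0_lt_compat; lra).
    rewrite rpow_inv, <- rpow_opp by lra. f_equal.
    rewrite <- (rpow_INR (INR N) 2), rpow_rpow by lra.
    rewrite <- (rpow_INR (INR N) 3) by lra. f_equal. simpl. lra. }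
  rewrite E.
  assert (rpow 192 (3/2) <= rpow 600 (3/2)) by (apply rpow_le; lra).
  assert (0 <= INR N ^ 3 * rpow (INR q) (-(3/2)) * rpow X (-(9/8))).
  { apply Rmult_le_pos; [apply Rmult_le_pos; [apply pow_le; lra|]|]; apply rpow_nonneg. }
  pose proof (rpow_nonneg (INR N) (15/8)). nra.
Qed.

(** * Exponential sums over the sphere *)

Lemma cos_period_Z x k : cos (x + 2 * PI * IZR k) = cos x.
Proof.
  assert (H : forall n : nat, forall y, cos (y + 2 * PI * INR n) = cos y).
  { intros n y. replace (y + 2 * PI * INR n) with (y + 2 * INR n * PI) by ring. apply cos_period. }
  destruct (Z.le_ge_cases 0 k).
  - rewrite <- (Z2Nat.id k), <- INR_IZR_INZ by auto. apply H.
  - rewrite <- (H (Z.to_nat (- k)) (x + 2 * PI * IZR k)). f_equal.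
    rewrite INR_IZR_INZ, Z2Nat.id, opp_IZR by lia. ring.
Qed.

Lemma sin_period_Z x k : sin (x + 2 * PI * IZR k) = sin x.
Proof.
  rewrite <- !cos_shift.
  replace (PI / 2 - (x + 2 * PI * IZR k)) with (PI / 2 - x + 2 * PI * IZR (- k)).
  - apply cos_period_Z.
  - rewrite opp_IZR. ring.
Qed.

(** If P does not divide m, the two ends of the telescoped sum agree by periodicity, while sin(PI m
    / P) is not 0. *)
Lemma cos_orthogonality (P : nat) (m : Z) phi : (1 <= P)%nat ->
  lsum (zseq 0 P) (fun j => cos (phi + 2 * PI * (IZR m / INR P * IZR j))) =
  indic (m mod Z.of_nat P =? 0)%Z * (INR P * cos phi).
Proof.
  intros HP. assert (HP' : INR P <> 0) by (apply not_0_INR; lia).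
  destruct (Z.eqb_spec (m mod Z.of_nat P) 0) as [E|E]; simpl indic.
  - apply Z.mod_divide in E as (k & ->); [|lia].
    rewrite (lsum_ext _ _ (fun _ => cos phi)).
    + rewrite lsum_const, length_zseq. ring.
    + intros j _. rewrite mult_IZR, <- INR_IZR_INZ.
      replace (IZR k * INR P / INR P * IZR j) with (IZR (k * j)) by (rewrite mult_IZR; field; auto).
      apply cos_period_Z.
  - rewrite Rmult_0_l.
    assert (H := cos_sum_telescope (IZR m / INR P) phi 0 P).
    replace (phi + 2 * PI * (IZR m / INR P * (0 + INR P)) - PI * (IZR m / INR P)) with
      (phi - PI * (IZR m / INR P) + 2 * PI * IZR m) in H by (field; auto).
    rewrite sin_period_Z in H.
    replace (phi + 2 * PI * (IZR m / INR P * 0) - PI * (IZR m / INR P)) with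
      (phi - PI * (IZR m / INR P)) in H by ring.
    assert (H0 : sin (PI * (IZR m / INR P)) * lsum (zseq 0 P)
       (fun j => cos (phi + 2 * PI * (IZR m / INR P * IZR j))) = 0) by lra.
    apply Rmult_integral in H0 as [H0|H0]; auto. exfalso.
    apply sin_eq_0_0 in H0 as (k & Hk). apply E. apply Z.mod_divide; [lia|]. exists k.
    assert (HPI := PI_RGT_0).
    assert (E2 : IZR m / INR P = IZR k) by (apply Rmult_eq_reg_l with PI; lra).
    apply eq_IZR. rewrite mult_IZR, <- INR_IZR_INZ, <- E2. field; auto.
Qed.

Lemma nsq_period l G theta k : nsq l G (theta + IZR k) = nsq l G theta.
Proof.
  rewrite !nsq_expand. apply lsum_ext; intros a _. apply lsum_ext; intros a' _. f_equal.
  rewrite <- (cos_period_Z (2 * PI * (IZR (a * a - a' * a') * theta)) ((a * a - a' * a') * k)).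
  f_equal. rewrite mult_IZR. ring.
Qed.

(** * The modulus on [Cx] and exponential sums in several variables *)

Lemma Cmod_sq_nonneg z : 0 <= Re z * Re z + Im z * Im z.
Proof. nra. Qed.

Lemma Cmod_nonneg z : 0 <= Cmod z.
Proof. apply sqrt_pos. Qed.

Lemma Cmod_mul z w : Cmod (Cmul z w) = Cmod z * Cmod w.
Proof.
  unfold Cmod. rewrite <- sqrt_mult by apply Cmod_sq_nonneg. f_equal. simpl. ring.
Qed.

Lemma Cmod_sqr z : Cmod z * Cmod z = Re z * Re z + Im z * Im z.
Proof. apply sqrt_sqrt, Cmod_sq_nonneg. Qed.

Lemma Re_le_Cmod z : Rabs (Re z) <= Cmod z.
Proof.
  unfold Cmod. rewrite <- sqrt_Rsqr_abs. apply sqrt_le_1_alt. unfold Rsqr. nra.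
Qed.

Lemma Cmod_add z w : Cmod (Cadd z w) <= Cmod z + Cmod w.
Proof.
  apply Rsqr_incr_0_var; [|pose proof (Cmod_nonneg z); pose proof (Cmod_nonneg w); lra].
  unfold Rsqr. rewrite Cmod_sqr. simpl.
  assert (H : Re z * Re w + Im z * Im w <= Cmod z * Cmod w).
  { pose proof (Re_le_Cmod (Cmul z (mkCx (Re w) (- Im w)))) as H. rewrite Cmod_mul in H.
    replace (Cmod (mkCx (Re w) (- Im w))) with (Cmod w) in H by (unfold Cmod; f_equal; simpl; ring).
    apply Rle_trans with (2 := H). eapply Rle_trans; [|apply Rle_abs]. right. simpl. ring. }
  pose proof (Cmod_sqr z). pose proof (Cmod_sqr w). nra.
Qed.

(** First elementary symmetric polynomial in the values G(x_i); [esym2] is the second. Which two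
    coordinates carry the largest factors depends on x, so all pairs of positions are summed. *)
Fixpoint esym1 (G : Z -> R) (x : list Z) : R :=
  match x with [] => 0 | a :: v => G a + esym1 G v end.

Fixpoint esym2 (G : Z -> R) (x : list Z) : R :=
  match x with [] => 0 | a :: v => G a * esym1 G v + esym2 G v end.

Lemma esym1_nonneg G x : (forall a, 0 <= G a) -> 0 <= esym1 G x.
Proof. intros H. induction x as [|a x IH]; simpl; [lra|]. specialize (H a). lra. Qed.

Lemma esym2_nonneg G x : (forall a, 0 <= G a) -> 0 <= esym2 G x.
Proof.
  intros H. induction x as [|a x IH]; simpl; [lra|].
  pose proof (esym1_nonneg G x H). specialize (H a). nra.
Qed.

Section ExpSums.
Context (J : list Z) (theta : R).

Definition expsum (n : nat) (w : list Z -> R) : Cx :=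
  mkCx (lsum (words J n) (fun x => w x * cos (2 * PI * (IZR (sumsq x) * theta))))
       (lsum (words J n) (fun x => w x * sin (2 * PI * (IZR (sumsq x) * theta)))).

Definition expsum1 (g : Z -> R) : Cx :=
  mkCx (lsum J (fun a => g a * cos (2 * PI * (IZR (a * a) * theta))))
       (lsum J (fun a => g a * sin (2 * PI * (IZR (a * a) * theta)))).

Lemma Cmod_expsum1 g : Cmod (expsum1 g) * Cmod (expsum1 g) = nsq J g theta.
Proof. rewrite Cmod_sqr. simpl. unfold nsq. ring. Qed.

Lemma expsum_add n w w' : expsum n (fun x => w x + w' x) = Cadd (expsum n w) (expsum n w').
Proof.
  unfold expsum, Cadd; simpl. f_equal; rewrite <- lsum_plus; apply lsum_ext; intros; ring.
Qed.

Lemma expsum_cons n g w :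
  expsum (S n) (fun x => match x with [] => 0 | a :: v => g a * w v end)
  = Cmul (expsum1 g) (expsum n w).
Proof.
  assert (Ec : forall a v, 2 * PI * (IZR (sumsq (a :: v)) * theta) =
     2 * PI * (IZR (a * a) * theta) + 2 * PI * (IZR (sumsq v) * theta)).
  { intros a v. change (sumsq (a :: v)) with (a * a + sumsq v)%Z. rewrite plus_IZR. ring. }
  unfold expsum, expsum1, Cmul. cbn [Re Im]. f_equal; rewrite lsum_words_S, !lsum_mult.
  - replace (lsum J (fun a => lsum (words J n) (fun b =>
        g a * cos (2 * PI * (IZR (a * a) * theta)) * (w b * cos (2 * PI * (IZR (sumsq b) * theta))))) -
      lsum J (fun a => lsum (words J n) (fun b =>
        g a * sin (2 * PI * (IZR (a * a) * theta)) * (w b * sin (2 * PI * (IZR (sumsq b) * theta))))))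
    with (lsum J (fun a => lsum (words J n) (fun b =>
        g a * cos (2 * PI * (IZR (a * a) * theta)) * (w b * cos (2 * PI * (IZR (sumsq b) * theta))))) +
      -1 * lsum J (fun a => lsum (words J n) (fun b =>
        g a * sin (2 * PI * (IZR (a * a) * theta)) * (w b * sin (2 * PI * (IZR (sumsq b) * theta)))))) by ring.
    rewrite <- lsum_scal, <- lsum_plus. apply lsum_ext; intros a _.
    rewrite <- lsum_scal, <- lsum_plus. apply lsum_ext; intros v _.
    rewrite Ec, cos_plus. ring.
  - rewrite <- lsum_plus. apply lsum_ext; intros a _. rewrite <- lsum_plus. apply lsum_ext; intros v _.
    rewrite Ec, sin_plus. ring.
Qed.

Let K := Cmod (expsum1 (fun _ => 1)).

Lemma expsum_one_bound n : Cmod (expsum n (fun _ => 1)) <= K ^ n.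
Proof.
  induction n as [|n IH].
  - unfold expsum, Cmod, lsum. simpl. rewrite Rmult_0_l, Rmult_0_r, cos_0, sin_0.
    right. transitivity (sqrt 1); [f_equal; ring|apply sqrt_1].
  - replace (expsum (S n) (fun _ => 1)) with (Cmul (expsum1 (fun _ => 1)) (expsum n (fun _ => 1))).
    + rewrite Cmod_mul. simpl. apply Rmult_le_compat_l; auto. apply Cmod_nonneg.
    + rewrite <- expsum_cons. unfold expsum. rewrite !lsum_words_S.
      f_equal; apply lsum_ext; intros a _; apply lsum_ext; intros; ring.
Qed.

Context (G : Z -> R).
Let A := Cmod (expsum1 G).

(** Covers the recursions e_k(a, v) = G(a) e_(k-1)(v) + e_k(v) for k = 1 and k = 2, splitting off
    one-dimensional exponential sums. *)
Lemma expsum_cons_add n w w1 w2 g :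
  (forall a v, w (a :: v) = g a * w1 v + w2 v) ->
  expsum (S n) w = Cadd (Cmul (expsum1 g) (expsum n w1)) (Cmul (expsum1 (fun _ => 1)) (expsum n w2)).
Proof.
  intros H. rewrite <- !expsum_cons, <- expsum_add. unfold expsum.
  rewrite !lsum_words_S. f_equal; apply lsum_ext; intros a _; apply lsum_ext; intros v _; rewrite H; ring.
Qed.

Lemma expsum_esym1_bound n : Cmod (expsum (S n) (esym1 G)) <= INR (S n) * (A * K ^ n).
Proof.
  assert (HA : 0 <= A) by apply Cmod_nonneg. assert (HK : 0 <= K) by apply Cmod_nonneg.
  induction n as [|n IH].
  - rewrite (expsum_cons_add 0 _ (fun _ => 1) (esym1 G) G) by (intros; simpl; ring).
    eapply Rle_trans; [apply Cmod_add|]. rewrite !Cmod_mul.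
    assert (H := expsum_one_bound 0).
    replace (Cmod (expsum 0 (esym1 G))) with 0.
    + fold A. simpl in *. nra.
    + unfold expsum, Cmod, lsum. simpl. transitivity (sqrt 0); [symmetry; apply sqrt_0|f_equal; ring].
  - rewrite (expsum_cons_add (S n) _ (fun _ => 1) (esym1 G) G) by (intros; simpl; ring).
    eapply Rle_trans; [apply Cmod_add|]. rewrite !Cmod_mul. fold A K.
    assert (H := expsum_one_bound (S n)). rewrite (S_INR (S n)).
    assert (A * Cmod (expsum (S n) (fun _ => 1)) <= A * K ^ S n) by now apply Rmult_le_compat_l.
    assert (K * Cmod (expsum (S n) (esym1 G)) <= K * (INR (S n) * (A * K ^ n))) by now apply Rmult_le_compat_l.
    rewrite <- (tech_pow_Rmult K n) in *. lra.
Qed.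

(** In dimension n + 2 the sum equals (n + 2)(n + 1)/2 times S_G^2 K^n, one term for each pair of
    positions; (n + 2)^2 is a coarser count of the pairs. *)
Lemma expsum_esym2_bound n :
  Cmod (expsum (S (S n)) (esym2 G)) <= INR (S (S n)) ^ 2 * (A * A * K ^ n).
Proof.
  assert (HA : 0 <= A) by apply Cmod_nonneg. assert (HK : 0 <= K) by apply Cmod_nonneg.
  induction n as [|n IH].
  - rewrite (expsum_cons_add 1 _ (esym1 G) (esym2 G) G) by (intros; simpl; ring).
    eapply Rle_trans; [apply Cmod_add|]. rewrite !Cmod_mul. fold A K.
    assert (H := expsum_esym1_bound 0).
    replace (Cmod (expsum 1 (esym2 G))) with 0.
    + simpl in *. nra.
    + unfold Cmod. transitivity (sqrt 0); [symmetry; apply sqrt_0|f_equal]. unfold expsum. cbn [Re Im]. rewrite !lsum_words_S.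
      rewrite (lsum_ext J _ (fun _ => 0)), (lsum_ext J (fun a => lsum (words J 0)
         (fun v => esym2 G (a :: v) * sin (2 * PI * (IZR (sumsq (a :: v)) * theta)))) (fun _ => 0)).
      * rewrite lsum_zero. ring.
      * intros a _. unfold lsum; simpl. ring.
      * intros a _. unfold lsum; simpl. ring.
  - rewrite (expsum_cons_add (S (S n)) _ (esym1 G) (esym2 G) G) by (intros; simpl; ring).
    eapply Rle_trans; [apply Cmod_add|]. rewrite !Cmod_mul. fold A K.
    assert (H := expsum_esym1_bound (S n)). rewrite (S_INR (S (S n))).
    set (t := INR (S (S n))) in *. assert (Ht : 0 <= t) by apply pos_INR.
    assert (H1 : A * Cmod (expsum (S (S n)) (esym1 G)) <= A * (t * (A * K ^ S n))) by now apply Rmult_le_compat_l.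
    assert (H2 : K * Cmod (expsum (S (S n)) (esym2 G)) <= K * (t ^ 2 * (A * A * K ^ n))) by now apply Rmult_le_compat_l.
    rewrite <- (tech_pow_Rmult K n) in *.
    assert (0 <= A * A * (K * K ^ n)) by (repeat apply Rmult_le_pos; auto; now apply pow_le).
    replace (A * (t * (A * (K * K ^ n)))) with (t * (A * A * (K * K ^ n))) in H1 by ring.
    replace (K * (t ^ 2 * (A * A * K ^ n))) with (t ^ 2 * (A * A * (K * K ^ n))) in H2 by ring.
    set (y := A * A * (K * K ^ n)) in *.
    assert (0 <= t * y) by now apply Rmult_le_pos.
    replace ((t + 1) ^ 2 * y) with (t ^ 2 * y + 2 * (t * y) + y) by ring. lra.
Qed.

End ExpSums.

(** The sphere lies in the box |x_i| <= sqrt lam and in the set |x|^2 = lam (mod P). Since [esym2]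
    is nonnegative, only the congruence has to be detected, by averaging over j. *)
Lemma sphere_fourier (n lam P : nat) (G : Z -> R) : (1 <= P)%nat -> (forall a, 0 <= G a) ->
  let N := Nat.sqrt lam in
  INR P * lsum (sphere (S (S n)) lam) (esym2 G) <=
  INR (S (S n)) ^ 2 * lsum (zseq 0 P) (fun j =>
     nsq (zrange N) G (IZR j / INR P) * Cmod (expsum1 (zrange N) (IZR j / INR P) (fun _ => 1)) ^ n).
Proof.
  intros HP HG N.
  set (W := words (zrange N) (S (S n))).
  set (s := fun x : list Z => (sumsq x - Z.of_nat lam)%Z).
  assert (HP0 : 0 < INR P) by (apply lt_0_INR; lia).
  assert (He : forall x, 0 <= esym2 G x) by (intros; now apply esym2_nonneg).
  assert (H1 : lsum (sphere (S (S n)) lam) (esym2 G) <=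
     lsum W (fun x => indic (s x mod Z.of_nat P =? 0)%Z * esym2 G x)).
  { rewrite <- lsum_filter. apply lsum_incl; [apply NoDup_sphere| |auto].
    intros x Hx. apply in_sphere in Hx as [Hl Hs]. apply filter_In. split.
    - apply in_words. split; auto. apply Forall_forall. intros a Ha. apply in_zrange.
      apply sumsq_coord in Ha. rewrite Hs in Ha. unfold N.
      destruct (Nat.sqrt_spec lam ltac:(lia)) as [_ Hsq].
      enough (Z.to_nat (Z.abs a) <= Nat.sqrt lam)%nat by lia.
      apply Nat.sqrt_le_square. nia.
    - unfold s. rewrite Hs, Z.sub_diag, Z.mod_0_l by lia. reflexivity. }
  apply Rle_trans with (INR P * lsum W (fun x => indic (s x mod Z.of_nat P =? 0)%Z * esym2 G x)).
  { apply Rmult_le_compat_l; lra. }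
  rewrite <- lsum_scal.
  rewrite (lsum_ext _ _ (fun x => lsum (zseq 0 P) (fun j =>
    esym2 G x * cos (0 + 2 * PI * (IZR (s x) / INR P * IZR j))))).
  2:{ intros x _. rewrite lsum_scal, cos_orthogonality, cos_0 by auto. ring. }
  rewrite lsum_exchange, <- lsum_scal. apply lsum_le; intros j _.
  set (th := IZR j / INR P).
  rewrite <- Cmod_expsum1.
  eapply Rle_trans; [|apply expsum_esym2_bound].
  set (E := expsum (zrange N) th (S (S n)) (esym2 G)).
  (* [z] is e(-lam theta), of modulus 1; after this rotation the real part of the exponential sum is
     the sum of cosines. *)
  set (z := mkCx (cos (2 * PI * (INR lam * th))) (- sin (2 * PI * (INR lam * th)))).
  assert (Hz : Cmod z = 1).
  { unfold Cmod, z. simpl. rewrite <- sqrt_1. f_equal.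
    pose proof (sin2_cos2 (2 * PI * (INR lam * th))) as H. unfold Rsqr in H. lra. }
  apply Rle_trans with (Re (Cmul z E)).
  2:{ eapply Rle_trans; [apply Rle_abs|]. eapply Rle_trans; [apply Re_le_Cmod|].
      rewrite Cmod_mul, Hz. lra. }
  right. unfold z, E, expsum, Cmul. cbn [Re Im]. fold W.
  replace (- sin (2 * PI * (INR lam * th)) * lsum W (fun x => esym2 G x * sin (2 * PI * (IZR (sumsq x) * th))))
    with (- (sin (2 * PI * (INR lam * th)) * lsum W (fun x => esym2 G x * sin (2 * PI * (IZR (sumsq x) * th))))) by ring.
  unfold Rminus. rewrite Ropp_involutive, <- !lsum_scal, <- lsum_plus. apply lsum_ext; intros x _.
  replace (0 + 2 * PI * (IZR (s x) / INR P * IZR j)) with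
    (2 * PI * (IZR (sumsq x) * th) - 2 * PI * (INR lam * th)).
  - rewrite cos_minus. ring.
  - unfold s, th. rewrite minus_IZR, <- INR_IZR_INZ. field. lra.
Qed.

(** * Correlations modulo q *)

(** Comparison of sums through a relation instead of a map: each a has a partner t, and each t is
    partner of at most one a. It serves where the partner comes from an existence theorem (Dirichlet
    approximation, factorization of q). *)
Lemma lsum_cover {A B : Type} (rel : B -> A -> Prop) (l : list A) (T : list B)
  (f : A -> R) (g : B -> R) :
  NoDup l -> (forall t, In t T -> 0 <= g t) ->
  (forall t a a', In a l -> In a' l -> rel t a -> rel t a' -> a = a') ->
  (forall a, In a l -> exists t, In t T /\ rel t a /\ f a <= g t) ->
  lsum l f <= lsum T g.
Proof.
  revert T. induction l as [|a l IH]; intros T Hn Hg Hu Hc.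
  - now apply lsum_nonneg.
  - destruct (Hc a) as (t & Ht & Hr & Hf); [now left|].
    apply in_split in Ht as (T1 & T2 & ->). inversion Hn as [|? ? Ha Hn']; subst.
    rewrite (lsum_perm (T1 ++ t :: T2) (t :: T1 ++ T2)) by (symmetry; apply Permutation_middle).
    rewrite !lsum_cons. apply Rplus_le_compat; auto. apply IH; auto.
    + intros t' Ht'. apply Hg. apply in_app_or in Ht'. apply in_or_app. simpl. tauto.
    + intros t' b b' Hb Hb'. apply Hu; now right.
    + intros b Hb. destruct (Hc b) as (t' & Ht' & Hr' & Hf'); [now right|].
      exists t'. repeat split; auto. apply in_app_or in Ht'. apply in_or_app.
      destruct Ht' as [|[<-|]]; try tauto. exfalso. apply Ha.
      rewrite (Hu t a b); simpl; auto.
Qed.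

Lemma lsum_zrange_abs P (f : nat -> R) :
  lsum (zrange P) (fun l => f (Z.abs_nat l)) = f 0%nat + 2 * lsum (seq 1 P) f.
Proof.
  induction P as [|P IH].
  - unfold zrange, lsum; simpl. ring.
  - rewrite (lsum_perm _ (Z.of_nat (S P) :: (- Z.of_nat (S P))%Z :: zrange P)).
    + rewrite !lsum_cons, IH, seq_S, lsum_app, lsum_single.
      replace (Z.abs_nat (Z.of_nat (S P))) with (S P) by lia.
      replace (Z.abs_nat (- Z.of_nat (S P))) with (S P) by lia.
      replace (1 + P)%nat with (S P) by lia. ring.
    + apply NoDup_Permutation; [apply NoDup_zrange| |].
      * repeat constructor; [| |apply NoDup_zrange]; cbn [In]; rewrite in_zrange; lia.
      * intros x. cbn [In]. rewrite !in_zrange. lia.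
Qed.

Lemma lsum_rpow_98_seq L : lsum (seq 1 L) (fun k => rpow (INR k) (-(9/8))) <= 9.
Proof.
  destruct L as [|L]; [unfold lsum; simpl; lra|].
  replace (seq 1 (S L)) with (1%nat :: map S (seq 1 L)) by (now rewrite seq_shift).
  rewrite lsum_cons, lsum_map. simpl (INR 1). rewrite rpow_one.
  pose proof (lsum_rpow_98 1 L ltac:(lra)) as H.
  rewrite (lsum_ext _ _ (fun l => rpow (1 + 1 * INR l) (-(9/8)))).
  - lra.
  - intros k _. rewrite S_INR. f_equal. ring.
Qed.

Definition corr (N : nat) (G : Z -> R) (q : nat) : R :=
  lsum (zrange N) (fun a => lsum (zrange N) (fun a' =>
    G a * G a' * indic ((a * a - a' * a') mod Z.of_nat q =? 0)%Z)).

Lemma indic_nonneg b : 0 <= indic b.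
Proof. destruct b; simpl; lra. Qed.

Lemma corr_nonneg N G q : (forall a, 0 <= G a) -> 0 <= corr N G q.
Proof.
  intros H. apply lsum_nonneg; intros a _. apply lsum_nonneg; intros a' _.
  apply Rmult_le_pos; [now apply Rmult_le_pos|apply indic_nonneg].
Qed.

(** Summing over b keeps only the pairs with a^2 = a'^2 (mod q). For these beta enters through a
    cosine, which is at most 1, so the bound is uniform in beta since G >= 0. *)
Lemma nsq_residue_sum N G q beta : (1 <= q)%nat -> (forall a, 0 <= G a) ->
  lsum (zseq 0 q) (fun b => nsq (zrange N) G (IZR b / INR q + beta)) <= INR q * corr N G q.
Proof.
  intros Hq HG. assert (Hq0 : 0 < INR q) by (apply lt_0_INR; lia).
  unfold corr. rewrite <- lsum_scal.
  rewrite (lsum_ext _ _ (fun b => lsum (zrange N) (fun a => lsum (zrange N) (fun a' =>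
    G a * G a' * cos (2 * PI * (IZR (a * a - a' * a') * beta) +
      2 * PI * (IZR (a * a - a' * a') / INR q * IZR b)))))).
  2:{ intros b _. rewrite nsq_expand. apply lsum_ext; intros a _. apply lsum_ext; intros a' _.
      f_equal. f_equal. field. lra. }
  rewrite lsum_exchange. apply lsum_le; intros a _.
  rewrite lsum_exchange, <- lsum_scal. apply lsum_le; intros a' _.
  rewrite lsum_scal, cos_orthogonality by auto.
  set (c := cos _). assert (c <= 1) by apply COS_bound.
  pose proof (HG a). pose proof (HG a').
  assert (Hp : 0 <= G a * G a' * (indic ((a * a - a' * a') mod Z.of_nat q =? 0)%Z * INR q)).
  { apply Rmult_le_pos; [now apply Rmult_le_pos|]. apply Rmult_le_pos; [apply indic_nonneg|lra]. }
  nra.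
Qed.

(** As P > N^2, the congruence forces a' = a or a' = -a, so rows and columns have at most two
    entries, and 2 x y <= x^2 + y^2 applies. *)
Lemma corr_large N G P : (N * N < P)%nat -> (forall a, 0 <= G a) ->
  corr N G P <= 2 * lsum (zrange N) (fun a => G a * G a).
Proof.
  intros HP HG. unfold corr.
  assert (Hrow : forall a, In a (zrange N) ->
    lsum (zrange N) (fun a' => indic ((a * a - a' * a') mod Z.of_nat P =? 0)%Z) <= 2).
  { intros a Ha. apply in_zrange in Ha.
    rewrite (lsum_ext _ _ (fun a' => indic ((a * a - a' * a') mod Z.of_nat P =? 0)%Z * 1)) by (intros; ring).
    rewrite <- lsum_filter, <- length_lsum.
    replace 2 with (INR (length [a; (- a)%Z])) by (simpl; ring). apply le_INR.
    apply NoDup_incl_length; [apply NoDup_filter, NoDup_zrange|].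
    intros a' Ha'. apply filter_In in Ha' as [Ha' H]. apply in_zrange in Ha'.
    apply Z.eqb_eq, Z.mod_divide in H as (k & Hk); [|lia]. simpl.
    assert (a * a <= Z.of_nat (N * N))%Z by nia. assert (a' * a' <= Z.of_nat (N * N))%Z by nia.
    assert (k = 0)%Z by nia. subst k.
    assert ((a - a') * (a + a') = 0)%Z as E by lia. apply Z.mul_eq_0 in E. lia. }
  assert (Hsym : forall a a' : Z, indic ((a * a - a' * a') mod Z.of_nat P =? 0)%Z =
     indic ((a' * a' - a * a) mod Z.of_nat P =? 0)%Z).
  { intros a a'. f_equal. apply Bool.eq_iff_eq_true. rewrite !Z.eqb_eq, !Z.mod_divide by lia.
    split; intros (k & Hk); exists (- k)%Z; lia. }
  apply Rle_trans with (lsum (zrange N) (fun a => lsum (zrange N) (fun a' =>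
    / 2 * (G a * G a * indic ((a * a - a' * a') mod Z.of_nat P =? 0)%Z) +
    / 2 * (G a' * G a' * indic ((a * a - a' * a') mod Z.of_nat P =? 0)%Z)))).
  { apply lsum_le; intros a _. apply lsum_le; intros a' _.
    set (i := indic _). assert (0 <= i) by apply indic_nonneg.
    assert (0 <= (G a - G a') ^ 2 * i) by (apply Rmult_le_pos; auto; apply pow2_ge_0). nra. }
  assert (Hhalf : lsum (zrange N) (fun a => lsum (zrange N) (fun a' =>
    / 2 * (G a * G a * indic ((a * a - a' * a') mod Z.of_nat P =? 0)%Z))) <=
    lsum (zrange N) (fun a => G a * G a)).
  { apply lsum_le; intros a Ha. rewrite !lsum_scal. specialize (Hrow a Ha).
    assert (0 <= G a * G a) by (apply Rmult_le_pos; auto). nra. }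
  rewrite (lsum_ext _ _ (fun a => lsum (zrange N) (fun a' =>
    / 2 * (G a * G a * indic ((a * a - a' * a') mod Z.of_nat P =? 0)%Z)) + lsum (zrange N) (fun a' =>
    / 2 * (G a' * G a' * indic ((a * a - a' * a') mod Z.of_nat P =? 0)%Z)))) by (intros; apply lsum_plus).
  rewrite lsum_plus, (lsum_exchange _ _ (fun a a' =>
    / 2 * (G a' * G a' * indic ((a * a - a' * a') mod Z.of_nat P =? 0)%Z))).
  rewrite (lsum_ext _ (fun b => lsum (zrange N) (fun a =>
    / 2 * (G b * G b * indic ((a * a - b * b) mod Z.of_nat P =? 0)%Z)))
   (fun a => lsum (zrange N) (fun a' =>
    / 2 * (G a * G a * indic ((a * a - a' * a') mod Z.of_nat P =? 0)%Z)))).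
  - lra.
  - intros a _. apply lsum_ext; intros a' _. now rewrite Hsym.
Qed.

(** With u = G^(16/9) this interpolates between the l^2 bound, with constant A, and the trivial l^1
    bound. Put x = u(a)/(A U), y = u(a')/(A U), z = u(a) u(a')/U^2: each term on the left is D
    x^(7/16) y^(7/16) z^(1/8), and the sums of x and y over the kernel and of z over all pairs are
    at most 1, whence the 3. *)
Lemma schur_test (l : list Z) (k : Z -> Z -> bool) (A : R) (u : Z -> R) :
  0 < A -> (forall a, 0 <= u a) ->
  (forall a, In a l -> lsum l (fun a' => indic (k a a')) <= A) ->
  (forall a', In a' l -> lsum l (fun a => indic (k a a')) <= A) ->
  lsum l (fun a => lsum l (fun a' => rpow (u a) (9/16) * rpow (u a') (9/16) * indic (k a a')))
    <= 3 * (rpow A (7/8) * rpow (lsum l u) (9/8)).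
Proof.
  intros HA Hu Hrow Hcol. set (U := lsum l u).
  assert (HU : 0 <= U) by (apply lsum_nonneg; auto).
  destruct HU as [HU|HU].
  2:{ rewrite (lsum_ext _ _ (fun _ => 0)).
      - rewrite lsum_zero. rewrite <- HU, rpow_0. lra.
      - intros a Ha. replace (u a) with 0.
        + rewrite (lsum_ext _ _ (fun _ => 0)) by (intros; rewrite rpow_0; ring). apply lsum_zero.
        + assert (u a <= U) by (apply lsum_term; auto). specialize (Hu a). lra. }
  set (D := rpow A (7/8) * rpow U (9/8)).
  assert (HD : 0 <= D) by (apply Rmult_le_pos; apply rpow_nonneg).
  apply Rle_trans with (lsum l (fun a => lsum l (fun a' =>
     D * (/ (A * U) * (u a * indic (k a a'))) + (D * (/ (A * U) * (u a' * indic (k a a')))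
      + D * (/ (U * U) * (u a * u a')))))).
  - apply lsum_le; intros a _. apply lsum_le; intros a' _.
    assert (Huu : 0 <= D * (/ (U * U) * (u a * u a'))).
    { apply Rmult_le_pos; auto. apply Rmult_le_pos; [|now apply Rmult_le_pos].
      left. apply Rinv_0_lt_compat. nra. }
    destruct (k a a'); simpl indic; [|rewrite !Rmult_0_r; lra].
    rewrite !Rmult_1_r.
    assert (HAU : 0 < A * U) by now apply Rmult_lt_0_compat.
    assert (HUU : 0 < U * U) by now apply Rmult_lt_0_compat.
    set (x := / (A * U) * u a). set (y := / (A * U) * u a'). set (z := / (U * U) * (u a * u a')).
    assert (Hx : 0 <= x) by (apply Rmult_le_pos; auto; left; now apply Rinv_0_lt_compat).
    assert (Hy : 0 <= y) by (apply Rmult_le_pos; auto; left; now apply Rinv_0_lt_compat).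
    assert (Hz : 0 <= z) by (apply Rmult_le_pos; [left; now apply Rinv_0_lt_compat|now apply Rmult_le_pos]).
    (* The exponents add up to 1 and each of x, y, z is at most x + y + z. *)
    assert (HS : rpow x (7/16) * rpow y (7/16) * rpow z (1/8) <= x + y + z).
    { rewrite <- (rpow_1 (x + y + z)) by lra. replace 1 with (7/16 + 7/16 + 1/8) at 2 by lra.
      rewrite !rpow_plus.
      repeat apply Rmult_le_compat; try apply Rmult_le_pos; try apply rpow_nonneg; apply rpow_le; lra. }
    assert (E : rpow (u a) (9/16) * rpow (u a') (9/16) = D * (rpow x (7/16) * rpow y (7/16) * rpow z (1/8))).
    { unfold x, y, z.
      rewrite !rpow_mult by (auto; try (left; apply Rinv_0_lt_compat; auto); now apply Rmult_le_pos).
      rewrite !rpow_inv, !rpow_mult by lra.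
      replace (rpow (u a) (9/16)) with (rpow (u a) (7/16) * rpow (u a) (1/8)) by (rewrite <- rpow_plus; f_equal; lra).
      replace (rpow (u a') (9/16)) with (rpow (u a') (7/16) * rpow (u a') (1/8)) by (rewrite <- rpow_plus; f_equal; lra).
      unfold D.
      replace (rpow A (7/8)) with (rpow A (7/16) * rpow A (7/16)) by (rewrite <- rpow_plus; f_equal; lra).
      replace (rpow U (9/8)) with (rpow U (7/16) * rpow U (7/16) * rpow U (1/8) * rpow U (1/8))
        by (rewrite <- !rpow_plus; f_equal; lra).
      pose proof (rpow_pos A (7/16) HA). pose proof (rpow_pos U (7/16) HU). pose proof (rpow_pos U (1/8) HU).
      field. lra. }
    rewrite E. assert (D * (rpow x (7/16) * rpow y (7/16) * rpow z (1/8)) <= D * (x + y + z))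
      by now apply Rmult_le_compat_l. lra.
  - rewrite (lsum_ext _ _ (fun a => D * (/ (A * U) * (u a * lsum l (fun a' => indic (k a a')))) +
      (lsum l (fun a' => D * (/ (A * U) * (u a' * indic (k a a')))) + D * (/ (U * U) * (u a * U))))).
    2:{ intros a _. rewrite !lsum_plus, !lsum_scal. unfold U. reflexivity. }
    rewrite !lsum_plus, (lsum_exchange l l).
    assert (HUA : lsum l (fun a => u a * A) = U * A) by (unfold U; now rewrite lsum_mult_l).
    assert (HiAU : 0 <= / (A * U)) by (left; apply Rinv_0_lt_compat; now apply Rmult_lt_0_compat).
    assert (H1 : lsum l (fun a => D * (/ (A * U) * (u a * lsum l (fun a' => indic (k a a'))))) <= D).
    { rewrite !lsum_scal. apply Rle_trans with (D * (/ (A * U) * (U * A))); [|right; field; lra].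
      apply Rmult_le_compat_l; auto. apply Rmult_le_compat_l; auto. rewrite <- HUA.
      apply lsum_le; intros a Ha. apply Rmult_le_compat_l; auto. }
    assert (H2 : lsum l (fun b => lsum l (fun a => D * (/ (A * U) * (u b * indic (k a b))))) <= D).
    { rewrite (lsum_ext _ _ (fun b => D * (/ (A * U) * (u b * lsum l (fun a => indic (k a b))))))
        by (intros; now rewrite !lsum_scal).
      rewrite !lsum_scal. apply Rle_trans with (D * (/ (A * U) * (U * A))); [|right; field; lra].
      apply Rmult_le_compat_l; auto. apply Rmult_le_compat_l; auto. rewrite <- HUA.
      apply lsum_le; intros a Ha. apply Rmult_le_compat_l; auto. }
    assert (H3 : lsum l (fun a => D * (/ (U * U) * (u a * U))) = D).
    { rewrite !lsum_scal, <- lsum_mult_l. fold U. field. lra. }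
    lra.
Qed.

(** There are at most 2 N / m + 1 elements, and m <= 16 N bounds the 1 by 16 N / m. *)
Lemma length_congruent (N m : nat) (l : list Z) : (1 <= m <= 16 * N)%nat -> NoDup l ->
  incl l (zrange N) -> (forall x y, In x l -> In y l -> (Z.of_nat m | x - y)%Z) ->
  INR (length l) <= 18 * INR N / INR m.
Proof.
  intros Hm Hn Hi Hc.
  assert (Hm0 : 0 < INR m) by (apply lt_0_INR; lia).
  assert (L : (length l <= length (seq 0 (2 * N / m + 1)))%nat).
  { apply (length_inj_le (fun x => Z.to_nat ((x + Z.of_nat N) / Z.of_nat m))); auto.
    - intros x y Hx Hy E. pose proof (Hi x Hx) as Rx. pose proof (Hi y Hy) as Ry.
      apply in_zrange in Rx, Ry. destruct (Hc x y Hx Hy) as (k & Hk).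
      apply (f_equal Z.of_nat) in E. rewrite !Z2Nat.id in E by (apply Z.div_pos; lia).
      replace (x + Z.of_nat N)%Z with (y + Z.of_nat N + k * Z.of_nat m)%Z in E by lia.
      rewrite Z.div_add in E by lia. assert (k = 0)%Z by lia. subst. lia.
    - intros x Hx. pose proof (Hi x Hx) as Rx. apply in_zrange in Rx. apply in_seq.
      split; [lia|].
      enough ((x + Z.of_nat N) / Z.of_nat m <= Z.of_nat (2 * N / m))%Z by lia.
      rewrite Nat2Z.inj_div. apply Z.div_le_mono; lia. }
  rewrite length_seq in L. apply le_INR in L. rewrite plus_INR in L. simpl (INR 1) in L.
  eapply Rle_trans; [exact L|]. apply Rmult_le_reg_r with (INR m); auto.
  unfold Rdiv. rewrite Rmult_assoc, Rinv_l, Rmult_1_r, Rmult_plus_distr_r by lra.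
  assert (H1 : INR (2 * N / m) * INR m <= 2 * INR N).
  { rewrite <- mult_INR. replace (2 * INR N) with (INR (2 * N)) by (rewrite mult_INR; simpl; ring).
    apply le_INR. rewrite Nat.mul_comm. apply Nat.Div0.mul_div_le. }
  destruct Hm as [_ Hm]. apply le_INR in Hm. rewrite mult_INR in Hm.
  replace (INR 16) with 16 in Hm by (simpl; ring). lra.
Qed.

(** Take D = gcd(q, x) and E = q / D, which divides y, then g = gcd(D, E), D = g d, E = g e. Applied
    to x = a - a' and y = a + a', it replaces one quadratic congruence mod q by two linear ones. *)
Lemma divisor_split (q x y : Z) : (0 < q)%Z -> (q | x * y)%Z ->
  exists g d e : Z, (0 < g /\ 0 < d /\ 0 < e)%Z /\ (q = g * g * d * e)%Z /\ Z.gcd d e = 1%Z /\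
    (g * d | x)%Z /\ (g * e | y)%Z.
Proof.
  intros Hq Hxy. set (D := Z.gcd q x).
  assert (HD : (0 < D)%Z).
  { pose proof (Z.gcd_nonneg q x). assert (D <> 0)%Z; [|unfold D in *; lia].
    intros E. apply Z.gcd_eq_0_l in E. lia. }
  destruct (Z.gcd_divide_l q x) as (E & HE). destruct (Z.gcd_divide_r q x) as (x' & Hx').
  fold D in HE, Hx'.
  assert (HE0 : (0 < E)%Z) by nia.
  assert (HEx : Z.gcd E x' = 1%Z).
  { assert (Z.gcd (D * E) (D * x') = D)%Z as H by (unfold D at 3; f_equal; lia).
    rewrite Z.gcd_mul_mono_l in H. nia. }
  assert (HEy : (E | y)%Z).
  { apply Z.gauss with x'; auto. destruct Hxy as (k & Hk).
    exists k. apply Z.mul_reg_l with D; [lia|]. rewrite HE, Hx' in Hk. lia. }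
  set (g := Z.gcd D E).
  assert (Hg : (0 < g)%Z).
  { pose proof (Z.gcd_nonneg D E). assert (g <> 0)%Z; [|unfold g in *; lia].
    intros E0. apply Z.gcd_eq_0_l in E0. lia. }
  destruct (Z.gcd_divide_l D E) as (d & Hd). destruct (Z.gcd_divide_r D E) as (e & He).
  fold g in Hd, He.
  exists g, d, e. split; [nia|]. split; [rewrite HE, Hd, He; ring|]. split.
  - assert (Z.gcd (g * d) (g * e) = g)%Z as H by (unfold g at 3; f_equal; lia).
    rewrite Z.gcd_mul_mono_l in H. nia.
  - split.
    + exists x'. rewrite Hx', Hd. ring.
    + replace (g * e)%Z with E by lia. exact HEy.
Qed.

(** * The multilinear bound on a single sphere *)

(** For fixed a the two congruences fix a' mod g d and mod g e, hence mod their least common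
    multiple g d e, as d and e are coprime. So rows and columns have at most 18 N / (g d e) entries,
    the [A] of Schur's test. *)
Lemma corr_split_bound (N g d e : nat) (G : Z -> R) :
  (1 <= N)%nat -> (1 <= g)%nat -> (1 <= d)%nat -> (1 <= e)%nat ->
  (g * d * e <= 16 * N)%nat -> Z.gcd (Z.of_nat d) (Z.of_nat e) = 1%Z -> (forall a, 0 <= G a) ->
  lsum (zrange N) (fun a => lsum (zrange N) (fun a' => G a * G a' *
    indic ((a - a') mod Z.of_nat (g * d) =? 0)%Z * indic ((a + a') mod Z.of_nat (g * e) =? 0)%Z))
  <= 3 * (rpow (18 * INR N / INR (g * d * e)) (7/8)
          * rpow (lsum (zrange N) (fun a => rpow (G a) (16/9))) (9/8)).
Proof.
  intros HN Hg Hd He Hgde Hcop HG.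
  set (k := fun a a' : Z => (((a - a') mod Z.of_nat (g * d) =? 0)
     && ((a + a') mod Z.of_nat (g * e) =? 0))%Z%bool).
  assert (Hk : forall a a', k a a' = true <-> (Z.of_nat (g * d) | a - a')%Z /\ (Z.of_nat (g * e) | a + a')%Z).
  { intros a a'. unfold k. rewrite Bool.andb_true_iff, !Z.eqb_eq, !Z.mod_divide by nia. tauto. }
  assert (Hdiv : forall x, (Z.of_nat (g * d) | x)%Z -> (Z.of_nat (g * e) | x)%Z -> (Z.of_nat (g * d * e) | x)%Z).
  { intros x (x1 & H1) (x2 & H2).
    assert (E : (x1 * Z.of_nat d = x2 * Z.of_nat e)%Z) by (apply Z.mul_reg_l with (Z.of_nat g); lia).
    assert (Hed : (Z.of_nat e | x1)%Z).
    { apply Z.gauss with (Z.of_nat d).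
      - exists x2. lia.
      - now rewrite Z.gcd_comm. }
    destruct Hed as (x3 & H3). exists x3. rewrite H1, H3. lia. }
  assert (Hm : (1 <= g * d * e)%nat) by nia.
  assert (Hlen : forall h : Z -> bool, (forall x y, h x = true -> h y = true ->
      (Z.of_nat (g * d) | x - y)%Z /\ (Z.of_nat (g * e) | x - y)%Z) ->
    lsum (zrange N) (fun x => indic (h x)) <= 18 * INR N / INR (g * d * e)).
  { intros h Hh. rewrite (lsum_ext _ _ (fun x => indic (h x) * 1)) by (intros; ring).
    rewrite <- lsum_filter, <- length_lsum. apply length_congruent; try lia.
    - apply NoDup_filter, NoDup_zrange.
    - intros x Hx. now apply filter_In in Hx.
    - intros x y Hx Hy. apply filter_In in Hx as [_ Hx], Hy as [_ Hy].
      destruct (Hh x y Hx Hy). now apply Hdiv. }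
  eapply Rle_trans; [|apply (schur_test (zrange N) k (18 * INR N / INR (g * d * e)) (fun a => rpow (G a) (16/9)))].
  - right. apply lsum_ext; intros a _. apply lsum_ext; intros a' _.
    rewrite !rpow_rpow. replace (16/9 * (9/16)) with 1 by lra. rewrite !rpow_1 by auto.
    unfold k. destruct (_ =? 0)%Z, (_ =? 0)%Z; simpl; ring.
  - apply Rdiv_lt_0_compat; [|apply lt_0_INR; lia].
    assert (0 < INR N) by (apply lt_0_INR; lia). lra.
  - intros; apply rpow_nonneg.
  - intros a _. apply (Hlen (k a)). intros x y Hx Hy. apply Hk in Hx, Hy. split.
    + replace (x - y)%Z with ((a - y) - (a - x))%Z by ring. apply Z.divide_sub_r; tauto.
    + replace (x - y)%Z with ((a + x) - (a + y))%Z by ring. apply Z.divide_sub_r; tauto.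
  - intros a _. apply (Hlen (fun x => k x a)). intros x y Hx Hy. apply Hk in Hx, Hy. split.
    + replace (x - y)%Z with ((x - a) - (y - a))%Z by ring. apply Z.divide_sub_r; tauto.
    + replace (x - y)%Z with ((x + a) - (y + a))%Z by ring. apply Z.divide_sub_r; tauto.
Qed.

(** The weight q^(-1/2) is q^(-3/2) from the cube of [K] times q from [nsq_residue_sum]. Summing
    over the parameters q = g^2 d e of [divisor_split] turns the series over q into a product of
    three convergent ones. *)
Lemma corr_sum (N : nat) (G : Z -> R) : (1 <= N)%nat -> (forall a, 0 <= G a) ->
  lsum (seq 1 (16 * N)) (fun q => rpow (INR q) (-(1/2)) * corr N G q) <=
  39366 * (rpow (INR N) (7/8) * rpow (lsum (zrange N) (fun a => rpow (G a) (16/9))) (9/8)).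
Proof.
  intros HN HG. set (U := lsum (zrange N) (fun a => rpow (G a) (16/9))).
  set (s := seq 1 (16 * N)).
  set (T := filter (fun t : nat * (nat * nat) => let '(g, (d, e)) := t in
     ((g * g * d * e <=? 16 * N)%nat && (Z.gcd (Z.of_nat d) (Z.of_nat e) =? 1)%Z)%bool) (list_prod s (list_prod s s))).
  set (k := fun (t : nat * (nat * nat)) (a a' : Z) => let '(g, (d, e)) := t in
     indic ((a - a') mod Z.of_nat (g * d) =? 0)%Z * indic ((a + a') mod Z.of_nat (g * e) =? 0)%Z).
  set (w := fun t : nat * (nat * nat) => let '(g, (d, e)) := t in rpow (INR (g * g * d * e)) (-(1/2))).
  assert (Hk0 : forall t a a', 0 <= k t a a').
  { intros (g & d & e) a a'. simpl. apply Rmult_le_pos; apply indic_nonneg. }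
  assert (Hw0 : forall t, 0 <= w t) by (intros (g & d & e); apply rpow_nonneg).
  assert (HT : forall g d e, In (g, (d, e)) T <-> (1 <= g <= 16 * N /\ 1 <= d <= 16 * N /\ 1 <= e <= 16 * N)%nat
     /\ (g * g * d * e <= 16 * N)%nat /\ Z.gcd (Z.of_nat d) (Z.of_nat e) = 1%Z).
  { intros g d e. unfold T. rewrite filter_In, !in_prod_iff, Bool.andb_true_iff, Nat.leb_le, Z.eqb_eq.
    unfold s. rewrite !in_seq. lia. }
  assert (Hpt : forall a a', lsum s (fun q => rpow (INR q) (-(1/2)) * indic ((a * a - a' * a') mod Z.of_nat q =? 0)%Z)
     <= lsum T (fun t => w t * k t a a')).
  { intros a a'.
    rewrite (lsum_ext _ _ (fun q => indic ((a * a - a' * a') mod Z.of_nat q =? 0)%Z * rpow (INR q) (-(1/2))))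
      by (intros; ring).
    rewrite <- lsum_filter.
    apply (lsum_cover (fun (t : nat * (nat * nat)) q => let '(g, (d, e)) := t in q = (g * g * d * e)%nat)).
    - apply NoDup_filter, seq_NoDup.
    - intros t _. apply Rmult_le_pos; auto.
    - intros (g & d & e) q q' _ _ -> ->. reflexivity.
    - intros q Hq. apply filter_In in Hq as [Hq Hm]. unfold s in Hq. apply in_seq in Hq.
      apply Z.eqb_eq, Z.mod_divide in Hm; [|lia].
      replace (a * a - a' * a')%Z with ((a - a') * (a + a'))%Z in Hm by ring.
      apply divisor_split in Hm as (g & d & e & (Hg & Hd & He) & Hqe & Hcop & H1 & H2); [|lia].
      assert (Hqn : q = (Z.to_nat g * Z.to_nat g * Z.to_nat d * Z.to_nat e)%nat) by nia.
      exists (Z.to_nat g, (Z.to_nat d, Z.to_nat e)). split; [|split; [exact Hqn|]].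
      + assert (Hle : forall x, Nat.divide x q -> (x <= 16 * N)%nat).
        { intros x Hx. apply Nat.divide_pos_le in Hx; lia. }
        apply HT. repeat split; try lia; try (apply Hle; rewrite Hqn).
        * exists (Z.to_nat g * Z.to_nat d * Z.to_nat e)%nat. ring.
        * exists (Z.to_nat g * Z.to_nat g * Z.to_nat e)%nat. ring.
        * exists (Z.to_nat g * Z.to_nat g * Z.to_nat d)%nat. ring.
        * rewrite !Z2Nat.id by lia. exact Hcop.
      + simpl. rewrite <- Hqn, !Nat2Z.inj_mul, !Z2Nat.id by lia.
        apply Z.mod_divide in H1, H2; try nia. rewrite H1, H2. simpl. lra. }
  apply Rle_trans with (lsum T (fun t => w t * lsum (zrange N) (fun a => lsum (zrange N) (fun a' => G a * G a' * k t a a')))).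
  { rewrite (lsum_ext _ _ (fun q => lsum (zrange N) (fun a => lsum (zrange N) (fun a' =>
       G a * G a' * (rpow (INR q) (-(1/2)) * indic ((a * a - a' * a') mod Z.of_nat q =? 0)%Z))))).
    2:{ intros q _. unfold corr. rewrite <- lsum_scal. apply lsum_ext; intros a _.
        rewrite <- lsum_scal. apply lsum_ext; intros; ring. }
    rewrite (lsum_ext T _ (fun t => lsum (zrange N) (fun a => lsum (zrange N) (fun a' =>
       G a * G a' * (w t * k t a a'))))).
    2:{ intros q _. rewrite <- lsum_scal. apply lsum_ext; intros a _.
        rewrite <- lsum_scal. apply lsum_ext; intros; ring. }
    rewrite (lsum_exchange _ (zrange N)), (lsum_exchange T (zrange N)). apply lsum_le; intros a _.
    rewrite (lsum_exchange _ (zrange N)), (lsum_exchange T (zrange N)). apply lsum_le; intros a' _.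
    rewrite !lsum_scal. apply Rmult_le_compat_l; [now apply Rmult_le_pos|apply Hpt]. }
  assert (HN0 : 0 < INR N) by (apply lt_0_INR; lia).
  set (Y := rpow (INR N) (7/8) * rpow U (9/8)).
  assert (HY : 0 <= Y) by (apply Rmult_le_pos; apply rpow_nonneg).
  set (z := fun m : nat => rpow (INR m) (-(9/8))).
  (* 54 = 3 * 18. The exponents -1/2 of q and -7/8 of g d e add up to -15/8 for g and -11/8 for d
     and e; all are relaxed to -9/8. Each series is at most 9, and 54 * 9^3 = 39366. *)
  apply Rle_trans with (lsum T (fun t => let '(g, (d, e)) := t in 54 * Y * (z g * (z d * z e)))).
  { apply lsum_le. intros (g & d & e) Ht. apply HT in Ht as ((Hg & Hd & He) & Hq & Hcop).
    assert (B := corr_split_bound N g d e G HN ltac:(lia) ltac:(lia) ltac:(lia) ltac:(nia) Hcop HG). fold U in B.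
    simpl k.
    rewrite (lsum_ext _ _ (fun a => lsum (zrange N) (fun a' => G a * G a' *
      indic ((a - a') mod Z.of_nat (g * d) =? 0)%Z * indic ((a + a') mod Z.of_nat (g * e) =? 0)%Z)))
      by (intros; apply lsum_ext; intros; ring).
    eapply Rle_trans; [apply Rmult_le_compat_l; [apply (Hw0 (g, (d, e)))|exact B]|]. simpl w.
    assert (Pg : 1 <= INR g) by (apply (le_INR 1); lia).
    assert (Pd : 1 <= INR d) by (apply (le_INR 1); lia).
    assert (Pe : 1 <= INR e) by (apply (le_INR 1); lia).
    assert (Pde : 0 < INR d * INR e) by (apply Rmult_lt_0_compat; lra).
    assert (Pgd : 0 < INR g * INR d) by (apply Rmult_lt_0_compat; lra).
    unfold Rdiv at 2. rewrite !mult_INR.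
    rewrite (rpow_mult (18 * INR N) (/ (INR g * INR d * INR e))) by (try lra; left; apply Rinv_0_lt_compat; nra).
    rewrite rpow_inv, <- rpow_opp by nra.
    rewrite !rpow_mult by nra.
    assert (E18 : rpow 18 (7/8) <= 18) by (rewrite <- (rpow_1 18) at 2 by lra; apply rpow_le_exp; lra).
    assert (HZ : forall x a b, 1 <= x -> a + b <= -(9/8) -> rpow x a * rpow x b <= rpow x (-(9/8))).
    { intros x a b Hx Hab. rewrite <- rpow_plus. now apply rpow_le_exp. }
    assert (Zd := HZ (INR d) (-(1/2)) (-(7/8)) Pd ltac:(lra)).
    assert (Ze := HZ (INR e) (-(1/2)) (-(7/8)) Pe ltac:(lra)).
    assert (Zg : rpow (INR g) (-(1/2)) * rpow (INR g) (-(1/2)) * rpow (INR g) (-(7/8)) <= rpow (INR g) (-(9/8))).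
    { rewrite <- rpow_plus. apply HZ; lra. }
    fold (z g) in Zg. fold (z d) in Zd. fold (z e) in Ze.
    assert (R0 := rpow_nonneg).
    replace (rpow (INR g) (-(1/2)) * rpow (INR g) (-(1/2)) * rpow (INR d) (-(1/2)) * rpow (INR e) (-(1/2)) *
      (3 * (rpow 18 (7/8) * rpow (INR N) (7/8) * (rpow (INR g) (-(7/8)) * rpow (INR d) (-(7/8)) * rpow (INR e) (-(7/8))) * rpow U (9/8))))
      with (3 * rpow 18 (7/8) * Y * ((rpow (INR g) (-(1/2)) * rpow (INR g) (-(1/2)) * rpow (INR g) (-(7/8))) *
        ((rpow (INR d) (-(1/2)) * rpow (INR d) (-(7/8))) * (rpow (INR e) (-(1/2)) * rpow (INR e) (-(7/8))))))
      by (unfold Y; ring).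
    apply Rmult_le_compat.
    - apply Rmult_le_pos; auto. pose proof (R0 18 (7/8)). lra.
    - repeat apply Rmult_le_pos; auto.
    - apply Rmult_le_compat_r; auto. lra.
    - apply Rmult_le_compat; auto; try (repeat apply Rmult_le_pos; auto).
      apply Rmult_le_compat; auto; try (repeat apply Rmult_le_pos; auto). }
  apply Rle_trans with (lsum (list_prod s (list_prod s s)) (fun t => let '(g, (d, e)) := t in 54 * Y * (z g * (z d * z e)))).
  { apply lsum_incl.
    - apply NoDup_filter, NoDup_list_prod; [apply seq_NoDup|]. apply NoDup_list_prod; apply seq_NoDup.
    - intros t Ht. now apply filter_In in Ht.
    - intros (g & d & e) _. apply Rmult_le_pos; [lra|]. repeat apply Rmult_le_pos; apply rpow_nonneg. }
  assert (HS : lsum s z <= 9) by apply lsum_rpow_98_seq.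
  assert (HS0 : 0 <= lsum s z) by (apply lsum_nonneg; intros; apply rpow_nonneg).
  rewrite lsum_list_prod.
  rewrite (lsum_ext _ _ (fun g => 54 * Y * (z g * (lsum s z * lsum s z)))).
  - rewrite lsum_scal, <- lsum_mult_l. fold Y.
    assert (lsum s z * lsum s z <= 81) by nra.
    assert (lsum s z * (lsum s z * lsum s z) <= 729) by nra. nra.
  - intros g _. rewrite lsum_list_prod, lsum_mult, <- Rmult_assoc, <- lsum_scal.
    apply lsum_ext; intros d _. rewrite <- lsum_scal. apply lsum_ext; intros e _. ring.
Qed.

(** When every [q <= 16 N] divides [P], all the fractions [b/q] of Dirichlet's theorem lie on the
    grid [j/P]. *)
Lemma modulus_exists N : exists P : nat, (N * N < P)%nat /\
  forall q, (1 <= q <= 16 * N)%nat -> exists p, P = (q * p)%nat.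
Proof.
  exists (fact (16 * N) * (N * N + 1))%nat. split.
  - pose proof (lt_O_fact (16 * N)). nia.
  - intros q Hq.
    assert (H : forall m, (q <= m)%nat -> exists p, fact m = (q * p)%nat).
    { intros m Hm. induction Hm as [|m Hm (p & IH)].
      - destruct q as [|q]; [lia|]. exists (fact q). reflexivity.
      - exists (p * S m)%nat. change (fact (S m)) with (S m * fact m)%nat. rewrite IH. ring. }
    destruct (H (16 * N)%nat) as (p & Hp); [lia|]. exists (p * (N * N + 1))%nat. rewrite Hp. ring.
Qed.

(** Major and minor arcs are not separated: at every grid point the cube of [K] is bounded by a main
    term, summed over all (q, l, b), plus N^(15/8), which needs only the mean square of S_G over the
    grid. *)
Lemma restriction_bound : exists C, 0 < C /\ forall (N : nat) (G : Z -> R), (1 <= N)%nat -> (forall a, 0 <= G a) ->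
  exists P : nat, (1 <= P)%nat /\
  lsum (zseq 0 P) (fun j => nsq (zrange N) G (IZR j / INR P)
     * rpow (nsq (zrange N) (fun _ => 1) (IZR j / INR P)) (3/2))
  <= C * INR P * (rpow (INR N) (15/8) * rpow (lsum (zrange N) (fun a => rpow (G a) (16/9))) (9/8)).
Proof.
  destruct weyl_cube as (C1 & HC1 & Hcube).
  exists (C1 * (17 * 39366) + C1 * 2). split; [lra|].
  intros N G HN HG. destruct (modulus_exists N) as (P & HP & Hdiv).
  exists P. split; [lia|].
  assert (HN1 : 1 <= INR N) by (apply (le_INR 1); lia).
  assert (HP0 : 0 < INR P) by (apply lt_0_INR; lia).
  set (U := lsum (zrange N) (fun a => rpow (G a) (16/9))).
  assert (HU0 : 0 <= U) by (apply lsum_nonneg; intros; apply rpow_nonneg).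
  set (nG := fun j : Z => nsq (zrange N) G (IZR j / INR P)).
  set (cb := fun j : Z => rpow (nsq (zrange N) (fun _ => 1) (IZR j / INR P)) (3/2)).
  (* Indices of the approximations j/P = b/q + l/P. The offsets l are not confined to the Dirichlet
     range, since the decay of exponent 9/8 in l controls the whole sum. *)
  set (T := flat_map (fun q => flat_map (fun l => map (fun b => (q, (l, b))) (zseq 0 q)) (zrange P)) (seq 1 (16 * N))).
  set (V := fun (q : nat) (l : Z) => INR N ^ 3 * rpow (INR q) (-(3/2)) *
     rpow (1 + INR N * INR N * (INR (Z.abs_nat l) / INR P)) (-(9/8))).
  set (g := fun t : nat * (Z * Z) => let '(q, (l, b)) := t in
     C1 * V q l * nsq (zrange N) G (IZR b / INR q + IZR l / INR P)).
  assert (HV : forall q l, 0 <= V q l).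
  { intros q l. unfold V. apply Rmult_le_pos; [apply Rmult_le_pos|]; try apply rpow_nonneg. apply pow_le; lra. }
  assert (Habs : forall l : Z, Rabs (IZR l / INR P) = INR (Z.abs_nat l) / INR P).
  { intros l. unfold Rdiv. rewrite Rabs_mult, (Rabs_pos_eq (/ INR P)) by (left; now apply Rinv_0_lt_compat).
    now rewrite <- abs_IZR, (INR_IZR_INZ (Z.abs_nat l)), Zabs2Nat.id_abs. }
  (* The error of Weyl's bound is moved to the left, so that only main terms have to be matched with
     [T]; (q, l, b) determines j mod P. *)
  assert (Hmain : lsum (zseq 0 P) (fun j => nG j * cb j + - (C1 * rpow (INR N) (15/8)) * nG j) <= lsum T g).
  { apply (lsum_cover (fun (t : nat * (Z * Z)) j => let '(q, (l, b)) := t in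
      (Z.of_nat P | j - (l + b * Z.of_nat (P / q)))%Z)).
    - apply NoDup_zseq.
    - intros (q & l & b) _. apply Rmult_le_pos; [|apply nsq_nonneg]. apply Rmult_le_pos; auto; lra.
    - intros (q & l & b) j j' Hj Hj' (k & Hk) (k' & Hk'). apply in_zseq in Hj, Hj'.
      assert (k = k') by nia. subst. lia.
    - intros j Hj. apply in_zseq in Hj.
      destruct (dirichlet (Z.of_nat P) (16 * Z.of_nat N) j) as (q & b & m & Hq & Hrp & Hjb & Hm); [lia|lia|].
      set (q' := Z.to_nat q). assert (Eq : q = Z.of_nat q') by lia.
      destruct (Hdiv q') as (p & Hp); [lia|].
      assert (Ep : (P / q' = p)%nat) by (rewrite Hp, Nat.mul_comm; apply Nat.div_mul; lia).
      (* As q divides P, the remainder m in Dirichlet's theorem equals q l, so beta = l / P is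
         itself on the grid. *)
      set (l := (j - b * Z.of_nat p)%Z).
      assert (El : (m = q * l)%Z) by (unfold l; rewrite Hp in Hjb; nia).
      exists (q', (l, (b mod q)%Z)). split; [|split].
      + apply in_flat_map. exists q'. split; [apply in_seq; lia|].
        apply in_flat_map. exists l. split; [apply in_zrange; rewrite El in Hm; nia|].
        apply in_map_iff. exists (b mod q)%Z. split; auto. apply in_zseq.
        pose proof (Z.mod_pos_bound b q). lia.
      + rewrite Ep. exists (b / q)%Z. unfold l. pose proof (Z.div_mod b q ltac:(lia)) as Hb.
        rewrite Hb at 1. rewrite Hp, Nat2Z.inj_mul, <- Eq. ring.
      + assert (Hq0 : 0 < INR q') by (apply lt_0_INR; lia).
        assert (Eth : IZR j / INR P = IZR b / INR q' + IZR l / INR P).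
        { unfold l. rewrite minus_IZR, mult_IZR, <- INR_IZR_INZ, Hp, mult_INR.
          assert (INR p <> 0) by (apply not_0_INR; nia). field. split; lra. }
        assert (HC := Hcube N q' b (IZR j / INR P) (IZR l / INR P) HN ltac:(lia) ltac:(now rewrite <- Eq) Eth).
        rewrite Habs in HC. fold (V q' l) in HC. fold (cb j) in HC.
        assert (En : nsq (zrange N) G (IZR (b mod q) / INR q' + IZR l / INR P) = nG j).
        { unfold nG. rewrite Eth. rewrite <- (nsq_period _ _ _ (b / q)). f_equal.
          pose proof (Z.div_mod b q ltac:(lia)) as Hb. rewrite Hb at 3.
          rewrite plus_IZR, mult_IZR. rewrite Eq at 3. rewrite <- INR_IZR_INZ. field. lra. }
        simpl g. rewrite En.
        assert (HnG : 0 <= nG j) by apply nsq_nonneg.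
        assert (HC' : cb j <= C1 * (V q' l + rpow (INR N) (15/8))).
        { apply HC. apply Rmult_le_reg_r with (INR P); auto.
          replace (INR (Z.abs_nat l) / INR P * (16 * INR N * INR q') * INR P) with
            (INR (Z.abs_nat l) * (16 * INR N * INR q')) by (field; lra).
          rewrite Rmult_1_l. replace 16 with (INR 16) by (simpl; ring).
          rewrite <- !mult_INR. apply le_INR. rewrite El, Z.abs_mul in Hm. nia. }
        assert (nG j * cb j <= nG j * (C1 * (V q' l + rpow (INR N) (15/8)))) by now apply Rmult_le_compat_l.
        lra. }
  rewrite lsum_plus, lsum_scal in Hmain.
  (* The case q = P, beta = 0 of [nsq_residue_sum]; [corr_large] reduces it to the l^2 norm of [G],
     which the l^(16/9) norm dominates. *)
  assert (HnG : lsum (zseq 0 P) nG <= INR P * (2 * rpow U (9/8))).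
  { assert (H := nsq_residue_sum N G P 0 ltac:(lia) HG).
    assert (H2 := corr_large N G P HP HG).
    assert (H3 : lsum (zrange N) (fun a => G a * G a) <= rpow U (9/8)).
    { replace (9/8) with (1 + 1/8) by lra. rewrite rpow_plus, rpow_1 by auto.
      unfold U at 1. rewrite lsum_mult_l. apply lsum_le; intros a Ha.
      replace (G a * G a) with (rpow (G a) (16/9) * rpow (rpow (G a) (16/9)) (1/8)).
      - apply Rmult_le_compat_l; [apply rpow_nonneg|]. apply rpow_le; [lra|].
        apply (lsum_term _ (fun a => rpow (G a) (16/9))); auto. intros; apply rpow_nonneg.
      - rewrite rpow_rpow, <- rpow_plus. replace (16/9 + 16/9 * (1/8)) with (1 + 1) by lra.
        now rewrite rpow_plus, rpow_1. }
    rewrite (lsum_ext _ _ nG) in H by (intros; unfold nG; now rewrite Rplus_0_r).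
    eapply Rle_trans; [exact H|]. apply Rmult_le_compat_l; lra. }
  assert (HT : lsum T g <= C1 * (17 * 39366) * INR P * (rpow (INR N) (15/8) * rpow U (9/8))).
  { unfold T. rewrite lsum_flat_map.
    apply Rle_trans with (lsum (seq 1 (16 * N)) (fun q => C1 * 17 * INR P * INR N * (rpow (INR q) (-(1/2)) * corr N G q))).
    - apply lsum_le; intros q Hq. apply in_seq in Hq. rewrite lsum_flat_map.
      assert (Hq0 : 0 < INR q) by (apply lt_0_INR; lia).
      assert (Hcorr := corr_nonneg N G q HG).
      apply Rle_trans with (lsum (zrange P) (fun l => C1 * (INR q * corr N G q) * V q l)).
      { apply lsum_le; intros l _. rewrite lsum_map. simpl g. rewrite lsum_scal.
        assert (H := nsq_residue_sum N G q (IZR l / INR P) ltac:(lia) HG).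
        assert (0 <= C1 * V q l) by (apply Rmult_le_pos; auto; lra). nra. }
      rewrite lsum_scal. unfold V. rewrite lsum_scal.
      rewrite (lsum_zrange_abs P (fun l => rpow (1 + INR N * INR N * (INR l / INR P)) (-(9/8)))).
      simpl (INR 0). unfold Rdiv at 2. rewrite Rmult_0_l, Rmult_0_r, Rplus_0_r, rpow_one.
      set (c := INR N * INR N / INR P).
      assert (Hc : 0 < c) by (apply Rdiv_lt_0_compat; nra).
      rewrite (lsum_ext _ _ (fun l => rpow (1 + c * INR l) (-(9/8)))).
      2:{ intros l _. f_equal. unfold c. field. lra. }
      assert (HL := lsum_rpow_98 c P Hc).
      assert (HPN : INR N * INR N <= INR P) by (rewrite <- mult_INR; apply le_INR; lia).
      assert (E8 : 8 / c = 8 * INR P / (INR N * INR N)) by (unfold c; field; nra).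
      assert (E1 : 1 <= INR P / (INR N * INR N)).
      { apply Rmult_le_reg_r with (INR N * INR N); [nra|]. unfold Rdiv. rewrite Rmult_assoc, Rinv_l; nra. }
      (* 17 = 1 + 2 * 8; the term l = 0 is absorbed because P >= N^2. *)
      assert (H17 : 1 + 2 * lsum (seq 1 P) (fun l => rpow (1 + c * INR l) (-(9/8))) <= 17 * (INR P / (INR N * INR N))).
      { rewrite E8 in HL. unfold Rdiv in *. lra. }
      assert (Erp : rpow (INR q) (-(1/2)) = INR q * rpow (INR q) (-(3/2))).
      { replace (-(1/2)) with (1 + -(3/2)) by lra. rewrite rpow_plus, rpow_1; lra. }
      rewrite Erp.
      assert (0 <= C1 * (INR q * corr N G q) * (INR N ^ 3 * rpow (INR q) (-(3/2)))).
      { apply Rmult_le_pos; apply Rmult_le_pos; try lra; try apply rpow_nonneg.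
        - apply Rmult_le_pos; lra.
        - apply pow_le; lra. }
      apply Rle_trans with (C1 * (INR q * corr N G q) * (INR N ^ 3 * rpow (INR q) (-(3/2))) * (17 * (INR P / (INR N * INR N)))).
      { rewrite <- (Rmult_assoc (C1 * _)). now apply Rmult_le_compat_l. }
      right. field. lra.
    - rewrite lsum_scal.
      assert (H := corr_sum N G HN HG). fold U in H.
      assert (0 <= C1 * 17 * INR P * INR N) by (repeat apply Rmult_le_pos; lra).
      eapply Rle_trans; [apply Rmult_le_compat_l; [auto|exact H]|].
      right. replace (rpow (INR N) (15/8)) with (INR N * rpow (INR N) (7/8)); [ring|].
      replace (15/8) with (1 + 7/8) by lra. rewrite rpow_plus, rpow_1; lra. }
  assert (HN15 := rpow_nonneg (INR N) (15/8)).
  assert (H2 : C1 * rpow (INR N) (15/8) * lsum (zseq 0 P) nG <= C1 * rpow (INR N) (15/8) * (INR P * (2 * rpow U (9/8)))).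
  { apply Rmult_le_compat_l; auto. apply Rmult_le_pos; lra. }
  change (lsum (zseq 0 P) (fun a => nG a * cb a) <= (C1 * (17 * 39366) + C1 * 2) * INR P *
    (rpow (INR N) (15/8) * rpow U (9/8))). lra.
Qed.

Definition lprod (F : Z -> R) (x : list Z) : R := fold_right (fun a p => F a * p) 1 x.

(** If [u >= v] are the two largest factors, the product is at most
    [u v^(n-1) <= (u v)^(n/2)]. *)
Lemma lprod_le_esym2 (F : Z -> R) (x : list Z) : (forall a, 0 <= F a) -> (2 <= length x)%nat ->
  lprod F x <= esym2 (fun a => rpow (F a) (INR (length x) / 2)) x.
Proof.
  intros HF Hx. set (al := INR (length x) / 2). set (G := fun a => rpow (F a) al).
  assert (Hal : 0 <= al) by (unfold al; pose proof (pos_INR (length x)); lra).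
  assert (HG : forall a, 0 <= G a) by (intros; apply rpow_nonneg).
  assert (Hind : forall y, y <> [] -> exists u v, 0 <= v <= u /\
    rpow u al <= esym1 G y /\ rpow u al * rpow v al <= esym2 G y /\
    lprod F y <= u * v ^ (length y - 1)).
  { intros y. induction y as [|a y IH]; [congruence|]. intros _.
    destruct y as [|b y].
    (* With a single factor take v = 0: [rpow] sends it to 0, while v ^ 0 = 1 leaves the bound F
       a. *)
    - exists (F a), 0. rewrite rpow_0. simpl. specialize (HF a). unfold G. lra.
    - destruct IH as (u & v & Huv & H1 & H2 & H3); [congruence|].
      set (y' := b :: y) in *.
      assert (Hlen : (length (a :: y') - 1 = S (length y' - 1))%nat) by (simpl; lia).
      rewrite Hlen. clear Hlen. set (m := (length y' - 1)%nat) in *.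
      change (lprod F (a :: y')) with (F a * lprod F y').
      change (esym1 G (a :: y')) with (G a + esym1 G y').
      change (esym2 G (a :: y')) with (G a * esym1 G y' + esym2 G y'). specialize (HF a). pose proof (HG a) as HGa.
      pose proof (esym1_nonneg G y' HG). pose proof (esym2_nonneg G y' HG).
      assert (Hpu := rpow_nonneg u al). assert (Hpv := rpow_nonneg v al).
      assert (Hvm : 0 <= v ^ m) by (apply pow_le; lra).
      assert (HP : F a * lprod F y' <= F a * (u * v ^ m)) by now apply Rmult_le_compat_l.
      assert (HGu : G a * rpow u al <= G a * esym1 G y') by now apply Rmult_le_compat_l.
      (* The new factor is the largest, the second largest, or neither. *)
      destruct (Rle_dec u (F a)); [|destruct (Rle_dec v (F a))].
      + exists (F a), u. fold (G a). repeat split; try lra.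
        simpl pow. assert (v ^ m <= u ^ m) by (apply pow_incr; lra).
        assert (u * v ^ m <= u * u ^ m) by (apply Rmult_le_compat_l; lra).
        assert (F a * (u * v ^ m) <= F a * (u * u ^ m)) by now apply Rmult_le_compat_l. lra.
      + exists u, (F a). fold (G a). repeat split; try lra.
        simpl pow. assert (v ^ m <= F a ^ m) by (apply pow_incr; lra).
        assert (u * F a * v ^ m <= u * F a * F a ^ m) by (apply Rmult_le_compat_l; nra). lra.
      + exists u, v. repeat split; try lra.
        * assert (0 <= G a * esym1 G y') by now apply Rmult_le_pos. lra.
        * simpl pow. assert (0 <= u * v ^ m) by (apply Rmult_le_pos; lra). nra. }
  destruct (Hind x) as (u & v & Huv & _ & H2 & H3); [intros ->; simpl in Hx; lia|].
  eapply Rle_trans; [exact H3|]. eapply Rle_trans; [|exact H2].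
  destruct (proj1 Huv) as [Hv|<-].
  - rewrite <- (rpow_INR v) by auto. rewrite <- (rpow_1 u) at 1 by lra.
    replace (INR (length x - 1)) with ((al - 1) + al)
      by (unfold al; rewrite minus_INR by lia; simpl (INR 1); lra).
    replace al with (1 + (al - 1)) at 3 by ring.
    rewrite !rpow_plus, <- !Rmult_assoc.
    apply Rmult_le_compat_r; [apply rpow_nonneg|].
    apply Rmult_le_compat_l; [apply rpow_nonneg|]. apply rpow_le; [|lra].
    unfold al. assert (2 <= INR (length x)) by (now apply (le_INR 2)). lra.
  - rewrite rpow_0, pow_i by lia. lra.
Qed.

(** The n - 5 copies of [K] beyond the cube are bounded by 3 N. The resulting power is N^(n-5)
    N^(15/8) = N^(n-2) N^(-9/8), whose last factor turns the sum U into the average U / N. *)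
Lemma sphere_upper (n : nat) : (5 <= n)%nat -> exists C, 0 < C /\
  forall (lam : nat) (F : Z -> R), (1 <= lam)%nat -> (forall a, 0 <= F a) ->
  let N := Nat.sqrt lam in
  lsum (sphere n lam) (lprod F) <=
  C * INR N ^ (n - 2) * rpow (lsum (zrange N) (fun a => rpow (F a) (8/9 * INR n)) / INR N) (9/8).
Proof.
  intros Hn. destruct restriction_bound as (C1 & HC1 & Hres).
  exists (INR n ^ 2 * 3 ^ (n - 5) * C1). split.
  { repeat apply Rmult_lt_0_compat; auto; try lra; try (apply lt_0_INR; lia). apply pow_lt; lra. }
  intros lam F Hlam HF N.
  assert (HN : (1 <= N)%nat) by (unfold N; apply (Nat.sqrt_le_mono 1 lam); auto).
  assert (HN1 : 1 <= INR N) by (apply (le_INR 1); auto).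
  set (G := fun a => rpow (F a) (INR n / 2)).
  assert (HG : forall a, 0 <= G a) by (intros; apply rpow_nonneg).
  destruct (Hres N G HN HG) as (P & HP & HR).
  assert (HP0 : 0 < INR P) by (apply lt_0_INR; lia).
  replace (lsum (zrange N) (fun a => rpow (G a) (16/9))) with
    (lsum (zrange N) (fun a => rpow (F a) (8/9 * INR n))) in HR.
  2:{ apply lsum_ext; intros a _. unfold G. rewrite rpow_rpow. f_equal. field. }
  set (U := lsum (zrange N) (fun a => rpow (F a) (8/9 * INR n))) in *.
  assert (HU0 : 0 <= U) by (apply lsum_nonneg; intros; apply rpow_nonneg).
  assert (HF4 := sphere_fourier (n - 2) lam P G HP HG). cbv zeta in HF4.
  replace (S (S (n - 2))) with n in HF4 by lia. fold N in HF4.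
  assert (H1 : lsum (sphere n lam) (lprod F) <= lsum (sphere n lam) (esym2 G)).
  { apply lsum_le; intros x Hx. apply in_sphere in Hx as [Hl _]. subst n.
    apply lprod_le_esym2; auto. lia. }
  assert (HK : forall j, nsq (zrange N) G (IZR j / INR P) *
     Cmod (expsum1 (zrange N) (IZR j / INR P) (fun _ => 1)) ^ (n - 2) <=
     (3 * INR N) ^ (n - 5) * (nsq (zrange N) G (IZR j / INR P) *
       rpow (nsq (zrange N) (fun _ => 1) (IZR j / INR P)) (3/2))).
  { intros j. set (th := IZR j / INR P). set (K := Cmod _).
    assert (HK0 : 0 <= K) by apply Cmod_nonneg.
    assert (HKK : K * K = nsq (zrange N) (fun _ => 1) th) by apply Cmod_expsum1.
    assert (HK3 : K <= 3 * INR N).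
    { apply Rsqr_incr_0_var; [|lra]. unfold Rsqr. rewrite HKK, nsq_expand.
      apply Rle_trans with (lsum (zrange N) (fun _ => lsum (zrange N) (fun _ => 1))).
      - apply lsum_le; intros a _. apply lsum_le; intros a' _. rewrite !Rmult_1_l. apply COS_bound.
      - rewrite !lsum_const, length_zrange, plus_INR, mult_INR. simpl (INR 2). simpl (INR 1). nra. }
    assert (EK : rpow (nsq (zrange N) (fun _ => 1) th) (3/2) = K ^ 3).
    { rewrite <- HKK, rpow_mult, <- rpow_plus by auto.
      destruct HK0 as [HK0|<-]; [|rewrite rpow_0; ring].
      rewrite <- rpow_INR by auto. f_equal. simpl. lra. }
    rewrite EK. replace (n - 2)%nat with (3 + (n - 5))%nat by lia. rewrite pow_add.
    assert (Hp : K ^ (n - 5) <= (3 * INR N) ^ (n - 5)) by (apply pow_incr; lra).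
    assert (0 <= nsq (zrange N) G th * K ^ 3) by (apply Rmult_le_pos; [apply nsq_nonneg|now apply pow_le]).
    rewrite <- Rmult_assoc, (Rmult_comm ((3 * INR N) ^ (n - 5))).
    now apply Rmult_le_compat_l. }
  assert (HS : INR P * lsum (sphere n lam) (lprod F) <= INR P * (INR n ^ 2 * 3 ^ (n - 5) * C1 *
      (INR N ^ (n - 5) * (rpow (INR N) (15/8) * rpow U (9/8))))).
  { eapply Rle_trans; [apply Rmult_le_compat_l; [lra|exact H1]|].
    eapply Rle_trans; [exact HF4|].
    assert (Hn2 : 0 <= INR n ^ 2) by apply pow2_ge_0.
    eapply Rle_trans; [apply Rmult_le_compat_l; [auto|apply lsum_le; intros j _; apply HK]|].
    rewrite lsum_scal, Rpow_mult_distr.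
    assert (H3 : 0 <= 3 ^ (n - 5) * INR N ^ (n - 5)) by (apply Rmult_le_pos; apply pow_le; lra).
    eapply Rle_trans; [apply Rmult_le_compat_l; [auto|apply Rmult_le_compat_l; [auto|exact HR]]|].
    right. ring. }
  apply Rmult_le_reg_l in HS; auto. eapply Rle_trans; [exact HS|]. right.
  change (U / INR N) with (U * / INR N).
  rewrite rpow_mult by (auto; left; apply Rinv_0_lt_compat; lra).
  rewrite rpow_inv, <- rpow_opp by lra.
  replace (n - 2)%nat with ((n - 5) + 3)%nat by lia. rewrite (pow_add (INR N)).
  replace (INR N ^ 3) with (rpow (INR N) 3) by (rewrite <- rpow_INR by lra; f_equal; simpl; lra).
  replace (15/8) with (3 + -(9/8)) by lra. rewrite rpow_plus. ring.
Qed.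

(** * The maximal function *)

Lemma rpow_pred x p : 0 <= x -> rpow x p = rpow x (p - 1) * x.
Proof.
  intros Hx. replace p with ((p - 1) + 1) at 1 by ring. now rewrite rpow_plus, (rpow_1 x).
Qed.

(** The graph of x^p lies above its tangent at m. After scaling it is Bernoulli's t^p >= p t - (p -
    1): with t = e^z, t^p >= t (1 + (p - 1) z) and t z >= t - 1. *)
Lemma young_rpow p m x : 0 <= m -> 0 <= x -> 1 < p ->
  p * rpow m (p - 1) * x <= (p - 1) * rpow m p + rpow x p.
Proof.
  intros [Hm|<-] Hx Hp.
  2:{ rewrite !rpow_0. pose proof (rpow_nonneg x p). lra. }
  assert (Em := rpow_pred m p ltac:(lra)).
  destruct Hx as [Hx|<-].
  2:{ rewrite rpow_0. pose proof (rpow_nonneg m p). nra. }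
  assert (Ht : 0 < x / m) by now apply Rdiv_lt_0_compat.
  assert (H : p * (x / m) <= (p - 1) + rpow (x / m) p).
  { rewrite rpow_pos_eq by auto. unfold Rpower.
    set (z := ln (x / m)). replace (x / m) with (exp z) by (apply exp_ln; auto).
    pose proof (exp_ineq1_le ((p - 1) * z)) as H1. pose proof (exp_ineq1_le (- z)) as H2.
    replace (p * z) with (z + (p - 1) * z) by ring. rewrite exp_plus.
    pose proof (exp_pos z) as Hz.
    assert (E1 : exp z * exp (- z) = 1) by (rewrite <- exp_plus, Rplus_opp_r; apply exp_0).
    assert (exp z * (1 + (p - 1) * z) <= exp z * exp ((p - 1) * z)) by (apply Rmult_le_compat_l; lra).
    assert (exp z * (1 + - z) <= 1) by (rewrite <- E1; apply Rmult_le_compat_l; lra).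
    nra. }
  assert (Exm : rpow (x / m) p * rpow m p = rpow x p).
  { rewrite <- rpow_mult by lra. f_equal. field. lra. }
  assert (Hmp : 0 < rpow m p) by now apply rpow_pos.
  apply (Rmult_le_compat_r (rpow m p)) in H; [|lra].
  rewrite Rmult_plus_distr_r, Exm in H.
  replace (p * rpow m (p - 1) * x) with (p * (x / m) * rpow m p); auto.
  rewrite Em. field. lra.
Qed.

Definition dyadic_avg (v : Z -> R) (k : nat) (c : Z) : R := lsum (zseq c (2 ^ k)) v / 2 ^ k.

Lemma INR_pow2 k : INR (2 ^ k) = 2 ^ k.
Proof. rewrite pow_INR. reflexivity. Qed.

Lemma dyadic_avg_split v k c :
  2 * dyadic_avg v (S k) c = dyadic_avg v k c + dyadic_avg v k (c + Z.of_nat (2 ^ k)).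
Proof.
  unfold dyadic_avg. replace (2 ^ S k)%nat with (2 ^ k + 2 ^ k)%nat by (simpl; lia).
  rewrite zseq_app, lsum_app. simpl pow. field. apply pow_nonzero. lra.
Qed.

(** Witness form of the dyadic maximal function: t is at most the average of v over some interval
    containing y of the dyadic grid that starts at c, inside the block of length 2^k. *)
Definition dyadic_majorant (v : Z -> R) (k : nat) (c y : Z) (t : R) : Prop :=
  exists i j, (i <= k)%nat /\ (0 <= j)%Z /\ ((j + 1) * Z.of_nat (2 ^ i) <= Z.of_nat (2 ^ k))%Z /\
    (c + j * Z.of_nat (2 ^ i) <= y < c + (j + 1) * Z.of_nat (2 ^ i))%Z /\
    t <= dyadic_avg v i (c + j * Z.of_nat (2 ^ i)).

(** Induction on scales with a Bellman function: [m |-> (p-1) m^p - p m^(p-1) x] decreases up to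
    [m = x] and increases afterwards, so the running maximum [m] may be raised to the average
    [x] of a half whenever [x] exceeds it. *)
Lemma dyadic_maximal_induction (v tau : Z -> R) (p : R) : 1 < p ->
  (forall z, 0 <= v z) -> (forall z, 0 <= tau z) ->
  forall k c m, dyadic_avg v k c <= m ->
  (forall y, In y (zseq c (2 ^ k)) -> tau y <= m \/ dyadic_majorant v k c y (tau y)) ->
  (p - 1) * lsum (zseq c (2 ^ k)) (fun y => rpow (tau y) p) <=
  rpow 2 p * lsum (zseq c (2 ^ k)) (fun y => rpow (v y) p) +
  2 ^ k * (2 * (p - 1) * rpow m p - 2 * p * rpow m (p - 1) * dyadic_avg v k c).
Proof.
  intros Hp Hv Htau.
  assert (Havg : forall k c, 0 <= dyadic_avg v k c).
  { intros k c. apply Rle_mult_inv_pos; [now apply lsum_nonneg|apply pow_lt; lra]. }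
  induction k as [|k IH]; intros c m Hm Hy.
  - change (2 ^ 0)%nat with 1%nat in *.
    assert (Ez : zseq c 1 = [c]) by (unfold zseq; simpl; now rewrite Z.add_0_r).
    unfold dyadic_avg in *. change (2 ^ 0)%nat with 1%nat in *. rewrite Ez, !lsum_single in *.
    simpl pow in *. unfold Rdiv in *. rewrite Rinv_1, Rmult_1_r in *.
    assert (Ht : tau c <= m).
    { destruct (Hy c) as [H|(i & j & Hi & Hj & Hj1 & Hin & H)]; [now left|auto|].
      assert (i = 0)%nat by lia. subst i. change (Z.of_nat (2 ^ 0)) with 1%Z in *.
      assert (j = 0)%Z by lia. subst j. unfold dyadic_avg in H. change (2 ^ 0)%nat with 1%nat in H.
      replace (c + 0 * 1)%Z with c in H by ring. rewrite Ez, lsum_single in H. simpl in H. lra. }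
    (* This explains the doubled terms: one copy of (p - 1) m^p pays for tau^p, the other for
       Young's inequality at 2 v, which produces 2^p v^p. *)
    assert (HY := young_rpow p m (2 * v c)). specialize (Hv c).
    rewrite rpow_mult in HY by lra. specialize (Htau c).
    assert (rpow (tau c) p <= rpow m p) by (apply rpow_le; lra).
    assert ((p - 1) * rpow (tau c) p <= (p - 1) * rpow m p) by (apply Rmult_le_compat_l; lra).
    assert (p * rpow m (p - 1) * (2 * v c) <= (p - 1) * rpow m p + rpow 2 p * rpow (v c) p) by (apply HY; lra).
    lra.
  - set (c' := (c + Z.of_nat (2 ^ k))%Z).
    assert (E2 : (2 ^ S k)%nat = (2 ^ k + 2 ^ k)%nat) by (simpl; lia).
    assert (Hhalf : forall d, (d = c \/ d = c') ->
      (p - 1) * lsum (zseq d (2 ^ k)) (fun y => rpow (tau y) p) <=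
      rpow 2 p * lsum (zseq d (2 ^ k)) (fun y => rpow (v y) p) +
      2 ^ k * (2 * (p - 1) * rpow m p - 2 * p * rpow m (p - 1) * dyadic_avg v k d)).
    { intros d Hd. set (x := dyadic_avg v k d).
      assert (Hmaj : forall y, In y (zseq d (2 ^ k)) -> tau y <= m \/ dyadic_majorant v k d y (tau y)).
      { intros y Hyd. assert (Hyc : In y (zseq c (2 ^ S k))).
        { rewrite in_zseq in *. rewrite E2. unfold c' in Hd. lia. }
        destruct (Hy y Hyc) as [H|(i & j & Hi & Hj & Hj1 & Hin & H)]; auto.
        destruct (Nat.eq_dec i (S k)) as [->|Hik].
        (* At the top scale the only grid interval is the whole block, whose average is at most
           m. *)
        - left. assert (0 < 2 ^ S k)%nat by (apply Nat.neq_0_lt_0, Nat.pow_nonzero; lia).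
          assert (j = 0)%Z by nia. subst j. rewrite Z.mul_0_l, Z.add_0_r in H. lra.
        - right. apply in_zseq in Hyd.
          assert (Epow : (2 ^ k = 2 ^ (k - i) * 2 ^ i)%nat) by (rewrite <- Nat.pow_add_r; f_equal; lia).
          set (w := (2 ^ i)%nat) in *. set (D := (2 ^ (k - i))%nat) in *.
          assert (Hw : (0 < w)%nat) by (apply Nat.neq_0_lt_0, Nat.pow_nonzero; lia).
          rewrite Epow in Hyd. unfold c' in Hd. rewrite Epow in Hd. rewrite E2, Epow in Hj1.
          destruct Hd as [->| ->].
          + assert (j < Z.of_nat D)%Z by nia.
            exists i, j. fold w. repeat split; auto; try lia. rewrite Epow, Nat2Z.inj_mul. nia.
          + assert (Z.of_nat D < j + 1)%Z by nia.
            exists i, (j - Z.of_nat D)%Z. unfold c'. rewrite Epow. fold w.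
            replace (c + Z.of_nat (D * w) + (j - Z.of_nat D) * Z.of_nat w)%Z with (c + j * Z.of_nat w)%Z by nia.
            repeat split; auto; try lia. }
      destruct (Rle_dec x m) as [Hxm|Hxm].
      - now apply IH.
      - eapply Rle_trans; [apply (IH d x); [unfold x; lra|]|].
        + intros y Hyd. destruct (Hmaj y Hyd); [left; lra|now right].
        + fold x. apply Rplus_le_compat_l. apply Rmult_le_compat_l; [apply pow_le; lra|].
          assert (Hm0 : 0 <= m) by (specialize (Havg (S k) c); lra).
          assert (Hx0 : 0 <= x) by apply Havg.
          assert (HY := young_rpow p m x Hm0 Hx0 Hp).
          assert (Exx := rpow_pred x p ltac:(lra)).
          rewrite Exx in *. lra. }
    assert (H1 := Hhalf c (or_introl eq_refl)). assert (H2 := Hhalf c' (or_intror eq_refl)).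
    assert (Hsp := dyadic_avg_split v k c). fold c' in Hsp.
    rewrite E2, zseq_app, !lsum_app. fold c'.
    replace (dyadic_avg v (S k) c) with ((dyadic_avg v k c + dyadic_avg v k c') / 2) by lra.
    simpl pow. lra.
Qed.

(** Start the induction with m equal to the average x over the whole block: the remainder term is
    then 2^k times -2 x^p, at most 0. *)
Lemma dyadic_maximal (v tau : Z -> R) (p : R) k c : 1 < p ->
  (forall z, 0 <= v z) -> (forall z, 0 <= tau z) ->
  (forall y, In y (zseq c (2 ^ k)) -> tau y <= 0 \/ dyadic_majorant v k c y (tau y)) ->
  lsum (zseq c (2 ^ k)) (fun y => rpow (tau y) p) <=
  rpow 2 p / (p - 1) * lsum (zseq c (2 ^ k)) (fun y => rpow (v y) p).
Proof.
  intros Hp Hv Htau Hy. set (x := dyadic_avg v k c).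
  assert (Hx : 0 <= x).
  { apply Rle_mult_inv_pos; [now apply lsum_nonneg|apply pow_lt; lra]. }
  assert (H := dyadic_maximal_induction v tau p Hp Hv Htau k c x (Rle_refl _)). fold x in H.
  assert (Exx := rpow_pred x p ltac:(lra)).
  assert (Hneg : 2 ^ k * (2 * (p - 1) * rpow x p - 2 * p * rpow x (p - 1) * x) <= 0).
  { replace (2 * (p - 1) * rpow x p - 2 * p * rpow x (p - 1) * x) with (- (2 * rpow x p))
      by (rewrite Exx; ring).
    assert (0 <= 2 ^ k) by (apply pow_le; lra). pose proof (rpow_nonneg x p). nra. }
  apply Rmult_le_reg_l with (p - 1); [lra|].
  replace ((p - 1) * (rpow 2 p / (p - 1) * lsum (zseq c (2 ^ k)) (fun y => rpow (v y) p))) with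
    (rpow 2 p * lsum (zseq c (2 ^ k)) (fun y => rpow (v y) p)) by (field; lra).
  eapply Rle_trans; [apply H|lra].
  intros y Hin. destruct (Hy y Hin) as [H0|H0]; [left; lra|now right].
Qed.

(** [s] is one third of a power of two (up to rounding), so that at every scale [M] the grid
    shifted by [s] stays at distance about [M/3] from the unshifted one. *)
Lemma shifted_grid (M D s x N : Z) : (0 < M)%Z -> (3 * s + 1 = M * D)%Z -> (0 <= N)%Z ->
  (6 * N + 1 <= M)%Z -> (x mod M + 2 * N < M \/ (x + s) mod M + 2 * N < M)%Z.
Proof.
  intros HM Hs HN H6.
  pose proof (Z.mod_pos_bound x M HM) as Hx. pose proof (Z.mod_pos_bound s M HM) as Hr.
  pose proof (Z.div_mod s M ltac:(lia)) as Es.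
  rewrite Z.add_mod by lia.
  set (x0 := (x mod M)%Z) in *. set (r := (s mod M)%Z) in *. set (e := (D - 3 * (s / M))%Z).
  assert (He : (3 * r + 1 = M * e)%Z) by (unfold e; rewrite Es in Hs at 1; lia).
  assert (e = 1 \/ e = 2)%Z as Hee by nia.
  destruct (Z_lt_ge_dec (x0 + 2 * N) M) as [|Hge]; [now left|right].
  replace ((x0 + r) mod M)%Z with (x0 + r - M)%Z.
  - destruct Hee; subst e; nia.
  - apply Z.mod_unique with 1%Z; [left; destruct Hee; nia|ring].
Qed.

(** The lower bound is what [shifted_grid] needs for a window of radius N; the upper one keeps the
    dyadic interval comparable to the window. *)
Lemma scale_exists N : (1 <= N)%nat -> exists k : nat, (6 * N + 1 <= 2 ^ k <= 14 * N)%nat.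
Proof.
  intros HN. exists (Nat.log2_up (6 * N + 1)).
  destruct (Nat.log2_up_spec (6 * N + 1) ltac:(lia)) as [H1 H2].
  split; [exact H2|]. set (k := Nat.log2_up (6 * N + 1)) in *.
  destruct k as [|k]; simpl in *; lia.
Qed.

Lemma split_by {A : Type} (P Q : A -> Prop) (l : list A) : (forall a, In a l -> P a \/ Q a) ->
  exists l1 l2, Permutation l (l1 ++ l2) /\ Forall P l1 /\ Forall Q l2.
Proof.
  induction l as [|a l IH]; intros H.
  - exists [], []. auto.
  - destruct IH as (l1 & l2 & HP & H1 & H2); [intros; apply H; now right|].
    destruct (H a); [now left| |].
    + exists (a :: l1), l2. simpl. auto.
    + exists l1, (a :: l2). split; [|auto].
      eapply Permutation_trans; [apply perm_skip, HP|]. apply Permutation_middle.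
Qed.

Lemma dyadic_maximal_sublist (v T : Z -> R) (p : R) k c (l : list Z) : 1 < p ->
  (forall z, 0 <= v z) -> (forall z, 0 <= T z) -> NoDup l -> incl l (zseq c (2 ^ k)) ->
  Forall (fun y => T y <= 0 \/ dyadic_majorant v k c y (T y)) l ->
  lsum l (fun y => rpow (T y) p) <=
  rpow 2 p / (p - 1) * lsum (zseq c (2 ^ k)) (fun y => rpow (v y) p).
Proof.
  intros Hp Hv HT Hn Hi Hl. rewrite Forall_forall in Hl.
  set (tau := fun y => if in_dec Z.eq_dec y l then T y else 0).
  assert (Htau : forall y, 0 <= tau y) by (intros y; unfold tau; destruct (in_dec _ _ _); auto; lra).
  rewrite (lsum_ext l _ (fun y => rpow (tau y) p)).
  - eapply Rle_trans; [apply (lsum_incl l (zseq c (2 ^ k))); auto; intros; apply rpow_nonneg|].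
    apply dyadic_maximal; auto. intros y Hy. unfold tau. destruct (in_dec _ _ _); auto. left; lra.
  - intros y Hy. unfold tau. destruct (in_dec _ _ _); tauto.
Qed.

(** One-third trick: every window [y - N, y + N] lies in an interval of length at most 14 N of one
    of two dyadic grids, so the dyadic theorem is applied twice. This gives the factors 14^p and
    2. *)
Lemma hardy_littlewood (p : R) : 1 < p -> exists C, 0 < C /\
  forall (v T : Z -> R) (S : R) (Ny L : nat),
  (forall z, 0 <= v z) -> (forall z, 0 <= T z) ->
  (forall N, lsum (zrange N) (fun y => rpow (v y) p) <= S) ->
  (forall y, In y (zrange Ny) -> T y <= 0 \/
     exists N, (1 <= N <= L)%nat /\ T y <= lsum (zrange N) (fun a => v (y - a)%Z) / INR N) ->
  lsum (zrange Ny) (fun y => rpow (T y) p) <= C * S.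
Proof.
  intros Hp. exists (rpow 14 p * (2 * (rpow 2 p / (p - 1)))). split.
  { assert (0 < rpow 2 p / (p - 1)) by (apply Rdiv_lt_0_compat; [apply rpow_pos|]; lra).
    apply Rmult_lt_0_compat; [apply rpow_pos; lra|lra]. }
  intros v T S Ny L Hv HT HS Hy.
  (* [K] is even, so W = 2^K is 1 mod 3 and the shift s = (W - 1) / 3 is an integer. *)
  set (J := (Ny + 14 * L + 1)%nat). set (K := (2 * J)%nat).
  set (W := Z.of_nat (2 ^ K)).
  assert (HJ : (Z.of_nat J < W)%Z).
  { unfold W, K. assert (J < 2 ^ J)%nat by (apply Nat.pow_gt_lin_r; lia).
    assert (2 ^ J <= 2 ^ (2 * J))%nat by (apply Nat.pow_le_mono_r; lia). lia. }
  assert (Hs : exists s : Z, (3 * s + 1 = W)%Z).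
  { unfold W, K. generalize J. intros m. induction m as [|m (s & IH)]; [exists 0%Z; reflexivity|].
    exists (4 * s + 1)%Z. replace (2 * Datatypes.S m)%nat with (Datatypes.S (Datatypes.S (2 * m))) by lia.
    change (2 ^ Datatypes.S (Datatypes.S (2 * m)))%nat with (2 * (2 * 2 ^ (2 * m)))%nat. lia. }
  destruct Hs as (s & Hs).
  set (c0 := (- W)%Z). set (c1 := (- W - s)%Z). set (K2 := (K + 2)%nat).
  assert (HK2 : Z.of_nat (2 ^ K2) = (4 * W)%Z).
  { unfold K2, W. rewrite Nat.add_comm. change (2 ^ (2 + K))%nat with (2 * (2 * 2 ^ K))%nat. lia. }
  assert (Hblock : forall c, c = c0 \/ c = c1 -> lsum (zseq c (2 ^ K2)) (fun y => rpow (v y) p) <= S).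
  { intros c Hc. eapply Rle_trans; [|apply (HS (Z.to_nat (4 * W)))].
    apply lsum_incl; [apply NoDup_zseq| |intros; apply rpow_nonneg].
    intros y. rewrite in_zseq, in_zrange. unfold c0, c1 in Hc. lia. }
  (* The condition on the residue of the left end y - N says that the window does not cross a point
     of the grid starting at c. Passing to the average over the grid interval costs the factor
     14. *)
  assert (Hwin : forall (c y : Z) (N k : nat), c = c0 \/ c = c1 -> In y (zrange Ny) -> (1 <= N <= L)%nat ->
    (6 * N + 1 <= 2 ^ k <= 14 * N)%nat ->
    ((y - Z.of_nat N - c) mod Z.of_nat (2 ^ k) + 2 * Z.of_nat N < Z.of_nat (2 ^ k))%Z ->
    T y <= lsum (zrange N) (fun a => v (y - a)%Z) / INR N ->
    dyadic_majorant v K2 c y (T y / 14)).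
  { intros c y N k Hc Hyr HN Hk Hmod HTy. apply in_zrange in Hyr.
    set (M := (2 ^ k)%nat) in *.
    pose proof (Z.div_mod (y - Z.of_nat N - c) (Z.of_nat M) ltac:(lia)) as Ediv.
    pose proof (Z.mod_pos_bound (y - Z.of_nat N - c) (Z.of_nat M) ltac:(lia)) as Hr.
    set (j := ((y - Z.of_nat N - c) / Z.of_nat M)%Z) in *.
    set (rr := ((y - Z.of_nat N - c) mod Z.of_nat M)%Z) in *.
    assert (HkK : (k < K)%nat).
    { apply (Nat.pow_lt_mono_r_iff 2); [lia|]. fold M. unfold W in HJ. unfold J in HJ. lia. }
    assert (EW : exists D, W = (Z.of_nat M * D)%Z /\ (0 < D)%Z).
    { exists (Z.of_nat (2 ^ (K - k))). unfold W, M. rewrite <- Nat2Z.inj_mul, <- Nat.pow_add_r.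
      split; [do 2 f_equal; lia|]. pose proof (Nat.pow_nonzero 2 (K - k)). lia. }
    destruct EW as (D & EW & HD).
    assert (Hj0 : (0 <= j)%Z) by (apply Z.div_pos; unfold c0, c1, J in *; lia).
    exists k, j. fold M. split; [unfold K2; lia|]. split; [auto|]. split; [|split].
    - rewrite HK2, EW. assert (j * Z.of_nat M < 3 * W)%Z by (unfold c0, c1, J in *; lia).
      rewrite EW in H. assert (j < 3 * D)%Z by nia. nia.
    - lia.
    - unfold dyadic_avg. fold M.
      assert (HN0 : 0 < INR N) by (apply lt_0_INR; lia).
      assert (HM0 : 0 < 2 ^ k) by (apply pow_lt; lra).
      assert (HM14 : 2 ^ k <= 14 * INR N).
      { rewrite <- INR_pow2. replace 14 with (INR 14) by (simpl; ring). rewrite <- mult_INR.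
        apply le_INR. fold M. lia. }
      assert (Hsum : lsum (zrange N) (fun a => v (y - a)%Z) <= lsum (zseq (c + j * Z.of_nat M) M) v).
      { apply (lsum_inj_le (fun a => (y - a)%Z)); auto; [apply NoDup_zrange|intros; lia|].
        intros a Ha. apply in_zrange in Ha. apply in_zseq. lia. }
      set (X := lsum (zrange N) (fun a => v (y - a)%Z)) in *.
      assert (HX : 0 <= X) by (apply lsum_nonneg; auto).
      apply Rle_trans with (X / (14 * INR N)).
      + replace (X / (14 * INR N)) with (X / INR N / 14) by (field; lra). lra.
      + apply Rle_trans with (X / 2 ^ k).
        * apply Rmult_le_compat_l; auto. now apply Rinv_le_contravar.
        * apply Rmult_le_compat_r; auto. left. now apply Rinv_0_lt_compat. }
  destruct (split_by (fun y => T y / 14 <= 0 \/ dyadic_majorant v K2 c0 y (T y / 14))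
    (fun y => T y / 14 <= 0 \/ dyadic_majorant v K2 c1 y (T y / 14)) (zrange Ny)) as (l1 & l2 & HP & H1 & H2).
  { intros y Hyr. destruct (Hy y Hyr) as [H0|(N & HN & HTy)]; [left; left; lra|].
    destruct (scale_exists N) as (k & Hk); [lia|].
    assert (HkK : (k < K)%nat).
    { apply (Nat.pow_lt_mono_r_iff 2); [lia|]. unfold W in HJ. unfold J in HJ. lia. }
    destruct (shifted_grid (Z.of_nat (2 ^ k)) (Z.of_nat (2 ^ (K - k))) s (y - Z.of_nat N - c0) (Z.of_nat N)) as [H|H];
      try lia.
    - rewrite Hs. unfold W. rewrite <- Nat2Z.inj_mul, <- Nat.pow_add_r. do 2 f_equal. lia.
    - left; right. apply (Hwin c0 y N k); auto.
    - right; right. apply (Hwin c1 y N k); auto.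
      replace (y - Z.of_nat N - c1)%Z with (y - Z.of_nat N - c0 + s)%Z by (unfold c0, c1; ring). exact H. }
  assert (Hn : NoDup (l1 ++ l2)) by (eapply Permutation_NoDup; [exact HP|apply NoDup_zrange]).
  assert (Hin : forall y, In y (l1 ++ l2) -> In y (zrange Ny)).
  { intros y. apply Permutation_in. now symmetry. }
  rewrite (lsum_perm _ _ _ HP), lsum_app.
  assert (HT14 : forall z, 0 <= T z / 14) by (intros z; specialize (HT z); lra).
  assert (B1 := dyadic_maximal_sublist v (fun y => T y / 14) p K2 c0 l1 Hp Hv HT14 (NoDup_app_remove_r _ _ Hn)).
  assert (B2 := dyadic_maximal_sublist v (fun y => T y / 14) p K2 c1 l2 Hp Hv HT14 (NoDup_app_remove_l _ _ Hn)).
  assert (E : forall l, lsum l (fun y => rpow (T y) p) = rpow 14 p * lsum l (fun y => rpow (T y / 14) p)).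
  { intros l. rewrite <- lsum_scal. apply lsum_ext; intros y _.
    rewrite <- rpow_mult by (auto; lra). f_equal. field. }
  rewrite !E.
  assert (HA : 0 < rpow 2 p / (p - 1)) by (apply Rdiv_lt_0_compat; [apply rpow_pos|]; lra).
  assert (Q1 : lsum l1 (fun y => rpow (T y / 14) p) <= rpow 2 p / (p - 1) * S).
  { eapply Rle_trans; [apply B1; auto|apply Rmult_le_compat_l; [lra|auto]].
    intros y Hyl. assert (Hyr : In y (zrange Ny)) by (apply Hin, in_or_app; auto).
    apply in_zrange in Hyr. apply in_zseq. unfold c0, J in *. lia. }
  assert (Q2 : lsum l2 (fun y => rpow (T y / 14) p) <= rpow 2 p / (p - 1) * S).
  { eapply Rle_trans; [apply B2; auto|apply Rmult_le_compat_l; [lra|auto]].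
    intros y Hyl. assert (Hyr : In y (zrange Ny)) by (apply Hin, in_or_app; auto).
    apply in_zrange in Hyr. apply in_zseq. unfold c1, J in *. lia. }
  pose proof (rpow_nonneg 14 p). nra.
Qed.

(** * The maximal operator *)

Lemma fold_Rmax_nonneg l : 0 <= fold_right Rmax 0 l.
Proof. induction l; simpl; [lra|]. eapply Rle_trans; [exact IHl|apply Rmax_r]. Qed.

Lemma fold_Rmax_ge l x : In x l -> x <= fold_right Rmax 0 l.
Proof.
  induction l; simpl; [tauto|]. intros [->|H]; [apply Rmax_l|].
  eapply Rle_trans; [now apply IHl|apply Rmax_r].
Qed.

Lemma fold_Rmax_in l : fold_right Rmax 0 l = 0 \/ In (fold_right Rmax 0 l) l.
Proof.
  induction l as [|a l IH]; simpl; [now left|].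
  set (m := fold_right Rmax 0 l) in *. destruct (Rle_dec a m).
  - rewrite Rmax_right by auto. tauto.
  - rewrite Rmax_left by lra. tauto.
Qed.

Lemma Amax_trunc_ge n f L y lam : (1 <= lam <= L)%nat -> Cmod (Aavg n f lam y) <= Amax_trunc n f L y.
Proof.
  intros H. apply fold_Rmax_ge. apply in_map_iff. exists lam. split; auto. apply in_seq. lia.
Qed.

Lemma Amax_trunc_in n f L y : Amax_trunc n f L y = 0 \/
  exists lam, (1 <= lam <= L)%nat /\ Amax_trunc n f L y = Cmod (Aavg n f lam y).
Proof.
  destruct (fold_Rmax_in (map (fun lam => Cmod (Aavg n f lam y)) (seq 1 L))) as [H|H]; [now left|right].
  apply in_map_iff in H as (lam & H & Hl). apply in_seq in Hl. exists lam. split; [lia|]. symmetry; exact H.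
Qed.

Lemma Cmod_real t : 0 <= t -> Cmod (mkCx t 0) = t.
Proof. intros H. unfold Cmod. simpl. rewrite Rmult_0_l, Rplus_0_r. now apply sqrt_square. Qed.

Lemma Cmod_scale t z : 0 <= t -> Cmod (Cscale t z) = t * Cmod z.
Proof.
  intros H. unfold Cmod. transitivity (sqrt (t * t) * sqrt (Re z * Re z + Im z * Im z)).
  - rewrite <- sqrt_mult_alt by nra. f_equal. simpl. ring.
  - now rewrite sqrt_square.
Qed.

Lemma lprod_nonneg F x : (forall a, 0 <= F a) -> 0 <= lprod F x.
Proof. intros H. induction x as [|a x IH]; simpl; [lra|]. now apply Rmult_le_pos. Qed.

Lemma inv_INR_nonneg m : 0 <= / INR m.
Proof.
  destruct (pos_INR m) as [H|<-]; [left; now apply Rinv_0_lt_compat|rewrite Rinv_0; lra].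
Qed.

Lemma Aavg_real n (g : Z -> R) lam y : (forall a, 0 <= g a) ->
  Cmod (Aavg n (fun _ a => mkCx (g a) 0) lam y) =
  / INR (r n lam) * lsum (sphere n lam) (lprod (fun a => g (y - a)%Z)).
Proof.
  intros Hg.
  assert (Hp : forall x i, prodf (fun _ a => mkCx (g a) 0) i y x = mkCx (lprod (fun a => g (y - a)%Z) x) 0).
  { induction x as [|a x IH]; intros i; [reflexivity|]. simpl. rewrite IH. unfold Cmul. simpl. f_equal; ring. }
  assert (Hf : forall l, fold_right Cadd C0 (map (fun x => prodf (fun _ a => mkCx (g a) 0) 0 y x) l)
     = mkCx (lsum l (lprod (fun a => g (y - a)%Z))) 0).
  { induction l as [|x l IH]; [reflexivity|]. simpl. rewrite IH, Hp, lsum_cons. unfold Cadd. simpl. f_equal; ring. }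
  unfold Aavg. rewrite Hf.
  assert (H0 := inv_INR_nonneg (r n lam)).
  rewrite Cmod_scale, Cmod_real; auto.
  apply lsum_nonneg. intros; now apply lprod_nonneg.
Qed.

Lemma Cmod_Aavg_le n f lam y :
  Cmod (Aavg n f lam y) <= / INR (r n lam) * lsum (sphere n lam) (fun x => Cmod (prodf f 0 y x)).
Proof.
  assert (H0 := inv_INR_nonneg (r n lam)).
  unfold Aavg. rewrite Cmod_scale by auto. apply Rmult_le_compat_l; auto.
  induction (sphere n lam) as [|x l IH].
  - simpl. unfold C0. rewrite Cmod_real by lra. unfold lsum; simpl; lra.
  - simpl. rewrite lsum_cons. eapply Rle_trans; [apply Cmod_add|lra].
Qed.

Lemma prod_upto_const c n : prod_upto (fun _ => c) n = c ^ n.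
Proof. induction n as [|n IH]; simpl; [reflexivity|]. rewrite IH. ring. Qed.

Lemma prod_upto_pos M n : (forall i, (i < n)%nat -> 0 < M i) -> 0 < prod_upto M n.
Proof.
  induction n as [|n IH]; intros H; simpl; [lra|]. apply Rmult_lt_0_compat; [apply IH|apply H]; auto.
Qed.

(** Multiplying by [prod_upto M i] lets the induction run over the tail product starting at index i;
    at i = 0 this factor is 1. *)
Lemma Cmod_prodf_le f M F y n : (forall i a, (i < n)%nat -> Cmod (f i a) <= M i * F a) ->
  (forall a, 0 <= F a) -> (forall i, (i < n)%nat -> 0 < M i) ->
  forall x i, (i + length x <= n)%nat ->
  prod_upto M i * Cmod (prodf f i y x) <= prod_upto M (i + length x) * lprod (fun a => F (y - a)%Z) x.
Proof.
  intros Hf HF HM. induction x as [|a x IH]; intros i Hi.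
  - simpl. unfold Defs.C1. rewrite Nat.add_0_r, Cmod_real by lra. lra.
  - simpl in *. rewrite Cmod_mul. replace (i + S (length x))%nat with (S i + length x)%nat by lia.
    assert (H := IH (S i) ltac:(lia)). simpl prod_upto at 1 in H.
    assert (Hfa := Hf i (y - a)%Z ltac:(lia)).
    assert (0 < prod_upto M i) by (apply prod_upto_pos; intros; apply HM; lia).
    pose proof (Cmod_nonneg (prodf f (S i) y x)).
    assert (HFa := HF (y - a)%Z).
    apply Rle_trans with (F (y - a)%Z * (prod_upto M i * M i * Cmod (prodf f (S i) y x))).
    + replace (F (y - a)%Z * (prod_upto M i * M i * Cmod (prodf f (S i) y x))) with
        (prod_upto M i * (M i * F (y - a)%Z * Cmod (prodf f (S i) y x))) by ring.
      apply Rmult_le_compat_l; [lra|]. now apply Rmult_le_compat_r.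
    + replace (prod_upto M (S i + length x) * (F (y - a)%Z * lprod (fun a0 => F (y - a0)%Z) x)) with
        (F (y - a)%Z * (prod_upto M (S i + length x) * lprod (fun a0 => F (y - a0)%Z) x)) by ring.
      now apply Rmult_le_compat_l.
Qed.

(** The powers N^(n-2) in [sphere_upper] and [r_lower] cancel; N <= sqrt lam is the direction
    required in the lower bound. *)
Lemma average_bound n : (5 <= n)%nat -> exists C, 0 < C /\
  forall (f : nat -> Z -> Cx) (M : nat -> R) (F : Z -> R) lam y,
  (1 <= lam)%nat -> (forall i a, (i < n)%nat -> Cmod (f i a) <= M i * F a) ->
  (forall a, 0 <= F a) -> (forall i, (i < n)%nat -> 0 < M i) ->
  Cmod (Aavg n f lam y) <= prod_upto M n * C *
    rpow (lsum (zrange (Nat.sqrt lam)) (fun a => rpow (F (y - a)%Z) (8/9 * INR n)) / INR (Nat.sqrt lam)) (9/8).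
Proof.
  intros Hn. destruct (sphere_upper n Hn) as (C & HC & Hup). destruct (r_lower n Hn) as (c & Hc & Hlow).
  exists (C / c). split; [now apply Rdiv_lt_0_compat|].
  intros f M F lam y Hlam Hf HF HM.
  set (N := Nat.sqrt lam).
  assert (HN : (1 <= N)%nat) by (unfold N; apply (Nat.sqrt_le_mono 1 lam); auto).
  assert (HN1 : 1 <= INR N) by (apply (le_INR 1); auto).
  assert (HP : 0 < prod_upto M n) by now apply prod_upto_pos.
  assert (Hr : c * INR N ^ (n - 2) <= INR (r n lam)).
  { eapply Rle_trans; [|apply Hlow; auto]. apply Rmult_le_compat_l; [lra|].
    apply pow_incr. split; [lra|]. rewrite <- (sqrt_square (INR N)) by lra. apply sqrt_le_1_alt.
    rewrite <- mult_INR. apply le_INR. unfold N. apply Nat.sqrt_spec; lia. }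
  assert (HNn : 0 < INR N ^ (n - 2)) by (apply pow_lt; lra).
  assert (Hr0 : 0 < INR (r n lam)) by nra.
  assert (H := Hup lam (fun a => F (y - a)%Z) Hlam (fun a => HF _)). cbv zeta in H. fold N in H.
  set (Q := rpow _ (9/8)) in *. assert (HQ : 0 <= Q) by apply rpow_nonneg.
  eapply Rle_trans; [apply Cmod_Aavg_le|].
  apply Rle_trans with (/ INR (r n lam) * (prod_upto M n * lsum (sphere n lam) (lprod (fun a => F (y - a)%Z)))).
  - apply Rmult_le_compat_l; [left; now apply Rinv_0_lt_compat|]. rewrite <- lsum_scal.
    apply lsum_le; intros x Hx. apply in_sphere in Hx as [Hl _].
    assert (B := Cmod_prodf_le f M F y n Hf HF HM x 0). rewrite Hl in B. simpl in B.
    rewrite Rmult_1_l in B. apply B. lia.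
  - apply Rmult_le_reg_l with (INR (r n lam)); auto.
    rewrite <- Rmult_assoc, Rinv_r, Rmult_1_l by lra.
    apply Rle_trans with (prod_upto M n * (C * INR N ^ (n - 2) * Q)); [apply Rmult_le_compat_l; lra|].
    replace (prod_upto M n * (C * INR N ^ (n - 2) * Q)) with
      ((prod_upto M n * (C / c) * Q) * (c * INR N ^ (n - 2))) by (field; lra).
    rewrite (Rmult_comm (INR (r n lam))). apply Rmult_le_compat_l; auto.
    apply Rmult_le_pos; auto. apply Rmult_le_pos; [lra|]. left; now apply Rdiv_lt_0_compat.
Qed.

Lemma lp_norm_pointwise (p M : R) (g : Z -> Cx) y : 1 <= p -> 0 <= M ->
  lp_norm_le (PFin p) g M -> Cmod (g y) <= M.
Proof.
  intros Hp HM H. specialize (H (Z.to_nat (Z.abs y))).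
  assert (Hy : rpow (Cmod (g y)) p <= rpow M p).
  { eapply Rle_trans; [|exact H].
    apply (lsum_term (zrange (Z.to_nat (Z.abs y))) (fun y => rpow (Cmod (g y)) p)).
    - apply in_zrange. lia.
    - intros; apply rpow_nonneg. }
  apply Rnot_lt_le. intros HL.
  assert (E : forall t, 0 <= t -> rpow (rpow t p) (/ p) = t).
  { intros t Ht. rewrite rpow_rpow, Rinv_r by lra. now apply rpow_1. }
  assert (Hle : rpow (rpow (Cmod (g y)) p) (/ p) <= rpow (rpow M p) (/ p)).
  { apply rpow_le; auto. left. apply Rinv_0_lt_compat. lra. }
  rewrite !E in Hle by (auto; apply Cmod_nonneg). lra.
Qed.

(** The pointwise bound is A <= D W^(9/8) with W an average of v = F^(8n/9). Hence (A/D)^(8/9) is at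
    most a maximal average of v, and the maximal theorem is used at exponent 9q/8, greater than 1
    even for q = 1. *)
Lemma Astar_bounded_sufficient n p q : (5 <= n)%nat -> 1 <= q -> 1 <= p <= INR n * q ->
  Astar_bounded n (PFin p) q.
Proof.
  intros Hn Hq Hp. destruct (average_bound n Hn) as (C2 & HC2 & Havg).
  destruct (hardy_littlewood (9/8 * q)) as (C3 & HC3 & HHL); [lra|].
  assert (Hn0 : 0 < INR n) by (apply lt_0_INR; lia).
  exists (C2 * rpow (C3 * INR n) (/ q)).
  intros f M HfM Ny L.
  change (lsum (zrange Ny) (fun y => rpow (Amax_trunc n f L y) q) <=
     rpow (C2 * rpow (C3 * INR n) (/ q) * prod_upto M n) q).
  (* The functions are normalized by dividing by M i below, so a zero norm is treated first; then
     all averages vanish. *)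
  destruct (classic (exists i, (i < n)%nat /\ M i = 0)) as [(i & Hi & HMi)|HM0].
  { rewrite (lsum_ext _ _ (fun _ => 0)); [rewrite lsum_zero; apply rpow_nonneg|].
    intros y _. destruct (Amax_trunc_in n f L y) as [->|(lam & Hlam & ->)]; [apply rpow_0|].
    replace (Cmod (Aavg n f lam y)) with 0; [apply rpow_0|].
    apply Rle_antisym; [apply Cmod_nonneg|]. eapply Rle_trans; [apply Cmod_Aavg_le|].
    rewrite (lsum_ext _ _ (fun _ => 0)); [rewrite lsum_zero; lra|].
    intros x Hx. apply in_sphere in Hx as [Hl _].
    assert (Hz : forall a, Cmod (f i a) = 0).
    { intros a. destruct (HfM i Hi) as [H0 H1].
      assert (H := lp_norm_pointwise p (M i) (f i) a ltac:(lra) H0 H1).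
      pose proof (Cmod_nonneg (f i a)). lra. }
    assert (Hprod : forall x j, (j <= i < j + length x)%nat -> Cmod (prodf f j y x) = 0).
    { clear x Hl. induction x as [|a x IH]; intros j Hj; simpl in *; [lia|].
      rewrite Cmod_mul. destruct (Nat.eq_dec j i) as [->|Hji].
      - rewrite Hz. ring.
      - rewrite IH by lia. ring. }
    apply Hprod. lia. }
  assert (HM : forall i, (i < n)%nat -> 0 < M i).
  { intros i Hi. destruct (HfM i Hi) as [[H|H] _]; auto. exfalso. apply HM0. exists i. auto. }
  set (F := fun a => fold_right Rmax 0 (map (fun i => Cmod (f i a) / M i) (seq 0 n))).
  assert (HF0 : forall a, 0 <= F a) by (intros; apply fold_Rmax_nonneg).
  assert (HfF : forall i a, (i < n)%nat -> Cmod (f i a) <= M i * F a).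
  { intros i a Hi. specialize (HM i Hi).
    assert (H : Cmod (f i a) / M i <= F a).
    { apply fold_Rmax_ge. apply in_map_iff. exists i. split; auto. apply in_seq. lia. }
    apply (Rmult_le_compat_l (M i)) in H; [|lra].
    replace (M i * (Cmod (f i a) / M i)) with (Cmod (f i a)) in H by (field; lra). exact H. }
  set (v := fun z => rpow (F z) (8/9 * INR n)).
  assert (Hv : forall z, 0 <= v z) by (intros; apply rpow_nonneg).
  (* v^(9q/8) = F^(nq). The values |f_i| / M_i are at most 1, so p <= n q allows their power nq to
     be replaced by the power p, and each of the n functions then contributes at most 1. *)
  assert (HS : forall N, lsum (zrange N) (fun y => rpow (v y) (9/8 * q)) <= INR n).
  { intros N.
    apply Rle_trans with (lsum (zrange N) (fun y => lsum (seq 0 n) (fun i => rpow (Cmod (f i y) / M i) p))).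
    - apply lsum_le; intros y _. unfold v. rewrite rpow_rpow.
      replace (8/9 * INR n * (9/8 * q)) with (INR n * q) by field.
      unfold F. destruct (fold_Rmax_in (map (fun i => Cmod (f i y) / M i) (seq 0 n))) as [->|H].
      + rewrite rpow_0. apply lsum_nonneg; intros; apply rpow_nonneg.
      + apply in_map_iff in H as (i & <- & Hi).
        assert (Hi' := Hi). apply in_seq in Hi'. destruct (HfM i) as [H0 H1]; [lia|]. specialize (HM i ltac:(lia)).
        assert (HL := lp_norm_pointwise p (M i) (f i) y ltac:(lra) H0 H1).
        apply Rle_trans with (rpow (Cmod (f i y) / M i) p).
        * apply rpow_le_small; [|lra]. split.
          -- apply Rle_mult_inv_pos; [apply Cmod_nonneg|auto].
          -- apply Rmult_le_reg_r with (M i); auto. unfold Rdiv. rewrite Rmult_assoc, Rinv_l; lra.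
        * apply (lsum_term (seq 0 n) (fun i => rpow (Cmod (f i y) / M i) p)); auto. intros; apply rpow_nonneg.
    - rewrite lsum_exchange. apply Rle_trans with (lsum (seq 0 n) (fun _ => 1)).
      + apply lsum_le; intros i Hi. apply in_seq in Hi. destruct (HfM i) as [H0 H1]; [lia|].
        specialize (HM i ltac:(lia)). assert (HMp : 0 < rpow (M i) p) by now apply rpow_pos.
        rewrite (lsum_ext _ _ (fun y => / rpow (M i) p * rpow (Cmod (f i y)) p)).
        * rewrite lsum_scal. apply Rmult_le_reg_l with (rpow (M i) p); auto.
          rewrite <- Rmult_assoc, Rinv_r, Rmult_1_l, Rmult_1_r by lra. apply H1.
        * intros y _. unfold Rdiv. rewrite rpow_mult, rpow_inv by (auto; try apply Cmod_nonneg; left; now apply Rinv_0_lt_compat).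
          ring.
      + rewrite lsum_const, length_seq. lra. }
  assert (HP : 0 < prod_upto M n) by now apply prod_upto_pos.
  set (D := prod_upto M n * C2). assert (HD : 0 < D) by now apply Rmult_lt_0_compat.
  assert (HA0 : forall y, 0 <= Amax_trunc n f L y) by (intros; apply fold_Rmax_nonneg).
  set (T := fun y => rpow (Amax_trunc n f L y / D) (8/9)).
  assert (HAD : forall y, 0 <= Amax_trunc n f L y / D) by (intros; apply Rle_mult_inv_pos; auto).
  assert (B : lsum (zrange Ny) (fun y => rpow (T y) (9/8 * q)) <= C3 * INR n).
  { apply (HHL v T (INR n) Ny L); auto.
    - intros; apply rpow_nonneg.
    - intros y _. unfold T. destruct (Amax_trunc_in n f L y) as [->|(lam & Hlam & ->)].
      + left. unfold Rdiv at 1. rewrite Rmult_0_l, rpow_0. lra.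
      + right. exists (Nat.sqrt lam). split.
        * split; [apply (Nat.sqrt_le_mono 1 lam); lia|]. pose proof (Nat.sqrt_le_lin lam). lia.
        * assert (H := Havg f M F lam y ltac:(lia) HfF HF0 HM).
          set (W := lsum (zrange (Nat.sqrt lam)) (fun a => v (y - a)%Z) / INR (Nat.sqrt lam)).
          change (Cmod (Aavg n f lam y) <= D * rpow W (9/8)) in H.
          assert (HW : 0 <= W).
          { apply Rle_mult_inv_pos; [apply lsum_nonneg; auto|].
            apply lt_0_INR. pose proof (Nat.sqrt_le_mono 1 lam ltac:(lia)).
            change (Nat.sqrt 1) with 1%nat in *. lia. }
          apply Rle_trans with (rpow (rpow W (9/8)) (8/9)).
          -- apply rpow_le; [lra|]. apply Rmult_le_reg_r with D; auto.
             replace (Cmod (Aavg n f lam y) / D * D) with (Cmod (Aavg n f lam y)) by (field; lra). lra.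
          -- rewrite rpow_rpow. replace (9/8 * (8/9)) with 1 by field. rewrite rpow_1; lra. }
  rewrite (lsum_ext _ _ (fun y => rpow D q * rpow (T y) (9/8 * q))).
  - rewrite lsum_scal. replace (C2 * rpow (C3 * INR n) (/ q) * prod_upto M n) with (D * rpow (C3 * INR n) (/ q))
      by (unfold D; ring).
    assert (0 < C3 * INR n) by now apply Rmult_lt_0_compat.
    rewrite rpow_mult by (try apply rpow_nonneg; lra). rewrite rpow_rpow, Rinv_l, rpow_1 by lra.
    apply Rmult_le_compat_l; auto. apply rpow_nonneg.
  - intros y _. unfold T. rewrite rpow_rpow. replace (8/9 * (9/8 * q)) with q by field.
    rewrite <- rpow_mult by (auto; lra). f_equal. field. lra.
Qed.

(** * Necessity of the conditions *)

Lemma no_sublinear_bound D gamma : 0 <= gamma < 1 ->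
  ~ (forall K : nat, (1 <= K)%nat -> 2 * INR K - 1 <= D * rpow (2 * INR K + 1) gamma).
Proof.
  intros Hg H.
  (* For X = 2 K + 1 >= 3 one has X <= 3 (2 K - 1), whence the 3; the maximum with 1 keeps [E]
     positive. *)
  set (E := 3 * Rmax D 1).
  assert (HE : 3 <= E) by (unfold E; pose proof (Rmax_r D 1); lra).
  destruct (INR_unbounded (rpow E (/ (1 - gamma)))) as (K & HK).
  assert (HK1 : (1 <= K)%nat).
  { destruct K; [|lia]. pose proof (rpow_nonneg E (/ (1 - gamma))). simpl in HK. lra. }
  specialize (H K HK1). assert (HK1' : 1 <= INR K) by (apply (le_INR 1); auto).
  set (X := 2 * INR K + 1) in *.
  assert (HX : 3 <= X) by (unfold X; lra).
  assert (HXg : 0 < rpow X gamma) by (apply rpow_pos; lra).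
  assert (H1 : X <= E * rpow X gamma).
  { unfold E. pose proof (Rmax_l D 1).
    assert (D * rpow X gamma <= Rmax D 1 * rpow X gamma) by (apply Rmult_le_compat_r; lra).
    unfold X in *. lra. }
  assert (H2 : rpow X (1 - gamma) <= E).
  { apply Rmult_le_reg_r with (rpow X gamma); auto. rewrite <- rpow_plus.
    replace (1 - gamma + gamma) with 1 by ring. rewrite rpow_1; lra. }
  assert (H3 : rpow (rpow X (1 - gamma)) (/ (1 - gamma)) <= rpow E (/ (1 - gamma))).
  { apply rpow_le; auto. left. apply Rinv_0_lt_compat. lra. }
  rewrite rpow_rpow, Rinv_r, rpow_1 in H3 by lra. unfold X in H3. lra.
Qed.

Lemma lprod_one F x : (forall a, In a x -> F a = 1) -> lprod F x = 1.
Proof.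
  intros H. induction x as [|a x IH]; [reflexivity|]. simpl.
  rewrite H, IH by (simpl; auto; intros; apply H; now right). ring.
Qed.

Lemma sphere_one_pos n : (1 <= n)%nat -> 0 < INR (r n 1).
Proof.
  intros Hn. apply lt_0_INR.
  assert (H : In (1%Z :: repeat 0%Z (n - 1)) (sphere n 1)).
  { apply in_sphere. simpl length. rewrite repeat_length. split; [lia|]. simpl.
    assert (E : forall m, sumsq (repeat 0%Z m) = 0%Z) by (induction m; simpl; lia).
    rewrite E. reflexivity. }
  unfold r. destruct (sphere n 1); [destruct H|simpl; lia].
Qed.

(** Testing on the indicator of [[-K, K]], for which [A_1 = 1] on [[-(K-1), K-1]]. *)
Lemma interval_test n p q K C (M : R) : (1 <= n)%nat -> (1 <= K)%nat -> 0 <= M ->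
  (forall (f : nat -> Z -> Cx) (M : nat -> R),
    (forall i, (i < n)%nat -> 0 <= M i /\ lp_norm_le p (f i) (M i)) ->
    forall N L : nat,
      Rsum_list (map (fun y => rpow (Amax_trunc n f L y) q) (zrange N))
        <= rpow (C * prod_upto M n) q) ->
  lp_norm_le p (fun y => mkCx (indic (Z.abs y <=? Z.of_nat K)%Z) 0) M -> 0 <= q ->
  2 * INR K - 1 <= rpow (Rmax C 1) q * rpow M (INR n * q).
Proof.
  intros Hn HK HM H Hnorm Hq.
  set (g := fun y => indic (Z.abs y <=? Z.of_nat K)%Z) in *.
  assert (Hg : forall y, 0 <= g y) by (intros; apply indic_nonneg).
  specialize (H (fun _ y => mkCx (g y) 0) (fun _ => M) (fun _ _ => conj HM Hnorm) (K - 1)%nat 1%nat).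
  rewrite prod_upto_const in H.
  apply Rle_trans with (rpow (C * M ^ n) q).
  - eapply Rle_trans; [|exact H].
    apply Rle_trans with (lsum (zrange (K - 1)) (fun _ => 1)).
    + rewrite lsum_const, length_zrange, plus_INR, mult_INR, minus_INR by lia. simpl. lra.
    + apply (lsum_le _ _ (fun y => rpow (Amax_trunc n (fun _ y => mkCx (g y) 0) 1 y) q)).
      intros y Hy. apply in_zrange in Hy.
      rewrite <- (rpow_one q). apply rpow_le; auto.
      eapply Rle_trans; [|apply (Amax_trunc_ge n _ 1 y 1); lia].
      rewrite Aavg_real by auto.
      rewrite (lsum_ext _ _ (fun _ => 1)).
      * rewrite <- length_lsum. fold (r n 1). rewrite Rinv_l; [lra|].
        pose proof (sphere_one_pos n Hn). lra.
      * intros x Hx. apply lprod_one. intros a Ha. apply in_sphere in Hx as [_ Hs].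
        apply sumsq_coord in Ha. rewrite Hs in Ha. unfold g.
        replace (Z.abs (y - a) <=? Z.of_nat K)%Z with true; [reflexivity|].
        symmetry. apply Z.leb_le. nia.
  - assert (HMn : 0 <= M ^ n) by now apply pow_le.
    (* The constant [C] may be negative, and [rpow_mult] requires nonnegative factors. *)
    apply Rle_trans with (rpow (Rmax C 1 * M ^ n) q).
    + apply rpow_le; auto. apply Rmult_le_compat_r; auto. apply Rmax_l.
    + rewrite rpow_mult by (auto; pose proof (Rmax_r C 1); lra).
      apply Rmult_le_compat_l; [apply rpow_nonneg|]. right.
      destruct HM as [HM|<-].
      * rewrite <- rpow_INR, rpow_rpow by auto. reflexivity.
      * rewrite pow_i, !rpow_0 by lia. reflexivity.
Qed.

(** The indicator of [-K, K] has norm (2 K + 1)^(1/p), so boundedness gives 2 K - 1 <= D (2 K +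
    1)^(nq/p) for all K, impossible if nq/p < 1. For p infinite the norm is 1 and the exponent is
    0. *)
Lemma Astar_bounded_exponent n p q : (1 <= n)%nat -> 1 <= q -> exp_ge1 p ->
  Astar_bounded n p q -> exp_le p (INR n * q).
Proof.
  intros Hn Hq Hp (C & HC).
  assert (HnR : 1 <= INR n) by (apply (le_INR 1); auto).
  destruct p as [p|]; simpl in *.
  - apply Rnot_lt_le. intros Hlt.
    apply (no_sublinear_bound (rpow (Rmax C 1) q) (INR n * q / p)).
    + split; [apply Rle_mult_inv_pos; nra|].
      apply Rmult_lt_reg_r with p; [lra|]. unfold Rdiv. rewrite Rmult_assoc, Rinv_l; lra.
    + intros K HK. assert (HK1 : 1 <= INR K) by (apply (le_INR 1); auto).
      replace (rpow (2 * INR K + 1) (INR n * q / p)) with (rpow (rpow (2 * INR K + 1) (/ p)) (INR n * q))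
        by (rewrite rpow_rpow; f_equal; field; lra).
      apply (interval_test n (PFin p) q K C); auto; try lra; [apply rpow_nonneg|].
      intros N. rewrite rpow_rpow, Rinv_l, rpow_1 by lra.
      apply Rle_trans with (lsum (zrange N) (fun y => indic (Z.abs y <=? Z.of_nat K)%Z * 1)).
      * right. apply (lsum_ext (zrange N) (fun y => rpow (Cmod (mkCx (indic (Z.abs y <=? Z.of_nat K)%Z) 0)) p)).
        intros y _. rewrite Cmod_real by apply indic_nonneg.
        destruct (Z.abs y <=? Z.of_nat K)%Z; simpl; rewrite ?rpow_one, ?rpow_0; ring.
      * rewrite <- lsum_filter, <- length_lsum.
        replace (2 * INR K + 1) with (INR (length (zrange K)))
          by (rewrite length_zrange, plus_INR, mult_INR; simpl; ring).
        apply le_INR. apply NoDup_incl_length; [apply NoDup_filter, NoDup_zrange|].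
        intros y Hy. apply filter_In in Hy as [_ Hy]. apply in_zrange. now apply Z.leb_le.
  - apply (no_sublinear_bound (rpow (Rmax C 1) q) 0); [lra|].
    intros K HK. assert (HK1 : 1 <= INR K) by (apply (le_INR 1); auto).
    replace (rpow (2 * INR K + 1) 0) with (rpow 1 (INR n * q))
      by (rewrite rpow_one, rpow_zero_exp; lra).
    apply (interval_test n PInf q K C); auto; try lra.
    intros y. rewrite Cmod_real by apply indic_nonneg. destruct (_ <=? _)%Z; simpl; lra.
Qed.

(** The averages of delta functions at [(y, y, y, y)], [y = 2^k], stay bounded below, since the
    sphere of squared radius [4^(k+1)] in dimension 4 has a bounded number of points. *)
Lemma Astar_unbounded_4 p q : 1 <= q -> exp_ge1 p -> ~ Astar_bounded 4 p q.
Proof.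
  intros Hq Hp (C & HC).
  set (g := fun y => indic (y =? 0)%Z).
  assert (Hg : forall y, 0 <= g y) by (intros; apply indic_nonneg).
  assert (Hnorm : lp_norm_le p (fun y => mkCx (g y) 0) 1).
  { destruct p as [p|]; simpl in *.
    - intros N. rewrite rpow_one.
      change (lsum (zrange N) (fun y => rpow (Cmod (mkCx (g y) 0)) p) <= 1).
      rewrite (lsum_ext _ _ (fun y => indic (y =? 0)%Z * 1)).
      + rewrite <- lsum_filter, <- length_lsum. replace 1 with (INR (length [0%Z])) by reflexivity.
        apply le_INR. apply NoDup_incl_length; [apply NoDup_filter, NoDup_zrange|].
        intros y Hy. apply filter_In in Hy as [_ Hy]. apply Z.eqb_eq in Hy. left. congruence.
      + intros y _. rewrite Cmod_real by auto. unfold g.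
        destruct (y =? 0)%Z; simpl; rewrite ?rpow_one, ?rpow_0; ring.
    - intros y. rewrite Cmod_real by auto. unfold g. destruct (_ =? _)%Z; simpl; lra. }
  set (c := / INR (r 4 4)).
  assert (Hr4 : 0 < INR (r 4 4)).
  { apply lt_0_INR. unfold r. assert (H : In [1; 1; 1; 1]%Z (sphere 4 4)) by (apply in_sphere; split; reflexivity).
    destruct (sphere 4 4); [destruct H|simpl; lia]. }
  assert (Hc : 0 < c) by now apply Rinv_0_lt_compat.
  assert (Hcq : 0 < rpow c q) by now apply rpow_pos.
  assert (Hbig : forall K : nat, INR K * rpow c q <= rpow (C * 1) q).
  { intros K.
    specialize (HC (fun _ y => mkCx (g y) 0) (fun _ => 1)
      (fun _ _ => conj (Rlt_le _ _ Rlt_0_1) Hnorm) (2 ^ K)%nat (4 ^ (K + 1))%nat).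
    rewrite prod_upto_const, pow1 in HC. eapply Rle_trans; [|exact HC].
    set (T := fun y => rpow (Amax_trunc 4 (fun _ y => mkCx (g y) 0) (4 ^ (K + 1)) y) q).
    (* Only the points y = 2^k with k < K are kept. Each contributes at least c^q, so the sum grows
       linearly in [K] while the norms of the delta functions stay 1. *)
    apply Rle_trans with (lsum (seq 0 K) (fun k => T (Z.of_nat (2 ^ k)))).
    - rewrite <- (length_seq K 0) at 1. rewrite Rmult_comm, <- lsum_const. apply lsum_le; intros k Hk.
      apply in_seq in Hk. unfold T. apply rpow_le; [lra|].
      assert (Hlam : (1 <= 4 ^ (k + 1) <= 4 ^ (K + 1))%nat).
      { split; [pose proof (Nat.pow_nonzero 4 (k + 1)); lia|apply Nat.pow_le_mono_r; lia]. }
      eapply Rle_trans; [|apply (Amax_trunc_ge _ _ _ _ _ Hlam)].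
      rewrite Aavg_real by auto. set (y := Z.of_nat (2 ^ k)).
      assert (Hx : In [y; y; y; y] (sphere 4 (4 ^ (k + 1)))).
      { apply in_sphere. split; [reflexivity|]. simpl sumsq.
        rewrite Nat.add_1_r, Nat.pow_succ_r', (Nat.pow_mul_l 2 2 k : 4 ^ k = _)%nat. unfold y. lia. }
      assert (Hrk : 0 < INR (r 4 (4 ^ (k + 1)))).
      { apply lt_0_INR. unfold r. destruct (sphere 4 (4 ^ (k + 1))); [destruct Hx|simpl; lia]. }
      assert (Hs : 1 <= lsum (sphere 4 (4 ^ (k + 1))) (lprod (fun a => g (y - a)%Z))).
      { rewrite <- (lprod_one (fun a => g (y - a)%Z) [y; y; y; y]).
        - apply (lsum_term _ (lprod (fun a => g (y - a)%Z))); auto. intros; now apply lprod_nonneg.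
        - intros a Ha. simpl in Ha. replace a with y by tauto. rewrite Z.sub_diag. reflexivity. }
      assert (Hinv : c <= / INR (r 4 (4 ^ (k + 1)))).
      { apply Rinv_le_contravar; auto. apply le_INR, r4_pow4. }
      nra.
    - apply (lsum_inj_le (fun k => Z.of_nat (2 ^ k)) (seq 0 K) (zrange (2 ^ K)) T).
      + apply seq_NoDup.
      + intros k k' _ _ E. apply Nat2Z.inj in E. apply Nat.pow_inj_r in E; auto.
      + intros k Hk. apply in_seq in Hk. apply in_zrange.
        assert (2 ^ k <= 2 ^ K)%nat by (apply Nat.pow_le_mono_r; lia). lia.
      + intros; apply rpow_nonneg. }
  destruct (INR_unbounded (rpow (C * 1) q / rpow c q)) as (K & HK).
  specialize (Hbig K). apply (Rmult_lt_compat_r (rpow c q)) in HK; auto.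
  unfold Rdiv in HK. rewrite Rmult_assoc, Rinv_l in HK; lra.
Qed.

Theorem theorem1 (n : nat) (p : exponent) (q : R) :
  (4 <= n)%nat -> 1 <= q -> exp_ge1 p ->
  (Astar_bounded n p q <-> ((5 <= n)%nat /\ exp_le p (INR n * q))).
Proof.
  intros Hn Hq Hp. split.
  - intros H. split.
    + destruct (Nat.eq_dec n 4) as [->|]; [|lia]. exfalso. now apply (Astar_unbounded_4 p q).
    + apply Astar_bounded_exponent; auto. lia.
  - intros [Hn5 Hle]. destruct p as [p|]; [|destruct Hle].
    apply Astar_bounded_sufficient; auto.
Qed.
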